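(* Let $X$ be a set of taxa and let $\sigma^+=(\psi^+,\lambda^+)$ be a rooted binary metric species tree on $X$. If $|X|\ge 5$, then the distribution $\mathbb P_{\sigma^+}$ of unrooted topological gene trees under the multispecies coalescent model, with one lineage sampled per taxon, determines the rooted metric species tree $\sigma^+$: if $\sigma_1^+,\sigma_2^+$ are rooted binary metric species trees on $X$ with $\mathbb P_{\sigma_1^+}=\mathbb P_{\sigma_2^+}$, then $\sigma_1^+=\sigma_2^+$. This means equal rooted leaf-labeled topologies and equal lengths on all internal edges. If $|X|=4$, then $\mathbb P_{\sigma^+}$ determines the unrooted metric species tree $\sigma^-$, but does not determine $\sigma^+$: there exist rooted binary metric species trees $\sigma_1^+\neq\sigma_2^+$ on $X$ with $\mathbb P_{\sigma_1^+}=\mathbb P_{\sigma_2^+}$.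
   Context: Let $X$ be a finite set of $n$ taxa. A rooted binary metric species tree on $X$ is a pair $\sigma^+=(\psi^+,\lambda^+)$. Here $\psi^+$ is a rooted binary tree topology whose leaves are bijectively labeled by $X$, and $\lambda^+$ assigns a strictly positive length, in coalescent units, to each of its $n-2$ internal (non-pendant) edges. Pendant edge lengths are not specified. Multispecies coalescent model with one lineage per taxon. Each edge of the species tree is a population, and there is additionally a population above the root of infinite duration. One gene lineage starts at each leaf, and no coalescence occurs on pendant edges. Going backward in time, the lineages entering an internal edge are those exiting its child edges. Within that edge, during a time equal to its length, each pair of the lineages currently present coalesces at rate 1, so with $i$ lineages the total coalescence rate is $\binom{i}{2}$ and the merging pair is uniformly random. In the population above the root, lineages coalesce in the same way until one remains. This yields a random rooted binary gene tree whose leaves are labeled by the taxa (gene $A$ sampled from taxon $a$, etc.). Forgetting the root gives an unrooted binary leaf-labeled topological gene tree. $\mathbb P_{\sigma^+}$ denotes the resulting probability distribution on the set $\mathcal T_X$ of unrooted binary leaf-labeled tree topologies on $X$. The unrooted metric species tree $\sigma^-=(\psi^-,\lambda^-)$ is obtained from $\sigma^+$ by suppressing the root: - $\psi^-$ is the underlying unrooted leaf-labeled topology. - If the root is incident to two internal edges, these merge into one internal edge whose length is the sum of their lengths. - If the root is incident to a pendant edge, the merged edge is pendant and carries no length. - All other internal edges keep their lengths. *)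

(* Defs.v *)
From HB Require Import structures.
From mathcomp Require Import all_boot all_order all_algebra.
From mathcomp Require Import all_classical all_reals all_analysis.
Set Implicit Arguments. Unset Strict Implicit. Unset Printing Implicit Defensive.
Import Order.TTheory GRing.Theory Num.Theory numFieldNormedType.Exports.
Local Open Scope ring_scope.

Section MSC.
Variables (R : realType) (X : finType).

(* A rooted binary tree topology on X, encoded by its cluster system
   (the sets of leaves below each vertex). *)
Definition is_rbt (C : {set {set X}}) : Prop :=
  [/\ [set: X] \in C,
      (forall a : X, [set a] \in C),
      finset.set0 \notin C,
      (forall A B, A \in C -> B \in C ->
         [|| A \subset B, B \subset A | [disjoint A & B]]) &
      (* binary: every non-leaf vertex has exactly two children, i.e. its
         cluster is the disjoint union of two clusters *)
      (forall A, A \in C -> (1 < #|A|)%N ->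
         exists B1 B2, [/\ B1 \in C, B2 \in C, [disjoint B1 & B2]
                         & B1 :|: B2 = A])].

(* clusters of internal (non-pendant, non-root) edges of the rooted tree *)
Definition internal (A : {set X}) : bool := (1 < #|A|)%N && (#|A| < #|X|)%N.

(* rooted metric species tree: topology + lengths (only the values on
   internal clusters matter) *)
Definition rmst := ({set {set X}} * ({set X} -> R))%type.

Definition is_rmst (s : rmst) : Prop :=
  is_rbt s.1 /\ forall A, A \in s.1 -> internal A -> 0 < s.2 A.

Definition child (C : {set {set X}}) (A B : {set X}) : bool :=
  [&& B \in C, B \proper A & [forall D in C, ~~ ((B \proper D) && (D \proper A))]].

(* Coalescent state: (current lineages, each a set of taxa;
                      clusters formed by coalescences so far). *)
Definition state := ({set {set X}} * {set {set X}})%type.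

Definition merge (s : state) (B1 B2 : {set X}) : state :=
  ((B1 :|: B2) |: ((s.1 :\ B1) :\ B2), (B1 :|: B2) |: s.2).

(* each (unordered) pair of present lineages coalesces at rate 1 *)
Definition rate (s s' : state) : R :=
  (#|[set p : {set X} * {set X} |
      [&& p.1 \in s.1, p.2 \in s.1, p.1 != p.2 & merge s p.1 p.2 == s']]|)%:R / 2.

Definition gen (s s' : state) : R :=
  if s == s' then - \sum_(u : state | u != s) rate s u else rate s s'.

Fixpoint genpow (k : nat) (s s' : state) : R :=
  match k with
  | 0 => ((s == s')%:R)
  | k.+1 => \sum_(u : state) genpow k s u * gen u s'
  end.

Definition trans (t : R) (s s' : state) : R :=
  limn (series (fun k => t ^+ k / (k`!)%:R * genpow k s s')).

(* population above the root: infinite duration *)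
Definition trans_root (s s' : state) : R :=
  lim (trans t s s' @[t --> +oo])%classic.

(* lineages entering the population above A: those exiting its children *)
Definition enter (C : {set {set X}}) (f : {ffun {set X} -> state}) (A : {set X})
  : state :=
  (\bigcup_(B | child C A B) (f B).1, \bigcup_(B | child C A B) (f B).2).

(* joint probability that the exiting state of each population A is f A
   (independent populations; no coalescence on pendant edges) *)
Definition weight (sg : rmst) (f : {ffun {set X} -> state}) : R :=
  \prod_(A : {set X})
    (if A \in sg.1 then
       (if #|A| == 1%N then ((f A == ([set A], finset.set0))%:R)
        else if A == [set: X] then trans_root (enter sg.1 f A) (f A)
        else trans (sg.2 A) (enter sg.1 f A) (f A))
     else ((f A == (finset.set0, finset.set0))%:R)).

Definition rooted_gene (s : state) : {set {set X}} :=
  s.2 :|: [set [set a] | a : X].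

(* unrooted topology: the split system {A, ~A} of a cluster system *)
Definition unroot (K : {set {set X}}) : {set {set X}} :=
  K :|: [set ~: B | B in K].

(* P_{sigma^+}(T): probability of unrooted gene tree topology T
   (a split system; zero outside the unrooted binary topologies) *)
Definition gtprob (sg : rmst) (T : {set {set X}}) : R :=
  \sum_(f : {ffun {set X} -> state} | unroot (rooted_gene (f [set: X])) == T)
    weight sg f.

Definition same_rooted (s1 s2 : rmst) : Prop :=
  s1.1 = s2.1 /\ forall A, A \in s1.1 -> internal A -> s1.2 A = s2.2 A.

(* unrooted metric species tree: internal splits and root-suppressed lengths *)
Definition uinternal (A : {set X}) : bool := (1 < #|A|)%N && (#|A|.+1 < #|X|)%N.

Definition ulen (s : rmst) (A : {set X}) : R :=
  (if (A \in s.1) && internal A then s.2 A else 0) +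
  (if (~: A \in s.1) && internal (~: A) then s.2 (~: A) else 0).

Definition same_unrooted (s1 s2 : rmst) : Prop :=
  unroot s1.1 = unroot s2.1 /\
  forall A, A \in unroot s1.1 -> uinternal A -> ulen s1 A = ulen s2 A.

End MSC.

(* Main.v *)
(* A function [phi] of the coalescent state with [Q phi = - k phi] satisfies
   [exp (t Q) phi = exp (- k t) phi].  Let [S] be a set of taxa.  The indicator
   that the lineages of [S] are still distinct is such an eigenfunction, with
   [k] the number of pairs in [S], and the probability that the gene tree
   eventually displays a given topology on [S] is harmonic ([k = 0]).  At the most
   recent common ancestor of [S] such a function splits into products of
   eigenfunctions for the two subtrees, so its mean is computed recursively as
   a polynomial in exponentials of differences of [D], where [D a b] is the
   depth below the root of the common ancestor of [a] and [b].

   Quartet probabilities determine [D a b + D c d - D a c - D b d], that is, the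
   unrooted metric tree.  On five taxa with unrooted species tree ab|c|de, the
   probability [M v] that [v] is the middle leaf of the gene tree locates the
   root: [M a - M b] is positive, zero or negative as the root is on the pendant
   edge of [a], on neither, or on that of [b], likewise [M d - M e]; [M a - M d]
   tells the two internal edges from the pendant edge of [c]; and the values
   give the position on the edge.  Hence [D] is known up to a constant, which vanishes since [D] is 0 for
   taxa separated by the root, and [D] determines the clusters and lengths. *)
From Pilot Require Import Defs.
From HB Require Import structures.
From mathcomp Require Import all_boot all_order all_algebra.
From mathcomp Require Import all_classical all_reals all_analysis.
From mathcomp Require Import zify ring lra.
Set Implicit Arguments. Unset Strict Implicit. Unset Printing Implicit Defensive.
Import Order.TTheory GRing.Theory Num.Theory numFieldNormedType.Exports.
Import mathcomp.boot.fintype mathcomp.boot.finset.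
Local Open Scope ring_scope.

Local Notation cmerge := Pilot.Defs.merge.

Ltac dist u := let e := fresh in
  by apply/eqP => e; move: (u); rewrite e /= !inE ?eqxx ?orbT ?andbF.
Ltac memt := by rewrite !inE ?eqxx ?orbT.
Ltac vmt := by vm_cast_no_check (erefl true).
Ltac permt := let P := fresh in apply/permP => P /=;
  repeat match goal with |- context [nat_of_bool (P ?x)] => generalize (nat_of_bool (P x)) end;
  clear; intros; lia.

(** * The semigroup of the coalescent generator *)

Section Generator.
Variables (R : realType) (X : finType).
Implicit Types (phi psi : state X -> R) (s u : state X) (t : R).

Definition lpairs s : {set {set X} * {set X}} :=
  [set p | [&& p.1 \in s.1, p.2 \in s.1 & p.1 != p.2]].

Definition Qop phi s : R := \sum_u gen R s u * phi u.

Lemma rateE s u :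
  rate R s u = (\sum_(p in lpairs s) (cmerge s p.1 p.2 == u)%:R) / 2.
Proof.
rewrite /rate; congr (_ / _); rewrite -natr_sum -sum1_card big_mkcond /=.
rewrite [in RHS]big_mkcond /=; congr (_%:R); apply: eq_bigr => p _.
by rewrite !inE; case: (p.1 \in _); case: (p.2 \in _); case: (p.1 != p.2);
  case: (_ == u).
Qed.

Lemma QopE phi s :
  Qop phi s = (\sum_(p in lpairs s) (phi (cmerge s p.1 p.2) - phi s)) / 2.
Proof.
have -> : Qop phi s = \sum_u rate R s u * (phi u - phi s).
  rewrite /Qop (bigD1 s) //= [RHS](bigD1 s) //= subrr mulr0 add0r.
  rewrite {1}/gen eqxx mulNr mulr_suml -sumrN -big_split /=.
  apply: eq_bigr => u us; rewrite /gen eq_sym (negbTE us); ring.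
under eq_bigr do rewrite rateE -mulrA mulrC -mulrA mulrC mulr_sumr.
rewrite -mulr_suml exchange_big /=; congr (_ / _); apply: eq_bigr => p _.
rewrite (bigD1 (cmerge s p.1 p.2)) //= eqxx mulr1 big1 ?addr0 // => u.
by rewrite eq_sym => /negbTE ->; rewrite mulr0.
Qed.

Lemma iter_QopE k phi s : iter k Qop phi s = \sum_u genpow R k s u * phi u.
Proof.
elim: k phi s => [|k IH] phi s.
  rewrite /= (bigD1 s) //= eqxx mul1r big1 ?addr0 // => u.
  by rewrite eq_sym => /negbTE ->; rewrite mul0r.
rewrite iterSr IH /=.
under [RHS]eq_bigr do rewrite mulr_suml.
rewrite exchange_big /=; apply: eq_bigr => v _; rewrite /Qop mulr_sumr.
by apply: eq_bigr => u _; rewrite mulrA.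
Qed.

Lemma cmerge_card s p : p \in lpairs s -> (#|(cmerge s p.1 p.2).1| < #|s.1|)%N.
Proof.
rewrite inE => /and3P[h1 h2 h12]; rewrite /= cardsU1.
rewrite (cardsD1 p.1 s.1) h1 (cardsD1 p.2 (s.1 :\ p.1)).
have -> : p.2 \in s.1 :\ p.1 by rewrite in_setD1 eq_sym h12.
by case: (_ \notin _).
Qed.

Definition kap (m : nat) : R := (m * m.-1)%:R / 2.

Lemma card_lpairs s : #|lpairs s| = (#|s.1| * #|s.1|.-1)%N.
Proof.
rewrite -sum1_card (eq_bigl (fun p => (p.1 \in s.1) && ((p.2 \in s.1) && (p.1 != p.2))));
  last by move=> p; rewrite inE.
rewrite -(pair_big_dep (mem s.1) (fun B1 B2 => (B2 \in s.1) && (B1 != B2)) (fun _ _ => 1%N)) /=.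
rewrite (eq_bigr (fun _ => #|s.1|.-1)) ?sum_nat_const // => B hB.
rewrite (cardsD1 B s.1) hB /= -sum1_card; apply: eq_bigl => B'.
by rewrite !inE eq_sym andbC.
Qed.

Lemma Qop_level phi s : Qop phi s =
  (\sum_(p in lpairs s) phi (cmerge s p.1 p.2)) / 2 - kap #|s.1| * phi s.
Proof.
rewrite QopE sumrB sumr_const card_lpairs /kap -mulr_natl; ring.
Qed.

Lemma kap_inj m j : (1 < m)%N -> (j < m)%N -> kap m - kap j != 0.
Proof.
move=> m1 jm; rewrite subr_eq0 /kap; apply/eqP => /(congr1 ( *%R^~ 2)).
rewrite !divfK ?pnatr_eq0 // => /eqP; rewrite eqr_nat => /eqP; nia.
Qed.

Lemma kap_gt0 m : (1 < m)%N -> 0 < kap m.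
Proof. by move=> m1; rewrite /kap divr_gt0 // ltr0n; nia. Qed.

Let N := #|{set X}|.+2.

(* The number of lineages strictly decreases along transitions, so [Q] is
   triangular with eigenvalues [- kap m], distinct for [m >= 1]. *)
Lemma iter_Qop_spec phi s : exists c : nat -> R,
  [/\ forall j, (#|s.1| < j)%N -> c j = 0,
      forall k, iter k Qop phi s = \sum_(j < N) c j * (- kap j) ^+ k &
      (forall u, (#|u.1| <= 1)%N -> phi u = 0) -> c 0%N = 0 /\ c 1%N = 0].
Proof.
have [m] := ubnP #|s.1|; elim: m s => // m IH s sm.
have sN : (#|s.1| < N)%N by rewrite /N ltnS (leq_trans (max_card _)).
have [s1|s1] := leqP #|s.1| 1.
  have Q0 k : iter k.+1 Qop phi s = 0.
    rewrite iterS QopE big1 ?mul0r // => p; rewrite inE => /and3P[h1 h2 h12].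
    by move/card_le1_eqP: s1 => /(_ p.1 p.2 h1 h2) e; rewrite e eqxx in h12.
  have k0 : kap #|s.1| = 0 by move: s1; case: #|s.1| => [|[|]] // _; rewrite /kap mul0r.
  exists (fun j => if j == #|s.1| then phi s else 0); split.
  - by move=> j; rewrite ltnNge; case: eqP => // ->; rewrite leqnn.
  - move=> k; rewrite (bigD1 (Ordinal sN)) //= eqxx k0 oppr0 big1 ?addr0.
      by case: k => [|k]; rewrite ?expr0 ?mulr1 // Q0 expr0n mulr0.
    by move=> j; rewrite -val_eqE /= => /negbTE ->; rewrite mul0r.
  - by move=> h; rewrite (h s s1); split; case: ifP.
have /choice[c hc] : forall p, exists c : nat -> R, p \in lpairs s ->
    [/\ forall j, (#|s.1| <= j)%N -> c j = 0,
      forall k, iter k Qop phi (cmerge s p.1 p.2) = \sum_(j < N) c j * (- kap j) ^+ k &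
      (forall u, (#|u.1| <= 1)%N -> phi u = 0) -> c 0%N = 0 /\ c 1%N = 0].
  move=> p; case: (boolP (p \in lpairs s)) => [ps|_]; last by exists (fun=> 0).
  have pl := cmerge_card ps.
  have [|c [c1 c2 c3]] := IH (cmerge s p.1 p.2); first by apply: (leq_trans pl); rewrite -ltnS.
  by exists c => _; split => // j sj; apply: c1; apply: leq_trans pl sj.
pose d j := (\sum_(p in lpairs s) c p j) / 2 / (kap #|s.1| - kap j).
have d0 j : (#|s.1| <= j)%N -> d j = 0.
  by move=> sj; rewrite /d big1 ?mul0r // => p /hc[h _ _]; rewrite h ?mul0r.
pose e := phi s - \sum_(j < N) d j.
exists (fun j => if j == #|s.1| then e else d j); split.
- move=> j sj; case: eqP => [js|_]; first by rewrite js ltnn in sj.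
  by rewrite d0 // ltnW.
- have split_sum k : \sum_(j < N) (if j == #|s.1| :> nat then e else d j) * (- kap j) ^+ k
       = e * (- kap #|s.1|) ^+ k + \sum_(j < N) d j * (- kap j) ^+ k.
    rewrite (bigD1 (Ordinal sN)) //= eqxx [in RHS](bigD1 (Ordinal sN)) //=.
    rewrite (d0 #|s.1|) // mul0r add0r; congr (_ + _).
    by apply: eq_bigr => j; rewrite -val_eqE /= => /negbTE ->.
  elim => [|k IHk].
    rewrite split_sum /= expr0 mulr1 /e.
    by under [X in _ - _ + X]eq_bigr do rewrite expr0 mulr1; rewrite subrK.
  rewrite iterS Qop_level IHk !split_sum.
  have -> : \sum_(p in lpairs s) iter k Qop phi (cmerge s p.1 p.2) =
      \sum_(p in lpairs s) \sum_(j < N) c p j * (- kap j) ^+ k.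
    by apply: eq_bigr => p /hc[_ -> _].
  rewrite exchange_big /= mulr_suml exprS mulrDr !mulr_sumr.
  have -> : \sum_(j < N) d j * (- kap j) ^+ k.+1 =
      \sum_(j < N) (\sum_(p in lpairs s) c p j * (- kap j) ^+ k) / 2 -
      \sum_(j < N) kap #|s.1| * (d j * (- kap j) ^+ k).
    rewrite -sumrB; apply: eq_bigr => j _; rewrite -mulr_suml exprS /d.
    have [js|js] := ltnP j #|s.1|.
      have := kap_inj s1 js; move: (\sum_(p in _) _) (kap j) (kap _) => *; field => //.
    by rewrite big1 ?mul0r ?mulr0 ?subr0 // => p /hc[h _ _]; rewrite h ?mul0r.
  ring.
- move=> h0; have h p : p \in lpairs s -> c p 0%N = 0 /\ c p 1%N = 0.
    by move=> /hc[_ _]; apply.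
  have s0 : (0%N == #|s.1|) = false by apply/eqP; lia.
  have s1' : (1%N == #|s.1|) = false by apply/eqP; lia.
  rewrite s0 s1' /d; split; rewrite big1 ?mul0r // => p /h[] //.
Qed.

Lemma cvg_sumr (I : finType) (T : Type) (F : set_system T) (FF : Filter F)
    (f : I -> T -> R) (a : I -> R) :
  (forall i, (f i x @[x --> F] --> a i)%classic) ->
  ((\sum_i f i x) @[x --> F] --> \sum_i a i)%classic.
Proof. by move=> h; apply: cvg_big => // x; exact: add_continuous. Qed.

Lemma trans_spec s u : exists c : nat -> R,
  (forall t, trans t s u = \sum_(j < N) c j * expR (- kap j * t) /\
     (series (fun k => t ^+ k / k`!%:R * genpow R k s u) @ \oo --> trans t s u)%classic) /\
  ((1 < #|u.1|)%N -> c 0%N = 0 /\ c 1%N = 0).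
Proof.
have [c [_ hc h1]] := iter_Qop_spec (fun v => (v == u)%:R) s.
have gE k : genpow R k s u = \sum_(j < N) c j * (- kap j) ^+ k.
  rewrite -hc iter_QopE (bigD1 u) //= eqxx mulr1 big1 ?addr0 // => v.
  by move=> /negbTE ->; rewrite mulr0.
exists c; split; last first.
  by move=> u1; apply: h1 => v v1; case: eqP => // vu; rewrite vu leqNgt u1 in v1.
move=> t.
have cv : (series (fun k => t ^+ k / k`!%:R * genpow R k s u) @ \oo -->
    \sum_(j < N) c j * expR (- kap j * t))%classic.
  rewrite (_ : series _ = fun n => \sum_(j < N) c j * series (exp_coeff (- kap j * t)) n).
    by apply: cvg_sumr => j; apply: cvgMr; exact: is_cvg_series_exp_coeff.
  apply/funext => n; rewrite /series /=.
  under [RHS]eq_bigr do rewrite mulr_sumr.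
  rewrite exchange_big /=; apply: eq_bigr => k _.
  rewrite gE mulr_sumr; apply: eq_bigr => j _; rewrite /exp_coeff /= exprMn; ring.
have e : trans t s u = \sum_(j < N) c j * expR (- kap j * t) by apply: cvg_lim.
by split => //; rewrite e.
Qed.

Definition Pop t phi s : R := \sum_u trans t s u * phi u.
Definition Proot phi s : R := \sum_u trans_root R s u * phi u.

Lemma expR_decay (k : R) : 0 < k -> (expR (- k * t) @[t --> +oo] --> (0 : R))%classic.
Proof.
move=> k0; under eq_cvg do rewrite mulNr.
apply: (@cvg_comp _ _ _ (fun t => k * t) (fun x => expR (- x)) _ (pinfty_nbhs R)); last exact: cvgr_expR.
by apply: gt0_cvgMry => //; exact: cvg_id.
Qed.

Lemma trans_cvg s u : (trans t s u @[t --> +oo] --> trans_root R s u)%classic /\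
  ((1 < #|u.1|)%N -> trans_root R s u = 0).
Proof.
have [c [hc h1]] := trans_spec s u.
have cv : (trans t s u @[t --> +oo] --> c 0%N + c 1%N)%classic.
  under eq_cvg do rewrite (hc _).1.
  have -> : c 0%N + c 1%N = \sum_(j < N) if (j <= 1)%N then c j else 0.
    rewrite /N big_ord_recl big_ord_recl /= big1 ?addr0 // .
  apply: cvg_sumr => j; case: ifP => j1.
    have -> : kap j = 0 by move: j1; case: (nat_of_ord j) => [|[|]] // _; rewrite /kap mul0r.
    under eq_cvg do rewrite oppr0 mul0r expR0 mulr1.
    exact: cvg_cst.
  rewrite -[X in (_ --> X)%classic](mulr0 (c j)); apply: cvgMr; apply: expR_decay.
  by apply: kap_gt0; rewrite ltnNge j1.
have e : trans_root R s u = c 0%N + c 1%N by apply: cvg_lim.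
by split; [rewrite e | move=> /h1[c0 c1]; rewrite e c0 c1 addr0].
Qed.

Lemma Pop_cvg phi s : (Pop t phi s @[t --> +oo] --> Proot phi s)%classic.
Proof.
apply: cvg_sumr => u; apply: cvgMl; exact: (trans_cvg s u).1.
Qed.

Section Closed.
Variable V : state X -> Prop.
Hypothesis V_closed : forall s p, V s -> p \in lpairs s -> V (cmerge s p.1 p.2).

Lemma gen_closed s u : V s -> ~ V u -> gen R s u = 0.
Proof.
move=> Vs Vu; rewrite /gen; case: eqP => [su|_]; first by case: Vu; rewrite -su.
rewrite rateE big1 ?mul0r // => p ps; case: eqP => // e.
by case: Vu; rewrite -e; exact: V_closed.
Qed.

Lemma genpow_closed k s u : V s -> ~ V u -> genpow R k s u = 0.
Proof.
elim: k u => [|k IH] u Vs Vu /=; first by case: eqP => // su; case: Vu; rewrite -su.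
rewrite big1 // => v _; case: (pselect (V v)) => Vv.
  by rewrite gen_closed ?mulr0.
by rewrite IH ?mul0r.
Qed.

Lemma trans_closed t s u : V s -> ~ V u -> trans t s u = 0.
Proof.
move=> Vs Vu; rewrite /trans (_ : (fun k => _) = fun=> 0).
  by apply: cvg_lim => //; rewrite /series /=; under eq_cvg do rewrite big1 //; exact: cvg_cst.
by apply/funext => k; rewrite genpow_closed ?mulr0.
Qed.

Lemma trans_root_closed s u : V s -> ~ V u -> trans_root R s u = 0.
Proof.
move=> Vs Vu; rewrite /trans_root; apply: cvg_lim => //.
by under eq_cvg do rewrite trans_closed //; exact: cvg_cst.
Qed.

Lemma eq_Pop t phi psi s : V s -> (forall u, V u -> phi u = psi u) ->
  Pop t phi s = Pop t psi s.
Proof.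
move=> Vs e; apply: eq_bigr => u _; case: (pselect (V u)) => Vu; first by rewrite e.
by rewrite trans_closed ?mul0r.
Qed.

Lemma eq_Proot phi psi s : V s ->
  (forall u, V u -> (#|u.1| <= 1)%N -> phi u = psi u) ->
  Proot phi s = Proot psi s.
Proof.
move=> Vs e; apply: eq_bigr => u _; case: (pselect (V u)) => Vu; last first.
  by rewrite trans_root_closed ?mul0r.
have [u1|u1] := leqP #|u.1| 1; first by rewrite e.
by rewrite (trans_cvg s u).2 ?mul0r.
Qed.

Lemma Pop_eigen (k : R) phi : (forall s, V s -> Qop phi s = - k * phi s) ->
  forall t s, V s -> Pop t phi s = expR (- k * t) * phi s.
Proof.
move=> e t s Vs.
have itE n u : V u -> iter n Qop phi u = (- k) ^+ n * phi u.
  elim: n u => [|n IH] u Vu; first by rewrite expr0 mul1r.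
  rewrite iterS exprS -mulrA -IH // /Qop.
  have -> : \sum_v gen R u v * iter n Qop phi v = (- k) ^+ n * Qop phi u.
    rewrite /Qop mulr_sumr; apply: eq_bigr => v _; case: (pselect (V v)) => Vv.
      by rewrite IH //; ring.
    by rewrite gen_closed // !mul0r mulr0.
  rewrite e // IH //; ring.
have cvt u : (series (fun n => t ^+ n / n`!%:R * genpow R n s u) @ \oo --> trans t s u)%classic.
  by have [c [hc _]] := trans_spec s u; exact: (hc t).2.
have c1 : ((fun n => \sum_u series (fun n => t ^+ n / n`!%:R * genpow R n s u) n * phi u) @ \oo
    --> Pop t phi s)%classic by apply: cvg_sumr => u; apply: cvgMl; exact: cvt.
have c2 : ((fun n => \sum_u series (fun n => t ^+ n / n`!%:R * genpow R n s u) n * phi u) @ \oo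
    --> expR (- k * t) * phi s)%classic.
  rewrite (_ : (fun n => _) = fun n => series (exp_coeff (- k * t)) n * phi s).
    by apply: cvgMl; exact: is_cvg_series_exp_coeff.
  apply/funext => n; rewrite /series /=.
  under eq_bigr do rewrite mulr_suml.
  rewrite exchange_big /= mulr_suml; apply: eq_bigr => i _.
  have := itE i s Vs; rewrite iter_QopE => h.
  under eq_bigr do rewrite -[_ * genpow _ _ _ _ * _]mulrA.
  rewrite -mulr_sumr h /exp_coeff /= exprMn; ring.
by rewrite -(cvg_lim _ c1) // (cvg_lim _ c2).
Qed.

Lemma Proot_harmonic phi : (forall s, V s -> Qop phi s = 0) ->
  forall s, V s -> Proot phi s = phi s.
Proof.
move=> e s Vs; have := @Pop_cvg phi s.
have h t : Pop t phi s = phi s.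
  rewrite (@Pop_eigen 0) // => [|u Vu]; last by rewrite e // oppr0 mul0r.
  by rewrite oppr0 mul0r expR0 mul1r.
under eq_cvg do rewrite h.
by move=> c; rewrite -(cvg_lim _ c) // lim_cst.
Qed.

End Closed.
End Generator.

(** * Species trees and the joint law of the populations *)

Inductive btree (X : finType) : Type := Leaf of X | Node of btree X & btree X.
Arguments Leaf {X} _.

Section Trees.
Variables (R : realType) (X : finType).
Implicit Types (t l r : btree X) (A B : {set X}) (C : {set {set X}}).

Fixpoint cl t : {set X} :=
  match t with Leaf a => [set a] | Node l r => cl l :|: cl r end.

Fixpoint cls t : {set {set X}} :=
  match t with
  | Leaf a => [set [set a]]
  | Node l r => (cl l :|: cl r) |: (cls l :|: cls r)
  end.

Fixpoint wf t : bool :=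
  match t with
  | Leaf a => true
  | Node l r => [&& wf l, wf r & [disjoint cl l & cl r]]
  end.

Lemma cl_neq0 t : exists a, a \in cl t.
Proof.
by elim: t => [a|l [a al] r _]; exists a; rewrite ?inE ?al //=.
Qed.

Lemma cl_cls t : cl t \in cls t.
Proof. by case: t => [a|l r] /=; rewrite !inE eqxx. Qed.

Lemma cls_sub t B : B \in cls t -> B \subset cl t /\ exists a, a \in B.
Proof.
elim: t => [a|l IHl r IHr] /=.
  by rewrite inE => /eqP ->; split => //; exists a; rewrite inE.
rewrite !inE => /or3P[/eqP->|/IHl[h1 h2]|/IHr[h1 h2]].
- by split => //; have [a al] := cl_neq0 l; exists a; rewrite inE al.
- by split => //; exact: (subset_trans h1 (subsetUl _ _)).
- by split => //; exact: (subset_trans h1 (subsetUr _ _)).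
Qed.

Lemma disjointE (A B : {set X}) a : [disjoint A & B] -> a \in A -> a \in B -> False.
Proof. by move/pred0P => /(_ a) /= + aA aB; rewrite aA aB. Qed.

Fixpoint compat C t : Prop :=
  match t with
  | Leaf _ => True
  | Node l r => [/\ forall B, child C (cl l :|: cl r) B = (B == cl l) || (B == cl r),
                    compat C l & compat C r]
  end.

Lemma cls_Node_sub C l r : wf (Node l r) ->
  cls (Node l r) = [set B in C | B \subset cl (Node l r)] ->
  cls l = [set B in C | B \subset cl l] /\ cls r = [set B in C | B \subset cl r].
Proof.
move=> w e; have /= /and3P[wl wr dlr] := w.
have mem B : (B \in cls (Node l r)) = (B \in C) && (B \subset cl l :|: cl r).
  by rewrite e inE.
have [x xl] := cl_neq0 l; have [y yr] := cl_neq0 r.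
split; apply/setP => B; rewrite inE; apply/idP/andP => [hB|[BC Bs]].
- have [Bl _] := cls_sub hB; split => //.
  have := mem B; rewrite !inE hB /= orbT => /esym /andP[] //.
- have := mem B; rewrite BC (subset_trans Bs (subsetUl _ _)) !inE.
  case/or3P => // [/eqP eB|/cls_sub[Br [z zB]]].
    case: (disjointE dlr (a := y)) => //; apply: (subsetP Bs); by rewrite eB inE yr orbT.
  by case: (disjointE dlr (subsetP Bs _ zB) (subsetP Br _ zB)).
- have [Br _] := cls_sub hB; split => //.
  have := mem B; rewrite !inE hB /= !orbT => /esym /andP[] //.
- have := mem B; rewrite BC (subset_trans Bs (subsetUr _ _)) !inE.
  case/or3P => // [/eqP eB|/cls_sub[Bl [z zB]]].
    case: (disjointE dlr (a := x)) => //; apply: (subsetP Bs); by rewrite eB inE xl.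
  by case: (disjointE dlr (subsetP Bl _ zB) (subsetP Bs _ zB)).
Qed.

Lemma compat_cls C t : wf t -> cls t = [set B in C | B \subset cl t] -> compat C t.
Proof.
elim: t => // l IHl r IHr w e.
have [el er] := cls_Node_sub w e; have /= /and3P[wl wr dlr] := w.
split; [|exact: IHl|exact: IHr].
have [x xl] := cl_neq0 l; have [y yr] := cl_neq0 r.
have lC : cl l \in C by have := cl_cls l; rewrite el inE => /andP[].
have rC : cl r \in C by have := cl_cls r; rewrite er inE => /andP[].
have lp : cl l \proper cl l :|: cl r.
  apply/properP; split; first exact: subsetUl.
  by exists y; [rewrite inE yr orbT | apply/negP => yl; exact: (disjointE dlr yl yr)].
have rp : cl r \proper cl l :|: cl r.
  apply/properP; split; first exact: subsetUr.
  by exists x; [rewrite inE xl | apply/negP => xr; exact: (disjointE dlr xl xr)].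
have cases D : D \in C -> D \proper cl l :|: cl r -> D \subset cl l \/ D \subset cl r.
  move=> DC Dp; have : D \in cls (Node l r) by rewrite e inE DC proper_sub.
  rewrite /= !inE => /or3P[/eqP eD|/cls_sub[]|/cls_sub[]]; try by [left|right].
  by rewrite eD properxx in Dp.
move=> B; apply/and3P/orP => [[BC Bp /forall_inP mx]|[/eqP->|/eqP->]].
- have [s|s] := cases B BC Bp; [left|right].
    have := mx _ lC; rewrite lp andbT properEneq s andbT negbK => //.
  have := mx _ rC; rewrite rp andbT properEneq s andbT negbK => //.
- split => //; apply/forall_inP => D DC; apply/negP => /andP[p1 p2].
  have [s|s] := cases D DC p2; first by have := proper_sub_trans p1 s; rewrite properxx.
  have /(subsetP s) xr := subsetP (proper_sub p1) _ xl.
  exact: (disjointE dlr xl xr).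
- split => //; apply/forall_inP => D DC; apply/negP => /andP[p1 p2].
  have [s|s] := cases D DC p2; last by have := proper_sub_trans p1 s; rewrite properxx.
  have /(subsetP s) yl := subsetP (proper_sub p1) _ yr.
  exact: (disjointE dlr yl yr).
Qed.

Lemma rbt_tree C A : is_rbt C -> A \in C ->
  exists t, [/\ wf t, cl t = A & cls t = [set B in C | B \subset A]].
Proof.
move=> [CT Cs C0 Cn Cb]; have [m] := ubnP #|A|; elim: m A => // m IH A Am AC.
have A0 : (0 < #|A|)%N by rewrite card_gt0; apply: contraNneq C0 => <-.
have Cpos B : B \in C -> exists x, x \in B.
  by move=> BC; apply/set0Pn; apply: contraNneq C0 => <-.
have [A1|A1] := leqP #|A| 1.
  have /cards1P[a eA] : #|A| == 1%N by rewrite eqn_leq A1.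
  exists (Leaf a); split => //=; apply/setP => B; rewrite !inE eA.
  apply/eqP/andP => [->|[BC]]; first by rewrite Cs subxx.
  by have [x xB] := Cpos B BC; rewrite subset1 => /orP[/eqP //|/eqP B0]; rewrite B0 inE in xB.
have [B1 [B2 [B1C B2C dB eA]]] := Cb A AC A1.
have [x xB] := Cpos _ B1C; have [y yB] := Cpos _ B2C.
have c1 : (#|B1| < #|A|)%N.
  apply: proper_card; rewrite -eA; apply/properP; split; first exact: subsetUl.
  by exists y; [rewrite inE yB orbT | apply/negP => h; exact: (disjointE dB h yB)].
have c2 : (#|B2| < #|A|)%N.
  apply: proper_card; rewrite -eA; apply/properP; split; first exact: subsetUr.
  by exists x; [rewrite inE xB | apply/negP => h; exact: (disjointE dB xB h)].
have [|l [wl el cll]] := IH B1 _ B1C; first exact: leq_trans c1 _.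
have [|r [wr er clr]] := IH B2 _ B2C; first exact: leq_trans c2 _.
exists (Node l r); split; rewrite /= ?el ?er ?wl ?wr //.
apply/setP => B; rewrite !inE cll clr !inE eA.
apply/idP/idP => [/or3P[/eqP->|/andP[-> s]|/andP[-> s]]|/andP[BC BA]].
- by rewrite AC subxx.
- by rewrite /= -eA; exact: (subset_trans s (subsetUl _ _)).
- by rewrite /= -eA; exact: (subset_trans s (subsetUr _ _)).
rewrite BC /=; have := Cn B B1 BC B1C; case/or3P => [->|s1|d1].
- by rewrite orbT.
- have := Cn B B2 BC B2C; case/or3P => [->|s2|d2]; first by rewrite !orbT.
    by rewrite eqEsubset BA -eA subUset s1 s2.
  suff -> : B \subset B1 by rewrite orbT.
  apply/subsetP => z zB; have := subsetP BA _ zB; rewrite -eA inE => /orP[//|zB2].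
  by case: (disjointE d2 zB zB2).
- suff -> : B \subset B2 by rewrite !orbT.
  apply/subsetP => z zB; have := subsetP BA _ zB; rewrite -eA inE => /orP[zB1|//].
  by case: (disjointE d1 zB zB1).
Qed.

Definition sunion (s1 s2 : state X) : state X := (s1.1 :|: s2.1, s1.2 :|: s2.2).

Lemma sunionC s1 s2 : sunion s1 s2 = sunion s2 s1.
Proof. by rewrite /sunion setUC [s1.2 :|: _]setUC. Qed.

Variable lam : {set X} -> R.

Fixpoint Ex t (phi : state X -> R) : R :=
  match t with
  | Leaf a => phi ([set [set a]], finset.set0)
  | Node l r => Ex r (fun s2 => Ex l (fun s1 =>
                  Pop (lam (cl l :|: cl r)) phi (sunion s1 s2)))
  end.

Definition Exroot t (phi : state X -> R) : R :=
  match t with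
  | Leaf a => phi ([set [set a]], finset.set0)
  | Node l r => Ex r (fun s2 => Ex l (fun s1 => Proot phi (sunion s1 s2)))
  end.

Lemma Ex_linear t a phi psi :
  Ex t (fun s => a * phi s + psi s) = a * Ex t phi + Ex t psi.
Proof.
elim: t a phi psi => [//|l IHl r IHr] a phi psi /=.
rewrite -IHr; congr (Ex r _); apply/funext => s2; rewrite -IHl; congr (Ex l _).
apply/funext => s1; rewrite /Pop mulr_sumr -big_split /=; apply: eq_bigr => u _.
ring.
Qed.

Lemma Ex0 t : Ex t (fun=> 0) = 0.
Proof.
have := Ex_linear t (-1) (fun=> 0) (fun=> 0).
by rewrite (_ : (fun s => _) = fun=> 0) ?mulN1r ?addNr //; apply/funext => s; rewrite mulr0 addr0.
Qed.

Lemma ExD t phi psi : Ex t (fun s => phi s + psi s) = Ex t phi + Ex t psi.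
Proof.
have := Ex_linear t 1 phi psi; rewrite mul1r => <-; congr (Ex t _).
by apply/funext => s; rewrite mul1r.
Qed.

Lemma ExZ t a phi : Ex t (fun s => a * phi s) = a * Ex t phi.
Proof.
have := Ex_linear t a phi (fun=> 0); rewrite Ex0 addr0 => <-; congr (Ex t _).
by apply/funext => s; rewrite addr0.
Qed.

Lemma Ex_sum t (I : Type) (v : seq I) (F : I -> state X -> R) :
  Ex t (fun s => \sum_(i <- v) F i s) = \sum_(i <- v) Ex t (F i).
Proof.
elim: v => [|i v IH].
  by rewrite big_nil -[RHS](Ex0 t); congr (Ex t _); apply/funext => s; rewrite big_nil.
by rewrite big_cons -IH -ExD; congr (Ex t _); apply/funext => s; rewrite big_cons.
Qed.

Lemma Ex_swap l r (F : state X -> state X -> R) :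
  Ex r (fun s2 => Ex l (fun s1 => F s1 s2)) = Ex l (fun s1 => Ex r (fun s2 => F s1 s2)).
Proof.
have dec (t : btree X) (phi : state X -> R) :
    Ex t phi = \sum_(u <- enum {: state X}) phi u * Ex t (fun s => (s == u)%:R).
  rewrite (eq_bigr (fun u => Ex t (fun s => phi u * (s == u)%:R))); last first.
    by move=> u _; rewrite ExZ.
  rewrite -Ex_sum; congr (Ex t _); apply/funext => s.
  rewrite big_enum /= (bigD1 s) //= eqxx mulr1 big1 ?addr0 // => u.
  by rewrite eq_sym => /negbTE ->; rewrite mulr0.
rewrite dec [RHS]dec.
under eq_bigr do rewrite dec mulr_suml.
under [RHS]eq_bigr do rewrite dec mulr_suml.
rewrite exchange_big /=; apply: eq_bigr => u _; apply: eq_bigr => v _; ring.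
Qed.

End Trees.

Section Weight.
Variables (R : realType) (X : finType) (sg : rmst R X).
Let C := sg.1.
Implicit Types (f : {ffun {set X} -> state X}) (T : {set {set X}}).
Local Notation dum := ((finset.set0, finset.set0) : state X).

Definition fac (A : {set X}) f : R :=
  if #|A| == 1%N then (f A == ([set A], finset.set0))%:R
  else if A == [set: X] then trans_root R (enter sg.1 f A) (f A)
  else trans (sg.2 A) (enter sg.1 f A) (f A).

Definition upd f (A : {set X}) (s : state X) : {ffun {set X} -> state X} :=
  [ffun B => if B == A then s else f B].

Definition Zs T (Phi : {ffun {set X} -> state X} -> R) : R :=
  \sum_f (\prod_A (if A \in T then fac A f else (f A == dum)%:R)) * Phi f.

Lemma enter_two A L L' f : (forall B, child C A B = (B == L) || (B == L')) ->
  enter C f A = sunion (f L) (f L').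
Proof.
move=> ch; rewrite /enter /sunion; congr (_, _); apply/setP => z; rewrite inE;
apply/bigcupP/orP => [[B]|[]h]; rewrite ?ch.
- by case/orP => /eqP ->; [left|right].
- by exists L; rewrite ?ch ?eqxx.
- by exists L'; rewrite ?ch ?eqxx ?orbT.
- by case/orP => /eqP ->; [left|right].
- by exists L; rewrite ?ch ?eqxx.
- by exists L'; rewrite ?ch ?eqxx ?orbT.
Qed.

Lemma enter_upd A B f s : ~~ child C A B -> enter C (upd f B s) A = enter C f A.
Proof.
move=> nc; rewrite /enter; congr (_, _); apply: eq_bigr => D hD; rewrite ffunE;
by case: eqP => // e; rewrite e (negbTE nc) in hD.
Qed.

Lemma fac_upd A B f s : B != A -> ~~ child C A B -> fac A (upd f B s) = fac A f.
Proof.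
by move=> BA nc; rewrite /fac enter_upd // !ffunE [A == B]eq_sym (negbTE BA).
Qed.

Lemma Zs_elim T A0 Phi : A0 \in T ->
  (forall A f s, A \in T -> A != A0 -> fac A (upd f A0 s) = fac A f) ->
  Zs T Phi = Zs (T :\ A0)
    (fun f => \sum_s fac A0 (upd f A0 s) * Phi (upd f A0 s)).
Proof.
move=> A0T indep; rewrite /Zs.
rewrite (partition_big (fun g => upd g A0 dum) predT) //=; apply: eq_bigr => f _.
have [fd|fd] := eqVneq (f A0) dum; last first.
  rewrite [X in _ = X * _](bigD1 A0) //= !inE eqxx /= (negbTE fd) !mul0r big1 // => g /eqP eg.
  by move: fd; rewrite -eg ffunE !eqxx.
rewrite (reindex_onto (fun s => upd f A0 s) (fun g => g A0)) /=; last first.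
  move=> g /eqP <-; apply/ffunP => B; rewrite !ffunE; case: eqP => // ->.
  by rewrite ?eqxx.
rewrite mulr_sumr; apply: eq_big => [s|s _].
  rewrite ffunE !eqxx andbT; apply/eqP/ffunP => B; rewrite !ffunE.
  by case: eqP => // ->.
rewrite (bigD1 A0) //= A0T [in RHS](bigD1 A0) //= !inE eqxx /= fd eqxx mul1r.
rewrite -[LHS]mulrA [RHS]mulrCA; congr (_ * (_ * _)); apply: eq_bigr => A AA0.
rewrite !inE AA0 /=; case: ifP => AT; first by rewrite indep.
by rewrite ffunE (negbTE AA0).
Qed.

Lemma cl_child (A : {set X}) t B : [disjoint A & cl t] -> B \in cls t -> (B != A) && ~~ child C A B.
Proof.
move=> dA Bt; have [Bs [x xB]] := cls_sub Bt; have xt := subsetP Bs _ xB.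
apply/andP; split; first by apply/eqP => e; apply: disjointE dA _ xt; rewrite -e.
apply/negP => /and3P[_ /proper_sub/subsetP s _]; exact: (disjointE dA (s _ xB) xt).
Qed.

Lemma Zs_tree t T (psi : state X -> {ffun {set X} -> state X} -> R) :
  wf t -> compat C t -> cl t != [set: X] ->
  (forall A, A \in T -> [disjoint A & cl t]) ->
  (forall B s u f, B \in cls t -> psi s (upd f B u) = psi s f) ->
  Zs (cls t :|: T) (fun f => psi (f (cl t)) f) =
  Zs T (fun f => Ex sg.2 t (fun s => psi s f)).
Proof.
elim: t T psi => [a|l IHl r IHr] T psi w c nT dT ind.
  rewrite (@Zs_elim _ [set a]) ?inE ?eqxx //; last first.
    move=> A f s; rewrite !inE => /orP[/eqP->|AT]; first by rewrite eqxx.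
    move=> AA; apply: fac_upd; first by rewrite eq_sym.
    by have /andP[] := cl_child (dT A AT) (cl_cls (Leaf a)).
  have -> : (cls (Leaf a) :|: T) :\ [set a] = T.
    apply/setP => A; rewrite !inE; case: eqP => //= -> ; apply/esym/negP => /dT /= d.
    by apply: (disjointE d (a := a)); rewrite inE.
  congr Zs; apply/funext => f; rewrite (bigD1 ([set [set a]], finset.set0)) //=.
  rewrite big1 ?addr0 => [|s ns]; last by rewrite /fac cards1 eqxx ffunE eqxx (negbTE ns) mul0r.
  by rewrite /fac cards1 eqxx !ffunE !eqxx mul1r ind ?(cl_cls (Leaf a)).
have /= /and3P[wl wr dlr] := w; have /= [ch cpl cpr] := c.
set A := cl l :|: cl r.
have [x xl] := cl_neq0 l; have [y yr] := cl_neq0 r.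
have xA : x \in A by rewrite inE xl.
have An1 : #|A| == 1%N = false.
  apply/negP => /cards1P[z ez]; have := xA; rewrite ez inE => /eqP ex.
  have : y \in A by rewrite inE yr orbT.
  by rewrite ez inE => /eqP ey; apply: (disjointE dlr xl); rewrite ex -ey.
have ln : cl l != [set: X].
  by apply/eqP => e; apply: (disjointE dlr (a := y)) => //; rewrite e inE.
have rn : cl r != [set: X].
  by apply/eqP => e; apply: (disjointE dlr (a := x)) => //; rewrite e inE.
have Al : A \notin cls l.
  apply/negP => /cls_sub[/subsetP s _]; apply: (disjointE dlr (s y _) yr).
  by rewrite inE yr orbT.
have Ar : A \notin cls r.
  by apply/negP => /cls_sub[/subsetP s _]; exact: (disjointE dlr xl (s x xA)).
rewrite (@Zs_elim _ A) ?inE ?eqxx //; last first.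
  move=> B f s BT BA; apply: fac_upd; first by rewrite eq_sym.
  apply/negP => /and3P[_ /properP[s1 [z zB zA]] _]; move: BT; rewrite !inE (negbTE BA) /=.
  case/orP => [/orP[]/cls_sub[/subsetP s2 _]|/dT d].
  - by move: zA; rewrite inE (s2 _ zB).
  - by move: zA; rewrite inE (s2 _ zB) orbT.
  - exact: (disjointE d (subsetP s1 _ xA) xA).
have -> : (cls (Node l r) :|: T) :\ A = cls l :|: (cls r :|: T).
  apply/setP => B; rewrite !inE; case: (eqVneq B A) => [->|] /=; last by rewrite orbA.
  rewrite (negbTE Al) (negbTE Ar) /=; apply/esym/negP => /dT d.
  exact: (disjointE d xA xA).
pose psi1 s f := Pop (sg.2 A) (fun u => psi u f) (sunion s (f (cl r))).
have -> : (fun f => \sum_s fac A (upd f A s) * psi (upd f A s (cl (Node l r))) (upd f A s)) =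
   fun f => psi1 (f (cl l)) f.
  apply/funext => f; rewrite /psi1 /Pop; apply: eq_bigr => s _.
  have -> : upd f A s (cl (Node l r)) = s by rewrite /upd ffunE eqxx.
  rewrite ind; last exact: (cl_cls (Node l r)).
  congr (_ * _); rewrite /fac An1 (negbTE nT) ffunE eqxx.
  rewrite enter_upd; last by rewrite /child properxx andbF.
  by rewrite (enter_two _ ch).
rewrite IHl //; first last.
- move=> B s u f Bl; rewrite /psi1 ffunE; have [Bs [z zB]] := cls_sub Bl.
  case: eqP => [e|_].
    by case: (disjointE dlr (subsetP Bs _ zB)); rewrite e.
  by congr (Pop _ _ _); apply/funext => v; rewrite ind //= !inE Bl orbT.
- move=> B; rewrite inE => /orP[/cls_sub[Bs _]|/dT /= d].
    by rewrite disjoint_sym; exact: disjointWr Bs dlr.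
  by apply: disjointWr d; exact: subsetUl.
pose psi2 s f := Ex sg.2 l (fun s1 => Pop (sg.2 A) (fun u => psi u f) (sunion s1 s)).
have -> : (fun f => Ex sg.2 l (fun s => psi1 s f)) = (fun f => psi2 (f (cl r)) f) by [].
rewrite IHr //.
- by move=> B /dT /= d; apply: disjointWr d; exact: subsetUr.
- move=> B s u f Br; rewrite /psi2; congr (Ex _ l _); apply/funext => s1.
  by congr (Pop _ _ _); apply/funext => v; rewrite ind //= !inE Br !orbT.
Qed.

Lemma weight_Exroot t (phi : state X -> R) :
  wf t -> cl t = [set: X] -> cls t = C -> (1 < #|X|)%N ->
  \sum_f weight sg f * phi (f [set: X]) = Exroot sg.2 t phi.
Proof.
move=> w eT eC X1.
have c : compat C t by apply: compat_cls; rewrite // eC eT; apply/setP => B; rewrite inE subsetT andbT.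
case: t w eT eC c => [a _ /= eT|l r w eT eC c].
  by move: X1; rewrite -cardsT -eT cards1.
have /= /and3P[wl wr dlr] := w; have /= [ch cpl cpr] := c.
have [x xl] := cl_neq0 l; have [y yr] := cl_neq0 r.
have -> : \sum_f weight sg f * phi (f [set: X]) = Zs (cls (Node l r)) (fun f => phi (f [set: X])).
  by rewrite eC.
have ln : cl l != [set: X].
  by apply/eqP => e; apply: (disjointE dlr (a := y)) => //; rewrite e inE.
have rn : cl r != [set: X].
  by apply/eqP => e; apply: (disjointE dlr (a := x)) => //; rewrite e inE.
rewrite (@Zs_elim _ [set: X]); first last.
- move=> B f s BT BA; apply: fac_upd; first by rewrite eq_sym.
  apply/negP => /and3P[_ /proper_sub h _]; case/negP: BA.
  by rewrite eqEsubset h subsetT.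
- by rewrite -eT cl_cls.
have -> : (cls (Node l r)) :\ [set: X] = cls l :|: (cls r :|: finset.set0).
  apply/setP => B; rewrite setU0 /= !inE -[cl l :|: cl r]/(cl (Node l r)) eT.
  case: (eqVneq B [set: X]) => [->|] //=.
  apply/esym/negP => /orP[]/cls_sub[s _]; [case/negP: ln|case/negP: rn];
  by rewrite eqEsubset s subsetT.
pose psi1 s f := Proot phi (sunion s (f (cl r))).
have -> : (fun f => \sum_s fac [set: X] (upd f [set: X] s) * phi (upd f [set: X] s [set: X])) =
   fun f => psi1 (f (cl l)) f.
  apply/funext => f; rewrite /psi1 /Proot; apply: eq_bigr => s _.
  rewrite ffunE eqxx; congr (_ * _); rewrite /fac cardsT.
  have -> : #|X| == 1%N = false by apply/eqP => e; rewrite e in X1.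
  rewrite eqxx ffunE eqxx.
  rewrite enter_upd; last by rewrite /child properxx andbF.
  rewrite (@enter_two _ (cl l) (cl r)) // => B.
  by rewrite -ch -[cl l :|: cl r]/(cl (Node l r)) eT.
rewrite Zs_tree //; first last.
- move=> B s u f Bl; rewrite /psi1 ffunE; have [Bs [z zB]] := cls_sub Bl.
  by case: eqP => [e|//]; case: (disjointE dlr (subsetP Bs _ zB)); rewrite e.
- move=> B; rewrite inE => /orP[/cls_sub[Bs _]|]; last by rewrite inE.
  by rewrite disjoint_sym; exact: disjointWr Bs dlr.
pose psi2 s (f : {ffun {set X} -> state X}) := Ex sg.2 l (fun s1 => Proot phi (sunion s1 s)).
have -> : (fun f => Ex sg.2 l (fun s => psi1 s f)) = (fun f => psi2 (f (cl r)) f) by [].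
rewrite Zs_tree //; last by move=> B; rewrite inE.
rewrite /Zs (bigD1 [ffun=> dum]) //= big1 ?mul1r; last first.
  by move=> A _; rewrite inE ffunE eqxx.
rewrite big1 ?addr0 // => f /eqP nf.
have [A hA] : exists A, f A != dum.
  apply/existsP; rewrite -negb_forall; apply/negP => /forallP h; case: nf.
  by apply/ffunP => A; rewrite ffunE; apply/eqP.
by rewrite (bigD1 A) //= inE (negbTE hA) !mul0r.
Qed.

End Weight.

(** * Restriction of states to at most five taxa *)

Fixpoint masks (k : nat) : seq bitseq :=
  if k is k'.+1 then map (cons true) (masks k') ++ map (cons false) (masks k')
  else [:: [::]].

Definition norm (k n : nat) (L : seq bitseq) : seq bitseq :=
  [seq m <- masks k | (n <= count id m)%N && (m \in L)].

(* A coalescent state seen on a list of [k] taxa: the bit masks of its lineages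
   and of its clusters with at least two of these taxa. *)
Definition gst := (seq bitseq * seq bitseq)%type.

Definition orm (m1 m2 : bitseq) : bitseq := [seq p.1 || p.2 | p <- zip m1 m2].

Definition gmerge (k : nat) (x : gst) (m1 m2 : bitseq) : gst :=
  (norm k 1 (orm m1 m2 :: [seq m <- x.1 | (m != m1) && (m != m2)]),
   norm k 2 (orm m1 m2 :: x.2)).

Fixpoint emb (sel m : bitseq) : bitseq :=
  match sel with
  | [::] => [::]
  | true :: sel' => head false m :: emb sel' (behead m)
  | false :: sel' => false :: emb sel' m
  end.

Definition gjoin (sel : bitseq) (x y : gst) : gst :=
  (norm (size sel) 1 (map (emb sel) x.1 ++ map (emb (map negb sel)) y.1),
   norm (size sel) 2 (map (emb sel) x.2 ++ map (emb (map negb sel)) y.2)).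

Definition succs (k : nat) (x : gst) : seq gst :=
  flatten [seq [seq gmerge k x m1 m2 | m2 <- x.1 & m1 != m2] | m1 <- x.1].

Fixpoint levels (k n : nat) (L : seq gst) : seq gst :=
  if n is n'.+1 then L ++ levels k n' (undup (flatten (map (succs k) L))) else [::].

Definition reach (k : nat) : seq gst :=
  levels k k.+1 [:: ([seq m <- masks k | count id m == 1%N], [::])].

Definition sumz (v : seq int) : int := foldr +%R 0 v.

Definition qsum (k : nat) (g : gst -> int) (x : gst) : int :=
  sumz [seq sumz [seq g (gmerge k x m1 m2) - g x | m2 <- x.1 & m1 != m2] | m1 <- x.1].

Definition eigen (k2 : int) (k : nat) (g : gst -> int) : bool :=
  all (fun x => qsum k g x == - k2 * g x) (reach k).

Definition decomp (sel : bitseq) (g : gst -> int)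
    (ds : seq ((gst -> int) * (gst -> int))) : bool :=
  let r1 := reach (count id sel) in let r2 := reach (count id (map negb sel)) in
  all (fun x => all (fun y =>
    g (gjoin sel x y) == sumz [seq d.1 x * d.2 y | d <- ds]) r2) r1.

Definition reach_closed (k : nat) : bool :=
  let r := reach k in all (fun x => all (fun y => y \in r) (succs k x)) r.

Definition reach_join (k : nat) : bool :=
  let r := reach k in
  all (fun sel => let r1 := reach (count id sel) in
                  let r2 := reach (count id (map negb sel)) in
    all (fun x => all (fun y => gjoin sel x y \in r) r2) r1) (masks k).

Lemma reach_closed5 k : (k <= 5)%N -> reach_closed k.
Proof.
have /allP h : all reach_closed (iota 0 6) by vm_cast_no_check (erefl true).
by move=> k5; apply: h; rewrite mem_iota.
Qed.

Lemma reach_join5 k : (k <= 5)%N -> reach_join k.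
Proof.
have /allP h : all reach_join (iota 0 6) by vm_cast_no_check (erefl true).
by move=> k5; apply: h; rewrite mem_iota.
Qed.

Lemma mem_masks k m : (m \in masks k) = (size m == k).
Proof.
elim: k m => [|k IH] [|b m] //=; rewrite mem_cat.
  by apply/norP; split; apply/mapP => -[].
have inj b' : injective (cons b' : bitseq -> bitseq) by move=> u v [].
rewrite eqSS -IH; case: b.
  rewrite (mem_map (inj true)); case: (m \in _) => //=.
  by apply/mapP => -[].
rewrite (mem_map (inj false)) orbC; case: (m \in _) => //=.
by apply/mapP => -[].
Qed.

Lemma uniq_masks k : uniq (masks k).
Proof.
elim: k => //= k IH; rewrite cat_uniq !map_inj_uniq ?IH //; try by move=> u v [].
by rewrite andbT; apply/hasPn => m /mapP[u _ ->]; apply/mapP => -[].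
Qed.

Lemma mem_norm k n L m :
  (m \in norm k n L) = [&& size m == k, (n <= count id m)%N & m \in L].
Proof. by rewrite mem_filter mem_masks andbC. Qed.

Lemma eq_norm k n L1 L2 :
  (forall m, size m = k -> (n <= count id m)%N -> (m \in L1) = (m \in L2)) ->
  norm k n L1 = norm k n L2.
Proof.
move=> h; apply: eq_in_filter => m; rewrite mem_masks => /eqP sm.
by case: leqP => //= nm; rewrite h.
Qed.

Lemma sumzE v : sumz v = \sum_(i <- v) i.
Proof. by elim: v => [|i v IH]; rewrite ?big_nil // big_cons -IH. Qed.

Section StateMask.
Variables (R : realType) (X : finType).
Implicit Types (ys : seq X) (A B K : {set X}) (s : state X).

Definition mk ys B : bitseq := [seq y \in B | y <- ys].

Definition smasks ys (S : {set {set X}}) : seq bitseq := [seq mk ys B | B <- enum S].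

Definition rho ys s : gst :=
  (norm (size ys) 1 (smasks ys s.1), norm (size ys) 2 (smasks ys s.2)).

Lemma size_mk ys B : size (mk ys B) = size ys. Proof. exact: size_map. Qed.

Lemma smasksP ys (S : {set {set X}}) m :
  reflect (exists2 B, B \in S & m = mk ys B) (m \in smasks ys S).
Proof.
by apply: (iffP mapP) => -[B BS ->]; exists B; rewrite // ?mem_enum // -mem_enum.
Qed.

Lemma mkU ys B1 B2 : mk ys (B1 :|: B2) = orm (mk ys B1) (mk ys B2).
Proof. by elim: ys => //= y ys IH; rewrite /orm /= inE; congr (_ :: _). Qed.

Lemma mk_count0 ys B : count id (mk ys B) = 0%N -> {in ys, forall y, y \notin B}.
Proof.
move=> h y yy; apply/negP => yB; have : has id (mk ys B) by apply/hasP; exists true => //; apply/mapP; exists y.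
by rewrite has_count h.
Qed.

Lemma mk_countP ys B : (0 < count id (mk ys B))%N -> exists2 y, y \in ys & y \in B.
Proof. by rewrite -has_count => /hasP[b /mapP[y yy ->] yB]; exists y. Qed.

Lemma mk_inj ys B y : forall B', mk ys B = mk ys B' -> y \in ys -> (y \in B) = (y \in B').
Proof.
elim: ys => //= z ys IH B' [e1 e2]; rewrite inE => /orP[/eqP->//|yy]; exact: IH.
Qed.

Lemma count_mk_card ys B : uniq ys -> (count id (mk ys B) <= #|B|)%N.
Proof.
move=> u; rewrite count_map /= -size_filter -(card_uniqP (filter_uniq _ u)).
by apply: subset_leq_card; apply/subsetP => y; rewrite mem_filter => /andP[].
Qed.

Lemma orm0 ys B1 B2 : count id (mk ys B1) = 0%N -> mk ys (B1 :|: B2) = mk ys B2.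
Proof.
move=> /mk_count0 h; rewrite /mk; apply/eq_in_map => y /h yB.
by rewrite inE (negbTE yB).
Qed.

(* Invariant of the states reached in the population above the cluster [A]. *)
Definition good A s : Prop :=
  [/\ forall B B', B \in s.1 -> B' \in s.1 -> B != B' -> [disjoint B & B'],
      forall B, B \in s.1 -> B \subset A,
      forall B, B \in s.2 -> B \subset A,
      forall B, B \in s.1 -> (B \in s.2) || (#|B| <= 1)%N &
      forall ys, uniq ys -> (size ys <= 5)%N -> {subset ys <= A} ->
        rho ys s \in reach (size ys)].

Lemma cmergeC s B1 B2 : cmerge s B1 B2 = cmerge s B2 B1.
Proof.
rewrite /Pilot.Defs.merge [B2 :|: B1]setUC.
suff -> : s.1 :\ B1 :\ B2 = s.1 :\ B2 :\ B1 by [].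
by apply/setP => B; rewrite !inE; case: (B == B1); case: (B == B2).
Qed.

Lemma rho_merge0 ys A s B1 B2 : good A s -> uniq ys -> B1 \in s.1 -> B2 \in s.1 ->
  B1 != B2 -> count id (mk ys B1) = 0%N -> rho ys (cmerge s B1 B2) = rho ys s.
Proof.
move=> [dj _ _ sg _] u h1 h2 n12 c1; have mU := orm0 B2 c1.
rewrite /rho; congr (_, _); apply: eq_norm => m sm cm; apply/smasksP/smasksP => -[B].
- rewrite !inE => /orP[/eqP->|/and3P[_ _ BS]] em; last by exists B.
  by exists B2 => //; rewrite em mU.
- move=> BS em; case: (eqVneq B B1) => [e|n1]; first by rewrite em e c1 in cm.
  case: (eqVneq B B2) => [e|n2].
    by exists (B1 :|: B2); rewrite ?inE ?eqxx // mU em e.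
  by exists B; rewrite // !inE n1 n2 BS orbT.
- rewrite !inE => /orP[/eqP->|BS] em; last by exists B.
  exists B2; last by rewrite em mU.
  have /orP[//|b1] := sg _ h2.
  by have := leq_trans cm (leq_trans _ b1); rewrite em mU count_mk_card => // /(_ isT).
- by move=> BS em; exists B => //; rewrite !inE BS orbT.
Qed.

Lemma rho_merge ys A s B1 B2 : good A s -> uniq ys -> B1 \in s.1 -> B2 \in s.1 ->
  B1 != B2 -> (0 < count id (mk ys B1))%N -> (0 < count id (mk ys B2))%N ->
  rho ys (cmerge s B1 B2) = gmerge (size ys) (rho ys s) (mk ys B1) (mk ys B2).
Proof.
move=> [dj _ _ sg _] u h1 h2 n12 c1 c2; rewrite /gmerge -mkU /rho.
congr (_, _); apply: eq_norm => m sm cm; rewrite inE; apply/smasksP/orP.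
- case=> B; rewrite !inE => /orP[/eqP->|/and3P[n2 n1 BS]] em; [by left; apply/eqP|right].
  have cB : (0 < count id (mk ys B))%N by rewrite -em.
  have ne B' : B' \in s.1 -> B != B' -> mk ys B != mk ys B'.
    move=> B'S nB; apply/eqP => e; have [y yy yB] := mk_countP cB.
    by apply: (disjointE (dj _ _ BS B'S nB) yB); rewrite -(mk_inj e yy).
  rewrite mem_filter em !ne //= mem_norm size_mk eqxx cB /=.
  by apply/smasksP; exists B.
- case=> [/eqP->|]; first by exists (B1 :|: B2); rewrite ?inE ?eqxx.
  rewrite mem_filter mem_norm => /andP[/andP[n1 n2] /and3P[_ _ /smasksP[B BS em]]].
  exists B => //; rewrite !inE BS andbT; apply/orP; right; apply/andP; split.
    by apply: contraNneq n2 => <-; rewrite em.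
  by apply: contraNneq n1 => <-; rewrite em.
- case=> B; rewrite !inE => /orP[/eqP->|BS] em; [by left; apply/eqP|right].
  by rewrite mem_norm sm eqxx cm; apply/smasksP; exists B.
- case=> [/eqP->|]; first by exists (B1 :|: B2); rewrite ?inE ?eqxx.
  rewrite mem_norm => /and3P[_ _ /smasksP[B BS em]].
  by exists B; rewrite // !inE BS orbT.
Qed.

Lemma rho_lin ys s B : B \in s.1 -> (0 < count id (mk ys B))%N -> mk ys B \in (rho ys s).1.
Proof.
by move=> BS cB; rewrite mem_norm size_mk eqxx cB; apply/smasksP; exists B.
Qed.

Lemma mk_neq ys A s B B' : good A s -> B \in s.1 -> B' \in s.1 ->
  (0 < count id (mk ys B))%N -> (mk ys B == mk ys B') = (B == B').
Proof.
move=> [dj _ _ _ _] BS BS' cB; case: (eqVneq B B') => [->|n]; first by rewrite eqxx.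
apply/eqP => e; have [y yy yB] := mk_countP cB.
by apply: (disjointE (dj _ _ BS BS' n) yB); rewrite -(mk_inj e yy).
Qed.

Lemma good_merge A s p : good A s -> p \in lpairs s -> good A (cmerge s p.1 p.2).
Proof.
case: p => B1 B2 /= gs; rewrite inE /= => /and3P[h1 h2 n12].
have [dj sA kA sg rr] := gs; split.
- have djU B : B \in s.1 -> B != B1 -> B != B2 -> [disjoint B1 :|: B2 & B].
    move=> BS n1 n2; apply/pred0P => x /=; rewrite inE; apply/negP => /andP[/orP[]h xB].
      by apply: (disjointE (dj _ _ BS h1 n1) xB).
    by apply: (disjointE (dj _ _ BS h2 n2) xB).
  move=> B B'; rewrite /= !inE => /orP[/eqP->|/and3P[b1 b2 b3]] /orP[/eqP->|/and3P[b1' b2' b3']].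
  + by rewrite eqxx.
  + by move=> _; apply: djU.
  + by move=> _; rewrite disjoint_sym; apply: djU.
  + exact: dj.
- move=> B; rewrite /= !inE => /orP[/eqP->|/and3P[b1 b2 b3]]; last exact: sA.
  by rewrite subUset !sA.
- move=> B; rewrite /= !inE => /orP[/eqP->|b3]; last exact: kA.
  by rewrite subUset !sA.
- move=> B; rewrite /= !inE => /orP[->//|/and3P[b1 b2 b3]].
  by have /orP[->|->] := sg _ b3; rewrite !orbT.
- move=> ys u s5 sub; have rs := rr ys u s5 sub.
  have [c1|c1] := posnP (count id (mk ys B1)); first by rewrite (rho_merge0 gs).
  have [c2|c2] := posnP (count id (mk ys B2)).
    by rewrite cmergeC (rho_merge0 gs) // eq_sym.
  rewrite (rho_merge gs) //.
  have /allP/(_ _ rs)/allP := reach_closed5 s5; apply; apply/flattenP.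
  exists [seq gmerge (size ys) (rho ys s) (mk ys B1) m2 | m2 <- (rho ys s).1 & mk ys B1 != m2].
    by apply/mapP; exists (mk ys B1) => //; exact: rho_lin.
  apply/mapP; exists (mk ys B2) => //.
  by rewrite mem_filter rho_lin // andbT (mk_neq gs).
Qed.

Lemma lin_sum ys A s (F : bitseq -> R) : good A s ->
  \sum_(m <- (rho ys s).1) F m =
  \sum_(B in s.1 | (0 < count id (mk ys B))%N) F (mk ys B).
Proof.
move=> gs; rewrite -[RHS]big_enum_cond -[RHS]big_filter -[RHS](big_map (mk ys) predT F).

have mf B : (B \in [seq i <- enum s.1 | (0 < count id (mk ys i))%N]) =
    (0 < count id (mk ys B))%N && (B \in s.1) by rewrite mem_filter mem_enum.
apply: perm_big; apply: uniq_perm.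
- exact: filter_uniq (uniq_masks _).
- rewrite map_inj_in_uniq => [|B B']; first exact: filter_uniq (enum_uniq _).
  rewrite !mf => /andP[c1 b1] /andP[c2 b2] /eqP.
  by rewrite (mk_neq gs) // => /eqP.
move=> m; rewrite mem_norm; apply/and3P/mapP => [[/eqP sm cm /smasksP[B BS em]]|].
  by exists B; rewrite // mf BS -em cm.
case=> B; rewrite mf => /andP[cB BS] ->.
by rewrite size_mk eqxx cB; split => //; apply/smasksP; exists B.
Qed.

Lemma Qop_lump ys A s (g : gst -> int) : good A s -> uniq ys ->
  Qop (fun u => (g (rho ys u))%:~R : R) s = (qsum (size ys) g (rho ys s))%:~R / 2.
Proof.
move=> gs u; rewrite QopE; congr (_ / _).
rewrite /qsum sumzE big_map rmorph_sum /=.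
rewrite (@lin_sum ys A s (fun m1 => (sumz [seq g (gmerge (size ys) (rho ys s) m1 m2) - g (rho ys s)
  | m2 <- (rho ys s).1 & m1 != m2])%:~R) gs).
rewrite (eq_bigl (fun p => (p.1 \in s.1) && ((p.2 \in s.1) && (p.1 != p.2))));
  last by move=> p; rewrite inE.
rewrite -(pair_big_dep (mem s.1) (fun B1 B2 => (B2 \in s.1) && (B1 != B2))
  (fun B1 B2 => (g (rho ys (cmerge s B1 B2)))%:~R - (g (rho ys s))%:~R)) /=.
rewrite [in RHS]big_mkcondr /=; apply: eq_bigr => B1 h1.
case: posnP => c1.
  by rewrite big1 // => B2 /andP[h2 n12]; rewrite (rho_merge0 gs) // subrr.
rewrite sumzE big_map big_filter rmorph_sum /= [RHS]big_mkcond /=.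
rewrite (@lin_sum ys A s (fun m2 => if mk ys B1 != m2 then
  (g (gmerge (size ys) (rho ys s) (mk ys B1) m2) - g (rho ys s))%:~R else 0) gs).
rewrite [in LHS]big_mkcondr [in RHS]big_mkcondr /=; apply: eq_bigr => B2 h2.
rewrite (mk_neq gs) //; case: (eqVneq B1 B2) => //= [_|n12]; first by case: ifP.
case: posnP => c2; last by rewrite (rho_merge gs) // rmorphB.
by rewrite cmergeC (rho_merge0 gs) ?subrr // eq_sym.
Qed.

Lemma Pop_lump ys A (g : gst -> int) (k2 : int) (t : R) s :
  good A s -> uniq ys -> (size ys <= 5)%N -> {subset ys <= A} ->
  eigen k2 (size ys) g ->
  Pop t (fun u => (g (rho ys u))%:~R) s =
  expR (- (k2%:~R / 2) * t) * (g (rho ys s))%:~R.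
Proof.
move=> gs u s5 sub /allP eg; apply: (Pop_eigen (V := good A)) => //.
  by move=> *; exact: good_merge.
move=> v gv; rewrite (Qop_lump _ gv) //.
have [_ _ _ _ /(_ ys u s5 sub) rv] := gv.
have /eqP -> := eg _ rv; rewrite rmorphM rmorphN /=; ring.
Qed.

Lemma Proot_lump ys A (g : gst -> int) (phi : state X -> R) s :
  good A s -> uniq ys -> (size ys <= 5)%N -> {subset ys <= A} ->
  eigen 0 (size ys) g ->
  (forall u, good A u -> (#|u.1| <= 1)%N -> phi u = (g (rho ys u))%:~R) ->
  Proot phi s = (g (rho ys s))%:~R.
Proof.
move=> gs u s5 sub /allP eg e.
have cl v p : good A v -> p \in lpairs v -> good A (cmerge v p.1 p.2) by exact: good_merge.
rewrite (eq_Proot (psi := fun u => (g (rho ys u))%:~R) cl) //.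
rewrite (Proot_harmonic cl) // => v gv; rewrite (Qop_lump _ gv) //.
have [_ _ _ _ /(_ ys u s5 sub) rv] := gv.
by have /eqP -> := eg _ rv; rewrite oppr0 mul0r mul0r.
Qed.

Lemma good_leaf a : good [set a] ([set [set a]], finset.set0).
Proof.
split => /=.
- by move=> B B'; rewrite !inE => /eqP-> /eqP->; rewrite eqxx.
- by move=> B; rewrite inE => /eqP->.
- by move=> B; rewrite inE.
- by move=> B; rewrite inE => /eqP->; rewrite cards1 orbT.
move=> [|y [|z ys]] u s5 sub.
- by rewrite /rho /smasks enum_set1 enum_set0 /=.
- have := sub y (mem_head _ _); rewrite inE => /eqP ->.
  by rewrite /rho /smasks enum_set1 enum_set0 /= inE eqxx.
- have := sub y (mem_head _ _); have := sub z; rewrite !inE eqxx orbT => /(_ isT)/eqP ez /eqP ey.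
  by move: u; rewrite /= ey ez inE eqxx.
Qed.

Lemma emb_mk ys (P : pred X) B : (forall y, y \in ys -> y \in B -> P y) ->
  mk ys B = emb (map P ys) (mk (mask (map P ys) ys) B).
Proof.
elim: ys => //= y ys IH h; case Py: (P y) => /=.
  by congr (_ :: _); apply: IH => z zy; apply: h; rewrite inE zy orbT.
congr (_ :: _); last by apply: IH => z zy; apply: h; rewrite inE zy orbT.
by apply/negP => yB; move: (h y (mem_head _ _) yB); rewrite Py.
Qed.

Lemma count_emb sel m : (size m <= count id sel)%N -> count id (emb sel m) = count id m.
Proof.
elim: sel m => [|[] sel IH] m /=; first by rewrite leqn0 size_eq0 => /eqP->.
  by case: m => [|b m] /= h; rewrite IH.
by rewrite add0n => h; rewrite add0n; exact: IH.
Qed.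

Lemma size_mask_map (P : pred X) ys : size (mask (map P ys) ys) = count id (map P ys).
Proof. by rewrite size_mask ?size_map. Qed.

Lemma emb_norm ys (P : pred X) (S : {set {set X}}) n m :
  (forall B, B \in S -> forall y, y \in ys -> y \in B -> P y) ->
  (n <= count id m)%N ->
  (m \in map (emb (map P ys)) (norm (count id (map P ys)) n (smasks (mask (map P ys) ys) S)))
  = (m \in smasks ys S).
Proof.
move=> h cm; have ce B : count id (emb (map P ys) (mk (mask (map P ys) ys) B)) =
    count id (mk (mask (map P ys) ys) B).
  by rewrite count_emb // size_mk size_mask_map.
apply/mapP/smasksP => [[m']|[B BS em]].
  rewrite mem_norm => /and3P[_ _ /smasksP[B BS ->]] ->; exists B => //.
  by rewrite -emb_mk //; exact: h.
have e := emb_mk (h _ BS).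
exists (mk (mask (map P ys) ys) B); last by rewrite em.
rewrite mem_norm size_mk size_mask_map eqxx -ce -e -em cm.
by apply/smasksP; exists B.
Qed.

Lemma rho_union ys (A A' : {set X}) s s' : good A s -> good A' s' -> [disjoint A & A'] ->
  let sel := [seq y \in A | y <- ys] in
  rho ys (sunion s s') =
  gjoin sel (rho (mask sel ys) s) (rho (mask (map negb sel) ys) s').
Proof.
move=> [_ sA kA _ _] [_ sA' kA' _ _] dA /=.
have nsel : map negb [seq y \in A | y <- ys] = [seq y \notin A | y <- ys] by rewrite -map_comp.
have hA (S : {set {set X}}) : (forall B, B \in S -> B \subset A) ->
    forall B, B \in S -> forall y, y \in ys -> y \in B -> y \in A.
  by move=> h B /h /subsetP sB y _ /sB.
have hA' (S : {set {set X}}) : (forall B, B \in S -> B \subset A') ->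
    forall B, B \in S -> forall y, y \in ys -> y \in B -> y \notin A.
  move=> h B /h /subsetP sB y _ /sB yA'; apply/negP => yA; exact: (disjointE dA yA yA').
have smU (S S' : {set {set X}}) m :
    (m \in smasks ys (S :|: S')) = (m \in smasks ys S) || (m \in smasks ys S').
  apply/smasksP/orP => [[B]|[/smasksP[B BS ->]|/smasksP[B BS ->]]].
  + by rewrite inE => /orP[BS|BS] ->; [left|right]; apply/smasksP; exists B.
  + by exists B; rewrite // inE BS.
  + by exists B; rewrite // inE BS orbT.
rewrite /gjoin nsel /rho !size_mask_map size_map.
congr (_, _); apply: eq_norm => m sm cm; rewrite mem_cat smU.
  by rewrite (emb_norm (hA _ sA)) // (emb_norm (hA' _ sA')).
by rewrite (emb_norm (hA _ kA)) // (emb_norm (hA' _ kA')).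
Qed.

Lemma good_union (A A' : {set X}) s s' : good A s -> good A' s' -> [disjoint A & A'] ->
  good (A :|: A') (sunion s s').
Proof.
move=> gs gs' dA; have [dj sA kA sg rr] := gs; have [dj' sA' kA' sg' rr'] := gs'.
have dBB B B' : B \in s.1 -> B' \in s'.1 -> [disjoint B & B'].
  move=> /sA h /sA' h'; apply/pred0P => x /=; apply/negP => /andP[xB xB'].
  exact: (disjointE dA (subsetP h _ xB) (subsetP h' _ xB')).
split.
- move=> B B'; rewrite !inE => /orP[b|b] /orP[b'|b'] n.
  + exact: dj. + exact: dBB. + by rewrite disjoint_sym; exact: dBB. + exact: dj'.
- move=> B; rewrite inE => /orP[/sA|/sA'] h.
  + exact: (subset_trans h (subsetUl _ _)). + exact: (subset_trans h (subsetUr _ _)).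
- move=> B; rewrite inE => /orP[/kA|/kA'] h.
  + exact: (subset_trans h (subsetUl _ _)). + exact: (subset_trans h (subsetUr _ _)).
- move=> B; rewrite !inE => /orP[/sg|/sg'] /orP[]-> ; by rewrite ?orbT.
move=> ys u s5 sub; rewrite (rho_union _ gs gs' dA).
set sel := [seq y \in A | y <- ys].
have s1 : size (mask sel ys) = count id sel by rewrite size_mask ?size_map.
have s2 : size (mask (map negb sel) ys) = count id (map negb sel) by rewrite size_mask ?size_map.
have le1 : (size (mask sel ys) <= 5)%N by apply: leq_trans s5; apply: size_subseq; exact: mask_subseq.
have le2 : (size (mask (map negb sel) ys) <= 5)%N by apply: leq_trans s5; apply: size_subseq; exact: mask_subseq.
have sub1 : {subset mask sel ys <= A}.
  by move=> y; rewrite /sel -filter_mask mem_filter => /andP[].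
have sub2 : {subset mask (map negb sel) ys <= A'}.
  move=> y; rewrite /sel -map_comp -filter_mask mem_filter => /andP[/= nA /sub].
  by rewrite inE (negbTE nA).
have r1 := rr _ (mask_uniq u _) le1 sub1; have r2 := rr' _ (mask_uniq u _) le2 sub2.
rewrite s1 in r1; rewrite s2 in r2.
have /allP/(_ sel) := reach_join5 s5; rewrite mem_masks size_map eqxx => /(_ isT).
by move/allP/(_ _ r1)/allP/(_ _ r2).
Qed.

Variable lam : {set X} -> R.

Lemma eq_Ex t (phi psi : state X -> R) : wf t ->
  (forall s, good (cl t) s -> phi s = psi s) -> Ex lam t phi = Ex lam t psi.
Proof.
elim: t phi psi => [a|l IHl r IHr] phi psi /=; first by move=> _ h; apply: h; exact: good_leaf.
case/and3P => wl wr d h; apply: IHr => // s2 g2; apply: IHl => // s1 g1.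
apply: (eq_Pop (V := good (cl l :|: cl r))) => //; last exact: good_union.
by move=> *; exact: good_merge.
Qed.

Lemma Ex_cst t (c : R) : Ex lam t (fun=> c) = c.
Proof.
elim: t => //= l IHl r IHr.
have P s : Pop (lam (cl l :|: cl r)) (fun=> c) s = c.
  rewrite (@Pop_eigen _ _ (fun=> True) _ 0) ?oppr0 ?mul0r ?expR0 ?mul1r // => v _.
  by rewrite QopE big1 ?mul0r ?oppr0 // => p _; rewrite subrr.
under eq_fun do under eq_fun do rewrite P.
by under eq_fun do rewrite IHl.
Qed.

Definition Exg t ys (g : gst -> int) : R := Ex lam t (fun s => (g (rho ys s))%:~R).

Lemma Exroot_harmonic t ys (g : gst -> int) (phi : state X -> R) :
  wf t -> uniq ys -> (1 < size ys <= 5)%N -> {subset ys <= cl t} ->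
  eigen 0 (size ys) g ->
  (forall u, good (cl t) u -> (#|u.1| <= 1)%N -> phi u = (g (rho ys u))%:~R) ->
  Exroot lam t phi = Exg t ys g.
Proof.
move=> w u /andP[s1 s5] sub eg e; case: t w sub e => [a|l r] w sub e.
  case: ys u s1 s5 sub eg e => [|y [|z ys]] //= /andP[yz _] _ _ sub.
  have := sub y (mem_head _ _); have := sub z; rewrite !inE eqxx orbT => /(_ isT)/eqP ez /eqP ey.
  by rewrite ey ez inE eqxx in yz.
have /= /and3P[wl wr d] := w.
apply: eq_Ex => // s2 g2; apply: eq_Ex => // s1' g1.
have gu := good_union g1 g2 d.
rewrite (Proot_lump gu u s5 sub eg e) (Pop_lump _ gu u s5 sub eg).
by rewrite mul0r oppr0 mul0r expR0 mul1r.
Qed.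

Lemma Exg_Node l r ys (g : gst -> int) (k2 : int) :
  wf (Node l r) -> uniq ys -> (size ys <= 5)%N -> {subset ys <= cl (Node l r)} ->
  eigen k2 (size ys) g ->
  Exg (Node l r) ys g = expR (- (k2%:~R / 2) * lam (cl (Node l r))) *
    Ex lam r (fun s2 => Ex lam l (fun s1 => (g (rho ys (sunion s1 s2)))%:~R)).
Proof.
move=> w u s5 sub eg; have /= /and3P[wl wr d] := w.
rewrite /Exg /= -ExZ; apply: eq_Ex => // s2 g2; rewrite -ExZ; apply: eq_Ex => // s1 g1.
exact: (Pop_lump _ (good_union g1 g2 d) u s5 sub eg).
Qed.

Lemma rho_union_out ys A s s' : good A s' -> (forall y, y \in ys -> y \notin A) ->
  rho ys (sunion s s') = rho ys s.
Proof.
move=> [_ sA kA _ _] out.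
have z B : B \subset A -> count id (mk ys B) = 0%N.
  move=> /subsetP sB; apply/eqP; rewrite -leqn0 leqNgt; apply/negP => /mk_countP[y yy /sB yA].
  by have := out y yy; rewrite yA.
rewrite /rho; congr (_, _); apply: eq_norm => m sm cm; apply/smasksP/smasksP => -[B].
- rewrite inE => /orP[BS em|/sA/z c em]; first by exists B.
  by rewrite em c in cm.
- by move=> BS em; exists B; rewrite // inE BS.
- rewrite inE => /orP[BS em|/kA/z c em]; first by exists B.
  by rewrite em c in cm.
- by move=> BS em; exists B; rewrite // inE BS.
Qed.

Definition dep t (a b : X) : R := \sum_(B in cls t | (a \in B) && (b \in B)) lam B.

Lemma depC t a b : dep t a b = dep t b a.
Proof. by apply: eq_bigl => B; rewrite [(a \in B) && _]andbC. Qed.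

Lemma dep_out t a b : a \notin cl t -> dep t a b = 0.
Proof.
move=> at'; apply: big1 => B /and3P[/cls_sub[/subsetP s _] aB _].
by rewrite (s _ aB) in at'.
Qed.

Lemma dep_Node l r a b : wf (Node l r) -> a \in cl (Node l r) -> b \in cl (Node l r) ->
  dep (Node l r) a b = lam (cl (Node l r)) + (dep l a b + dep r a b).
Proof.
move=> w ha hb; have /= /and3P[wl wr d] := w.
have [x xl] := cl_neq0 l; have [y yr] := cl_neq0 r.
rewrite /dep (bigD1 (cl (Node l r))) /=; last by rewrite !inE eqxx /= -!in_setU ha hb.
congr (_ + _); rewrite !big_mkcondr /=.
have Al : cl l :|: cl r \notin cls l.
  apply/negP => /cls_sub[/subsetP s _]; apply: (disjointE d (s y _) yr).
  by rewrite inE yr orbT.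
have Ar : cl l :|: cl r \notin cls r.
  by apply/negP => /cls_sub[/subsetP s _]; apply: (disjointE d xl (s x _)); rewrite inE xl.
rewrite big_mkcond [X in _ = X + _]big_mkcond [X in _ = _ + X]big_mkcond -big_split /=.
apply: eq_bigr => B _; rewrite !inE.
case: (eqVneq B (cl l :|: cl r)) => [->|nB] /=.
  by rewrite (negbTE Al) (negbTE Ar) addr0; case: ifP.
case Bl: (B \in cls l); case Br: (B \in cls r); rewrite ?andbT ?andbF ?addr0 ?add0r //=.
have [/subsetP s1 [z zB]] := cls_sub Bl; have [/subsetP s2 _] := cls_sub Br.
by case: (disjointE d (s1 _ zB) (s2 _ zB)).
Qed.

Definition pos t := forall B, B \in cls t -> (1 < #|B|)%N -> 0 < lam B.
Definition pos0 t := forall B, B \in cls t -> (1 < #|B|)%N -> B != cl t -> 0 < lam B.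

Lemma pos_pos0 t : pos t -> pos0 t.
Proof. by move=> h B Bt B1 _; exact: h. Qed.

Lemma pos_children l r : wf (Node l r) -> pos0 (Node l r) -> pos l /\ pos r.
Proof.
move=> w p0; have /= /and3P[wl wr d] := w.
have [x xl] := cl_neq0 l; have [y yr] := cl_neq0 r.
split => B Bt B1; apply: p0 => //=; rewrite ?inE ?Bt ?orbT //; apply/eqP => e;
have [/subsetP s _] := cls_sub Bt.
  by apply: (disjointE d (s y _) yr); rewrite e inE yr orbT.
by apply: (disjointE d xl (s x _)); rewrite e inE xl.
Qed.

Lemma dep_pos t a b : wf t -> pos t -> a \in cl t -> b \in cl t -> a != b -> 0 < dep t a b.
Proof.
move=> w p at' bt ab; rewrite /dep (bigD1 (cl t)) /=; last by rewrite cl_cls at' bt.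
have c1 (B : {set X}) : a \in B -> b \in B -> (1 < #|B|)%N.
  by move=> aB bB; apply/card_gt1P; exists a, b.
rewrite ltr_pwDl ?p ?cl_cls ?c1 //; apply: sumr_ge0 => B /andP[/and3P[Bt aB bB] _].
by rewrite ltW // p // c1.
Qed.

End StateMask.

(** * Eigenfunctions and their splittings *)

Definition andm (m1 m2 : bitseq) : bitseq := [seq p.1 && p.2 | p <- zip m1 m2].

Definition cst1 (x : gst) : int := 1.

Definition apart (S : bitseq) (x : gst) : int :=
  if all (fun m => count id (andm m S) <= 1)%N x.1 then 1 else 0.

Definition apart_all (x : gst) : int := if all (fun m => count id m <= 1)%N x.1 then 1 else 0.

(* 3 times the harmonic extension of the indicator that, among three taxa, the
   pair [p] coalesces first. *)
Definition first_pair (p : bitseq) (x : gst) : int := if p \in x.2 then 3 else apart_all x.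

(* 3 times the harmonic extension of the indicator that the quartet [p] is
   displayed. *)
Definition quartet_h (p : bitseq) (x : gst) : int :=
  if (p \in x.2) || (map negb p \in x.2) then 3 else apart_all x.

Definition pairm (k i j : nat) : bitseq := mkseq (fun n => (n == i) || (n == j)) k.

Definition is_middle (i : nat) (x : gst) : bool :=
  ~~ has (fun j => (j != i) && ((pairm 5 i j \in x.2) || (map negb (pairm 5 i j) \in x.2)))
       (iota 0 5).

(* 30 times the harmonic extension of the indicator that taxon [i] is the
   middle leaf of the unrooted gene tree on five taxa. *)
Definition middle_h (i : nat) (x : gst) : int :=
  match size x.1 with
  | 5 => 6
  | 4 => if has (fun m => nth false m i) x.2 then 0 else 10
  | _ => if is_middle i x then 30 else 0
  end.

Definition lone (x : gst) : gst := gjoin [:: true; true; true; true; false] x ([:: [:: true]], [::]).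

Definition cat_rest (x : gst) : int := middle_h 4 (lone x) - middle_h 3 (lone x) + 5 * apart_all x.
Definition cat_rest' (x : gst) : int := middle_h 0 (lone x) - middle_h 1 (lone x).
Definition pse_rest (i : nat) (x : gst) : int := middle_h i (lone x) - apart_all x.

Lemma eigen_apart_all k : (k <= 5)%N -> eigen (k * k.-1)%:Z k apart_all.
Proof.
have /allP h : all (fun k => eigen (k * k.-1)%:Z k apart_all) (iota 0 6) by vm_cast_no_check (erefl true).
by move=> k5; apply: h; rewrite mem_iota.
Qed.

Definition pairs3 : seq bitseq := [:: [:: true; true; false]; [:: true; false; true]; [:: false; true; true]].

Lemma eigen_apart p : p \in pairs3 -> eigen 2 3 (apart p).
Proof.
have /allP h : all (fun p => eigen 2 3 (apart p)) pairs3 by vm_cast_no_check (erefl true).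
exact: h.
Qed.

Lemma eigen_first_pair p : p \in pairs3 -> eigen 0 3 (first_pair p).
Proof.
have /allP h : all (fun p => eigen 0 3 (first_pair p)) pairs3 by vm_cast_no_check (erefl true).
exact: h.
Qed.

Definition pairs4 : seq bitseq := [:: [:: true; true; false; false];
  [:: true; false; true; false]; [:: true; false; false; true]].

Lemma eigen_quartet_h p : p \in pairs4 -> eigen 0 4 (quartet_h p).
Proof.
have /allP h : all (fun p => eigen 0 4 (quartet_h p)) pairs4 by vm_cast_no_check (erefl true).
exact: h.
Qed.

Lemma eigen_middle_h i : (i < 5)%N -> eigen 0 5 (middle_h i).
Proof.
have /allP h : all (fun i => eigen 0 5 (middle_h i)) (iota 0 5) by vm_cast_no_check (erefl true).
by move=> i5; apply: h; rewrite mem_iota.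
Qed.

Lemma eigen_rest : [&& eigen 0 4 cat_rest, eigen 0 4 cat_rest' & all (fun i => eigen 0 4 (pse_rest i)) (iota 0 4)].
Proof. by vm_cast_no_check (erefl true). Qed.

Lemma decomp_cat :
  let sel := [:: true; true; true; true; false] in
  let sel' := [:: true; true; true; false] in
  [&& decomp sel (fun x => middle_h 4 x - middle_h 3 x) [:: (cat_rest, cst1); (fun x => -5 * apart_all x, cst1)],
      decomp sel (fun x => middle_h 0 x - middle_h 1 x) [:: (cat_rest', cst1)],
      decomp sel' cat_rest [:: (fun x => 5 * apart_all x, cst1)] &
      decomp sel' cat_rest' [:: (fun x => 10 * first_pair [:: false; true; true] x, cst1);
        (fun x => -10 * first_pair [:: true; false; true] x, cst1);
        (fun x => -20 * apart [:: true; false; true] x, cst1);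
        (fun x => 20 * apart [:: false; true; true] x, cst1)]].
Proof. by vm_cast_no_check (erefl true). Qed.

Lemma decomp_bal :
  let sel := [:: true; true; true; false; false] in
  let d3 := [:: (fun x => 5 * apart [:: true; true; false] x, apart_all);
                (fun x => 5 * apart [:: true; false; true] x, apart_all);
                (fun x => 5 * apart [:: false; true; true] x, apart_all); (fun x => -9 * apart_all x, apart_all)] in
  let d0 p1 p2 := [:: (fun x => 10 * first_pair p2 x, cst1);
     (fun x => -10 * apart p1 x, apart_all); (fun x => -10 * apart [:: true; true; false] x, apart_all);
     (fun x => 10 * apart p2 x, apart_all); (fun x => 6 * apart_all x, apart_all)] in
  [&& decomp sel (middle_h 3) d3, decomp sel (middle_h 4) d3,
      decomp sel (middle_h 0) (d0 [:: true; false; true] [:: false; true; true]) &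
      decomp sel (middle_h 1) (d0 [:: false; true; true] [:: true; false; true])].
Proof. by vm_cast_no_check (erefl true). Qed.

Lemma decomp_pse :
  let sel := [:: true; true; true; true; false] in
  let sel' := [:: true; true; false; false] in
  [&& all (fun i => decomp sel (middle_h i) [:: (pse_rest i, cst1); (apart_all, cst1)]) (iota 0 4),
      all (fun i => decomp sel' (pse_rest i)
        [:: (fun x => 10 * apart_all x, cst1); (fun x => -5 * apart_all x, apart_all)]) [:: 0; 1]%N &
      all (fun i => decomp sel' (pse_rest i)
        [:: (cst1, fun x => 10 * apart_all x); (fun x => -5 * apart_all x, apart_all)]) [:: 2; 3]%N].
Proof. by vm_cast_no_check (erefl true). Qed.

(** * Means of eigenfunctions *)

Section Split.
Variables (R : realType) (X : finType) (lam : {set X} -> R).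
Implicit Types (t l r : btree X) (ys : seq X) (g : gst -> int).

Local Notation dep := (dep lam).
Local Notation Exg := (Exg lam).
Local Notation pos := (pos lam).
Local Notation pos0 := (pos0 lam).

Lemma join_decomp l r ys g ds : wf l -> wf r -> [disjoint cl l & cl r] -> uniq ys ->
  (size ys <= 5)%N -> {subset ys <= cl l :|: cl r} ->
  let sel := [seq y \in cl l | y <- ys] in
  decomp sel g ds ->
  Ex lam r (fun s2 => Ex lam l (fun s1 => (g (rho ys (sunion s1 s2)))%:~R)) =
  \sum_(d <- ds) Exg l (mask sel ys) d.1 * Exg r (mask (map negb sel) ys) d.2.
Proof.
move=> wl wr d u s5 sub sel /allP dec.
have s1 : size (mask sel ys) = count id sel by rewrite size_mask ?size_map.
have s2 : size (mask (map negb sel) ys) = count id (map negb sel) by rewrite size_mask ?size_map.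
have le1 : (size (mask sel ys) <= 5)%N by apply: leq_trans s5; apply: size_subseq; exact: mask_subseq.
have le2 : (size (mask (map negb sel) ys) <= 5)%N by apply: leq_trans s5; apply: size_subseq; exact: mask_subseq.
have sub1 : {subset mask sel ys <= cl l}.
  by move=> y; rewrite /sel -filter_mask mem_filter => /andP[].
have sub2 : {subset mask (map negb sel) ys <= cl r}.
  move=> y; rewrite /sel -map_comp -filter_mask mem_filter => /andP[/= nA /sub].
  by rewrite inE (negbTE nA).
transitivity (Ex lam r (fun s2 => \sum_(d <- ds)
    Exg l (mask sel ys) d.1 * (d.2 (rho (mask (map negb sel) ys) s2))%:~R)).
  apply: eq_Ex => // v2 g2.
  transitivity (Ex lam l (fun v1 => \sum_(d <- ds)
    (d.2 (rho (mask (map negb sel) ys) v2))%:~R * (d.1 (rho (mask sel ys) v1))%:~R)).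
    apply: eq_Ex => // v1 g1; rewrite (rho_union _ g1 g2 d).
    have [_ _ _ _ /(_ _ (mask_uniq u _) le1 sub1)] := g1; rewrite s1 => r1.
    have [_ _ _ _ /(_ _ (mask_uniq u _) le2 sub2)] := g2; rewrite s2 => r2.
    have /allP/(_ _ r2)/eqP -> := dec _ r1; rewrite sumzE big_map rmorph_sum /=.
    by apply: eq_bigr => e _; rewrite rmorphM mulrC.
  rewrite Ex_sum; apply: eq_bigr => e _; rewrite ExZ mulrC; congr (_ * _).
rewrite Ex_sum; apply: eq_bigr => e _; by rewrite ExZ.
Qed.

Lemma Exg_out l r ys g : wf l -> wf r -> uniq ys -> (forall y, y \in ys -> y \notin cl r) ->
  Ex lam r (fun s2 => Ex lam l (fun s1 => (g (rho ys (sunion s1 s2)))%:~R)) = Exg l ys g.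
Proof.
move=> wl wr u out; rewrite -[RHS](Ex_cst lam r); apply: eq_Ex => // s2 g2.
by apply: eq_Ex => // s1 g1; rewrite (rho_union_out _ g2).
Qed.

Lemma Ex_sunion_swap l r (F : state X -> R) :
  Ex lam r (fun s2 => Ex lam l (fun s1 => F (sunion s1 s2))) =
  Ex lam l (fun s2 => Ex lam r (fun s1 => F (sunion s1 s2))).
Proof.
rewrite Ex_swap; congr (Ex _ l _); apply/funext => s1; congr (Ex _ r _).
by apply/funext => s2; rewrite sunionC.
Qed.

(* [l] and [r] are the subtrees below the most recent common ancestor of [ys]
   in [t], and [de] is the depth of that ancestor. *)
Definition splits t ys l r (de : R) : Prop :=
  [/\ [/\ wf l, wf r, pos l & pos r],
      {in ys, forall y, (y \in cl r) = (y \notin cl l)},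
      {in ys &, forall a b, a != b -> a \in cl l -> b \in cl l ->
         dep t a b = de + dep l a b},
      {in ys &, forall a b, a != b -> a \notin cl l -> b \notin cl l ->
         dep t a b = de + dep r a b} /\
      {in ys &, forall a b, a != b -> a \in cl l -> b \notin cl l -> dep t a b = de} &
      forall k2 g ds, eigen k2 (size ys) g ->
        decomp [seq y \in cl l | y <- ys] g ds ->
        Exg t ys g = expR (- (k2%:~R / 2) * de) *
          \sum_(d <- ds) Exg l (mask [seq y \in cl l | y <- ys] ys) d.1 *
                         Exg r (mask [seq y \notin cl l | y <- ys] ys) d.2].

Lemma split_mrca t (y0 : X) ys : wf t -> pos0 t -> uniq (y0 :: ys) -> (0 < size ys <= 4)%N ->
  {subset (y0 :: ys) <= cl t} ->
  exists l r de, [/\ splits t (y0 :: ys) l r de, y0 \in cl l & has (fun y => y \notin cl l) ys].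
Proof.
move=> w p u /andP[s1 s5]; elim: t w p => [a|l IHl r IHr] w p sub.
  case: ys u s1 s5 sub => // z ys /= /andP[yz _] _ _ sub.
  have := sub y0 (mem_head _ _); have := sub z; rewrite !inE eqxx orbT => /(_ isT)/eqP ez /eqP ey.
  by move: yz; rewrite ey ez inE eqxx.
have [pl pr] := pos_children w p.
have /= /and3P[wl wr d] := w.
have dN a b := @dep_Node _ _ lam l r a b w.
have nlr y : y \in cl l -> y \notin cl r by move=> yl; apply/negP => yr; exact: (disjointE d yl yr).
have nrl y : y \in cl r -> y \notin cl l by move=> yr; apply/negP => yl; exact: (disjointE d yl yr).
have lr y : y \in y0 :: ys -> (y \in cl r) = (y \notin cl l).
  move=> /sub; rewrite /= inE; case: (boolP (y \in cl l)) => [yl _|_ /= -> //].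
  exact/negbTE/nlr.
have rl y : y \in y0 :: ys -> (y \in cl l) = (y \notin cl r).
  by move=> /lr ->; rewrite negbK.
have nsel q : map negb [seq y \in cl q | y <- y0 :: ys] = [seq y \notin cl q | y <- y0 :: ys].
  by rewrite -map_comp.
case: (boolP (all (fun y => y \in cl l) (y0 :: ys))) => [/allP al|nal].
  have [l' [r' [de [[h1 h2 h3 [h4 h4'] h5] yl hs]]]] := IHl wl (pos_pos0 pl) al.
  have e a b : a \in y0 :: ys -> b \in y0 :: ys ->
      dep (Node l r) a b = lam (cl (Node l r)) + dep l a b.
    by move=> ha hb; rewrite dN ?sub // (dep_out _ _ (nlr _ (al _ ha))) addr0.
  exists l', r', (lam (cl (Node l r)) + de); split => //; split => //.
  - by move=> a b ha hb ab la lb; rewrite e // h3 // addrA.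
  - by split=> a b ha hb ab la lb; rewrite e //; [rewrite h4 ?addrA | rewrite h4'].
  move=> k2 g ds eg dec; rewrite (Exg_Node _ w u _ sub eg) //.
  rewrite Exg_out //; last by move=> y /al/nlr.
  by rewrite (h5 _ _ _ eg dec) mulrA -expRD mulrDr.
case: (boolP (all (fun y => y \in cl r) (y0 :: ys))) => [/allP ar|nar].
  have [l' [r' [de [[h1 h2 h3 [h4 h4'] h5] yl hs]]]] := IHr wr (pos_pos0 pr) ar.
  have e a b : a \in y0 :: ys -> b \in y0 :: ys ->
      dep (Node l r) a b = lam (cl (Node l r)) + dep r a b.
    by move=> ha hb; rewrite dN ?sub // (dep_out _ _ (nrl _ (ar _ ha))) add0r.
  exists l', r', (lam (cl (Node l r)) + de); split => //; split => //.
  - by move=> a b ha hb ab la lb; rewrite e // h3 // addrA.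
  - by split=> a b ha hb ab la lb; rewrite e //; [rewrite h4 ?addrA | rewrite h4'].
  move=> k2 g ds eg dec; rewrite (Exg_Node _ w u _ sub eg) //.
  rewrite (Ex_sunion_swap l r (fun s => (g (rho (y0 :: ys) s))%:~R)) Exg_out //; last by move=> y /ar/nrl.
  by rewrite (h5 _ _ _ eg dec) mulrA -expRD mulrDr.
case yl: (y0 \in cl l).
  exists l, r, (lam (cl (Node l r))); split => //; last by move: nal; rewrite -has_predC /= yl.
  split => //.
  - by move=> a b ha hb ab la lb; rewrite dN ?sub // (dep_out _ _ (nlr _ la)) addr0.
  - split=> a b ha hb ab la lb; rewrite dN ?sub //.
      by rewrite (dep_out _ _ la) add0r.
    by rewrite [dep l _ _]depC (dep_out _ _ lb) (dep_out _ _ (nlr _ la)) !addr0.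
  move=> k2 g ds eg dec; rewrite (Exg_Node _ w u _ sub eg) //.
  by rewrite (join_decomp wl wr d u _ _ dec) // nsel.
have yr : y0 \in cl r by rewrite lr ?yl // mem_head.
exists r, l, (lam (cl (Node l r))); split => //; last by move: nar; rewrite -has_predC /= yr.
split => //.
- by move=> a b ha hb ab la lb; rewrite dN ?sub // (dep_out _ _ (nrl _ la)) add0r.
- split=> a b ha hb ab la lb; rewrite dN ?sub //.
    by rewrite (dep_out _ _ la) addr0.
  by rewrite [dep r _ _]depC (dep_out _ _ lb) (dep_out _ _ (nrl _ la)) !addr0.
move=> k2 g ds eg dec; rewrite (Exg_Node _ w u _ sub eg) //.
rewrite (Ex_sunion_swap l r (fun s => (g (rho (y0 :: ys) s))%:~R)) (join_decomp wr wl _ u _ _ dec) ?nsel //; first by rewrite disjoint_sym.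
by move=> y /sub; rewrite /= !inE orbC.
Qed.

Lemma dep_ge t ys l r de a b : splits t ys l r de ->
  a \in ys -> b \in ys -> a != b -> de <= dep t a b.
Proof.
move=> [[wl wr pl pr] hr hl [hrr hlr] _] ha hb ab.
case al: (a \in cl l); case bl: (b \in cl l).
- by rewrite hl // lerDl ltW // dep_pos.
- by rewrite hlr // bl.
- by rewrite depC hlr // ?al // eq_sym.
- by rewrite hrr ?al ?bl // lerDl ltW // dep_pos // hr // ?al ?bl.
Qed.

Lemma Exg_cst1 t ys : Exg t ys cst1 = 1.
Proof. by rewrite /Exg Ex_cst. Qed.

Lemma ExgZ t ys (c : int) g : Exg t ys (fun x => c * g x) = c%:~R * Exg t ys g.
Proof.
rewrite /Exg -ExZ; congr (Ex _ t _); apply/funext => s; by rewrite rmorphM.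
Qed.

Lemma ExgB t ys g g' : Exg t ys (fun x => g x - g' x) = Exg t ys g - Exg t ys g'.
Proof.
rewrite /Exg -mulN1r -[RHS]addrC -[in RHS]Ex_linear; congr (Ex _ t _).
by apply/funext => s; rewrite rmorphB /= mulN1r addrC.
Qed.

Lemma Exg_nall2 t a b : wf t -> pos0 t -> uniq [:: a; b] -> {subset [:: a; b] <= cl t} ->
  Exg t [:: a; b] apart_all = expR (- dep t a b).
Proof.
move=> w p u sub; have [l [r [de [sp al]]]] := split_mrca w p u isT sub.
rewrite /= orbF => bl.
have [_ _ _ [_ hlr] E] := sp; have ab : a != b by move: u; rewrite /= inE andbT.
rewrite (E 2 apart_all [:: (cst1, cst1)]); first last.
- by rewrite /= al (negbTE bl); vm_cast_no_check (erefl true).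
- exact: (eigen_apart_all (k := 2)).
rewrite big_seq1 !Exg_cst1 (hlr a b) ?inE ?eqxx ?orbT // mulr1 mulr1; congr expR.
by rewrite divff ?mulN1r // pnatr_eq0.
Qed.

Lemma split_left t (y0 : X) ys l r de y z : splits t (y0 :: ys) l r de -> y0 \in cl l ->
  y \in ys -> z \in ys -> y0 != y -> y0 != z -> dep t y0 z < dep t y0 y -> y \in cl l.
Proof.
move=> sp y0l yy zz n1 n2 lt; apply/negPn/negP => yl.
have [_ _ _ [_ hlr] _] := sp.
have e := hlr y0 y (mem_head _ _) (mem_behead (s := y0 :: ys) yy) n1 y0l yl.
have := dep_ge sp (mem_head _ _) (mem_behead (s := y0 :: ys) zz) n2; lra.
Qed.

Lemma Exg3 t a b c : wf t -> pos0 t -> uniq [:: a; b; c] -> {subset [:: a; b; c] <= cl t} ->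
  dep t a c < dep t a b \/ dep t b c < dep t a b ->
  let ys := [:: a; b; c] in
  let e := expR (- (dep t a b - dep t a c)) in
  [/\ dep t a c = dep t b c,
      [/\ Exg t ys (first_pair [:: true; true; false]) = 3 - 2 * e,
          Exg t ys (first_pair [:: true; false; true]) = e &
          Exg t ys (first_pair [:: false; true; true]) = e],
      [/\ Exg t ys (apart [:: true; true; false]) = expR (- dep t a b),
          Exg t ys (apart [:: true; false; true]) = expR (- dep t a c) &
          Exg t ys (apart [:: false; true; true]) = expR (- dep t a c)] &
      Exg t ys apart_all = expR (- (dep t a b + 2 * dep t a c))].
Proof.
move=> w p u sub lt ys e; have [l [r [de [sp al hs]]]] := split_mrca w p u isT sub.
have [[wl wr pl pr] hr hl [hrr hlr] E] := sp.
have ab : a != b by dist u. have ac : a != c by dist u. have bc : b != c by dist u.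
have bl : b \in cl l.
  apply/negPn/negP => bl.
  have e1 : dep t a b = de by apply: hlr => //; memt.
  have e2 : de <= dep t a c by apply: (dep_ge sp) => //; memt.
  have e3 : de <= dep t b c by apply: (dep_ge sp) => //; memt.
  by case: lt; lra.
have cl' : c \notin cl l by move: hs; rewrite /= bl orbF.
have eac : dep t a c = de by apply: hlr => //; memt.
have ebc : dep t b c = de by apply: hlr => //; memt.
have eab : dep t a b = de + dep l a b by apply: hl => //; memt.
have N2 : Exg l [:: a; b] apart_all = expR (- dep l a b).
  apply: Exg_nall2 => //; first exact: pos_pos0; first by rewrite /= inE ab.
  by move=> y; rewrite !inE => /orP[]/eqP->.
move: E; rewrite /= al bl (negbTE cl') /= => E.
have ee : e = expR (- dep l a b) by rewrite /e eac eab; congr expR; ring.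
split; first by rewrite eac ebc.
- split.
  + rewrite (E 0 _ [:: (fun x => 3 * cst1 x, cst1); (fun x => -2 * apart_all x, cst1)]); [|exact: eigen_first_pair|vmt].
    by rewrite !big_cons big_nil /= !ExgZ !Exg_cst1 N2 ee mul0r oppr0 mul0r expR0; ring.
  + rewrite (E 0 _ [:: (apart_all, cst1)]); [|exact: eigen_first_pair|vmt].
    by rewrite big_seq1 /= Exg_cst1 N2 ee mul0r oppr0 mul0r expR0; ring.
  + rewrite (E 0 _ [:: (apart_all, cst1)]); [|exact: eigen_first_pair|vmt].
    by rewrite big_seq1 /= Exg_cst1 N2 ee mul0r oppr0 mul0r expR0; ring.
- split.
  + rewrite (E 2 _ [:: (apart_all, cst1)]); [|exact: eigen_apart|vmt].
    by rewrite big_seq1 /= Exg_cst1 N2 mulr1 -expRD eab; congr expR; field.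
  + rewrite (E 2 _ [:: (cst1, cst1)]); [|exact: eigen_apart|vmt].
    by rewrite big_seq1 /= !Exg_cst1 !mulr1 eac; congr expR; field.
  + rewrite (E 2 _ [:: (cst1, cst1)]); [|exact: eigen_apart|vmt].
    by rewrite big_seq1 /= !Exg_cst1 !mulr1 eac; congr expR; field.
- rewrite (E 6 _ [:: (apart_all, cst1)]); [|exact: (eigen_apart_all (k := 3))|vmt].
  by rewrite big_seq1 /= Exg_cst1 N2 mulr1 -expRD eab eac; congr expR; field.
Qed.

Lemma Exg3_last t a b c : wf t -> pos0 t -> uniq [:: a; b; c] -> {subset [:: a; b; c] <= cl t} ->
  dep t a b < dep t b c \/ dep t a c < dep t b c ->
  let ys := [:: a; b; c] in
  let e := expR (- (dep t b c - dep t a b)) in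
  [/\ dep t a b = dep t a c,
      Exg t ys (first_pair [:: false; true; true]) = 3 - 2 * e,
      Exg t ys (first_pair [:: true; false; true]) = e &
      Exg t ys (first_pair [:: true; true; false]) = e].
Proof.
move=> w p u sub lt ys e; have [l [r [de [sp al hs]]]] := split_mrca w p u isT sub.
have [[wl wr pl pr] hr hl [hrr hlr] E] := sp.
have ab : a != b by dist u. have ac : a != c by dist u. have bc : b != c by dist u.
have e2 : de <= dep t a b by apply: (dep_ge sp) => //; memt.
have e3 : de <= dep t a c by apply: (dep_ge sp) => //; memt.
have [bl cl'] : b \notin cl l /\ c \notin cl l.
  case bl: (b \in cl l); case cl': (c \in cl l) => //.
  - by move: hs; rewrite /= bl cl'.
  - have e1 : dep t b c = de by apply: hlr; rewrite ?cl' //; memt.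
    by case: lt; lra.
  - have e1 : dep t b c = de by rewrite depC; apply: hlr; rewrite ?bl // 1?eq_sym //; memt.
    by case: lt; lra.
have eac : dep t a c = de by apply: hlr => //; memt.
have eab : dep t a b = de by apply: hlr => //; memt.
have ebc : dep t b c = de + dep r b c by apply: hrr => //; memt.
have N2 : Exg r [:: b; c] apart_all = expR (- dep r b c).
  apply: Exg_nall2 => //; first exact: pos_pos0; first by rewrite /= inE bc.
  by move=> y; rewrite !inE => /orP[]/eqP->; rewrite hr //; memt.
move: E; rewrite /= al (negbTE bl) (negbTE cl') /= => E.
have ee : e = expR (- dep r b c) by rewrite /e eab ebc; congr expR; ring.
split; first by rewrite eac eab.
+ rewrite (E 0 _ [:: (fun x => 3 * cst1 x, cst1); (cst1, fun x => -2 * apart_all x)]); [|exact: eigen_first_pair|vmt].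
  by rewrite !big_cons big_nil /= !ExgZ !Exg_cst1 N2 ee mul0r oppr0 mul0r expR0; ring.
+ rewrite (E 0 _ [:: (cst1, apart_all)]); [|exact: eigen_first_pair|vmt].
  by rewrite big_seq1 /= Exg_cst1 N2 ee mul0r oppr0 mul0r expR0; ring.
+ rewrite (E 0 _ [:: (cst1, apart_all)]); [|exact: eigen_first_pair|vmt].
  by rewrite big_seq1 /= Exg_cst1 N2 ee mul0r oppr0 mul0r expR0; ring.
Qed.

End Split.

Section FiveTaxa.
Variables (R : realType) (X : finType) (lam : {set X} -> R).
Implicit Types (t l r : btree X) (ys : seq X) (g : gst -> int).

Local Notation dep := (dep lam).
Local Notation Exg := (Exg lam).
Local Notation pos := (pos lam).
Local Notation pos0 := (pos0 lam).

Lemma dep_triple t a b c : wf t -> pos0 t -> uniq [:: a; b; c] -> {subset [:: a; b; c] <= cl t} ->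
  [\/ dep t a c = dep t b c /\ dep t a c < dep t a b,
      dep t a b = dep t b c /\ dep t a b < dep t a c |
      dep t a b = dep t a c /\ dep t a b < dep t b c].
Proof.
move=> w p u sub; have [l [r [de [sp al hs]]]] := split_mrca w p u isT sub.
have [[wl wr pl pr] hr hl [hrr hlr] _] := sp.
have ab : a != b by dist u. have ac : a != c by dist u. have bc : b != c by dist u.
case bl: (b \in cl l); case cl': (c \in cl l).
- by move: hs; rewrite /= bl cl'.
- apply: Or31.
  have e1 : dep t a c = de by apply: hlr; rewrite ?cl' //; memt.
  have e2 : dep t b c = de by apply: hlr; rewrite ?cl' //; memt.
  have e3 : dep t a b = de + dep l a b by apply: hl => //; memt.
  have := dep_pos wl pl al bl ab; split; lra.
- apply: Or32.
  have e1 : dep t a b = de by apply: hlr; rewrite ?bl //; memt.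
  have e2 : dep t b c = de by rewrite depC; apply: hlr; rewrite ?bl // 1?eq_sym //; memt.
  have e3 : dep t a c = de + dep l a c by apply: hl => //; memt.
  have := dep_pos wl pl al cl' ac; split; lra.
- apply: Or33.
  have e1 : dep t a b = de by apply: hlr; rewrite ?bl //; memt.
  have e2 : dep t a c = de by apply: hlr; rewrite ?cl' //; memt.
  have e3 : dep t b c = de + dep r b c by apply: hrr; rewrite ?bl ?cl' //; memt.
  have br : b \in cl r by rewrite hr ?bl //; memt.
  have cr : c \in cl r by rewrite hr ?cl' //; memt.
  have := dep_pos wr pr br cr bc; split; lra.
Qed.

Lemma Exg4_quartet t a b c d : wf t -> pos0 t -> uniq [:: a; b; c; d] ->
  {subset [:: a; b; c; d] <= cl t} ->
  dep t a c + dep t b d < dep t a b + dep t c d ->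
  let ys := [:: a; b; c; d] in
  let e := expR (- (dep t a b + dep t c d - dep t a c - dep t b d)) in
  [/\ Exg t ys (quartet_h [:: true; true; false; false]) = 3 - 2 * e,
      Exg t ys (quartet_h [:: true; false; true; false]) = e &
      Exg t ys (quartet_h [:: true; false; false; true]) = e].
Proof.
move=> w p u sub lt ys e; have [l [r [de [sp al hs]]]] := split_mrca w p u isT sub.
have [[wl wr pl pr] hr hl [hrr hlr] E] := sp.
have pl0 := pos_pos0 pl; have pr0 := pos_pos0 pr.
have ab : a != b by dist u. have ac : a != c by dist u. have ad : a != d by dist u.
have bc : b != c by dist u. have bd : b != d by dist u. have cd : c != d by dist u.
have eq0 k g ds : eigen 0 4 g -> decomp k g ds -> k = [seq y \in cl l | y <- ys] ->
    Exg t ys g = \sum_(d <- ds) Exg l (mask k ys) d.1 * Exg r (mask (map negb k) ys) d.2.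
  move=> eg dec ek; rewrite (E 0 g ds) //; last by rewrite -ek.
  by rewrite mul0r oppr0 mul0r expR0 mul1r ek -map_comp.
have rr y : y \in ys -> y \notin cl l -> y \in cl r by move=> yy yl; rewrite hr.
have LL x y : x \in ys -> y \in ys -> x != y -> x \in cl l -> y \in cl l ->
  dep t x y = de + dep l x y by move=> *; exact: hl.
have RR x y : x \in ys -> y \in ys -> x != y -> x \notin cl l -> y \notin cl l ->
  dep t x y = de + dep r x y by move=> *; exact: hrr.
have LR x y : x \in ys -> y \in ys -> x != y -> x \in cl l -> y \notin cl l ->
  dep t x y = de by move=> *; exact: hlr.
have RL x y : x \in ys -> y \in ys -> x != y -> x \notin cl l -> y \in cl l ->
  dep t x y = de by move=> xx yy xy xl yl; rewrite depC; apply: hlr => //; rewrite eq_sym.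
case: (boolP (b \in cl l)) => bl; case: (boolP (c \in cl l)) => cc; case: (boolP (d \in cl l)) => dl.
- by move: hs; rewrite /= bl cc dl.
- have [|||h1 [f1 f2 f3] _ _] := @Exg3 _ _ lam l a b c wl pl0.
  + by rewrite /= !inE !negb_or ab ac bc.
  + by move=> y; rewrite !inE => /or3P[]/eqP->.
  + left; move: lt; rewrite (LL a b) ?(LL a c) ?(LR c d) ?(LR b d) //; try memt; lra.
  have ee : e = expR (- (dep l a b - dep l a c)).
    by rewrite /e (LL a b) ?(LL a c) ?(LR c d) ?(LR b d) //; try memt; congr expR; ring.
  have ek : [:: true; true; true; false] = [seq y \in cl l | y <- ys].
    by rewrite /= al bl cc (negbTE dl).
  split.
  + rewrite (eq0 _ _ [:: (first_pair [:: true; true; false], cst1)] (@eigen_quartet_h [:: true; true; false; false] isT) _ ek); last vmt.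
    by rewrite big_seq1 /= Exg_cst1 mulr1 f1 ee.
  + rewrite (eq0 _ _ [:: (first_pair [:: true; false; true], cst1)] (@eigen_quartet_h [:: true; false; true; false] isT) _ ek); last vmt.
    by rewrite big_seq1 /= Exg_cst1 mulr1 f2 ee.
  + rewrite (eq0 _ _ [:: (first_pair [:: false; true; true], cst1)] (@eigen_quartet_h [:: true; false; false; true] isT) _ ek); last vmt.
    by rewrite big_seq1 /= Exg_cst1 mulr1 f3 ee.
- have [|||h1 [f1 f2 f3] _ _] := @Exg3 _ _ lam l a b d wl pl0.
  + by rewrite /= !inE !negb_or ab ad bd.
  + by move=> y; rewrite !inE => /or3P[]/eqP->.
  + right; move: lt; rewrite (LL a b) ?(LL b d) ?(RL c d) ?(LR a c) //; try memt; lra.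
  have ee : e = expR (- (dep l a b - dep l a d)).
    by rewrite /e h1 (LL a b) ?(LL b d) ?(RL c d) ?(LR a c) //; try memt; congr expR; ring.
  have ek : [:: true; true; false; true] = [seq y \in cl l | y <- ys].
    by rewrite /= al bl (negbTE cc) dl.
  split.
  + rewrite (eq0 _ _ [:: (first_pair [:: true; true; false], cst1)] (@eigen_quartet_h [:: true; true; false; false] isT) _ ek); last vmt.
    by rewrite big_seq1 /= Exg_cst1 mulr1 f1 ee.
  + rewrite (eq0 _ _ [:: (first_pair [:: false; true; true], cst1)] (@eigen_quartet_h [:: true; false; true; false] isT) _ ek); last vmt.
    by rewrite big_seq1 /= Exg_cst1 mulr1 f3 ee.
  + rewrite (eq0 _ _ [:: (first_pair [:: true; false; true], cst1)] (@eigen_quartet_h [:: true; false; false; true] isT) _ ek); last vmt.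
    by rewrite big_seq1 /= Exg_cst1 mulr1 f2 ee.
- have N1 : Exg l [:: a; b] apart_all = expR (- dep l a b).
    apply: Exg_nall2 => //; first by rewrite /= inE ab.
    by move=> y; rewrite !inE => /orP[]/eqP->.
  have N2 : Exg r [:: c; d] apart_all = expR (- dep r c d).
    apply: Exg_nall2 => //; first by rewrite /= inE cd.
    by move=> y; rewrite !inE => /orP[]/eqP->; apply: rr => //; memt.
  have ee : e = expR (- dep l a b) * expR (- dep r c d).
    rewrite -expRD /e (LL a b) ?(RR c d) ?(LR a c) ?(LR b d) //; try memt; congr expR; ring.
  have ek : [:: true; true; false; false] = [seq y \in cl l | y <- ys].
    by rewrite /= al bl (negbTE cc) (negbTE dl).
  split.
  + rewrite (eq0 _ _ [:: (fun x => 3 * cst1 x, cst1); (fun x => -2 * apart_all x, apart_all)] (@eigen_quartet_h [:: true; true; false; false] isT) _ ek); last vmt.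
    by rewrite !big_cons big_nil /= !ExgZ !Exg_cst1 N1 N2 ee; ring.
  + rewrite (eq0 _ _ [:: (apart_all, apart_all)] (@eigen_quartet_h [:: true; false; true; false] isT) _ ek); last vmt.
    by rewrite big_seq1 /= N1 N2 ee.
  + rewrite (eq0 _ _ [:: (apart_all, apart_all)] (@eigen_quartet_h [:: true; false; false; true] isT) _ ek); last vmt.
    by rewrite big_seq1 /= N1 N2 ee.
- have [|||h1 f1 f2 f3] := @Exg3_last _ _ lam l a c d wl pl0.
  + by rewrite /= !inE !negb_or ac ad cd.
  + by move=> y; rewrite !inE => /or3P[]/eqP->.
  + left; move: lt; rewrite (LL a c) ?(LL c d) ?(LR a b) ?(RL b d) //; try memt; lra.
  have ee : e = expR (- (dep l c d - dep l a c)).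
    by rewrite /e (LL a c) ?(LL c d) ?(LR a b) ?(RL b d) //; try memt; congr expR; ring.
  have ek : [:: true; false; true; true] = [seq y \in cl l | y <- ys].
    by rewrite /= al (negbTE bl) cc dl.
  split.
  + rewrite (eq0 _ _ [:: (first_pair [:: false; true; true], cst1)] (@eigen_quartet_h [:: true; true; false; false] isT) _ ek); last vmt.
    by rewrite big_seq1 /= Exg_cst1 mulr1 f1 ee.
  + rewrite (eq0 _ _ [:: (first_pair [:: true; true; false], cst1)] (@eigen_quartet_h [:: true; false; true; false] isT) _ ek); last vmt.
    by rewrite big_seq1 /= Exg_cst1 mulr1 f3 ee.
  + rewrite (eq0 _ _ [:: (first_pair [:: true; false; true], cst1)] (@eigen_quartet_h [:: true; false; false; true] isT) _ ek); last vmt.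
    by rewrite big_seq1 /= Exg_cst1 mulr1 f2 ee.
- exfalso; move: lt (dep_ge sp (a := a) (b := c)) (dep_ge sp (a := b) (b := d)).
  rewrite (LR a b) ?(LR c d) //; try memt.
  move=> h1 h2 h3; have := h2 _ _ ac; have := h3 _ _ bd.
  by rewrite !inE !eqxx !orbT => /(_ isT isT) h4 /(_ isT isT) h5; lra.
- exfalso; move: lt (dep_ge sp (a := a) (b := c)) (dep_ge sp (a := b) (b := d)).
  rewrite (LR a b) ?(RL c d) //; try memt.
  move=> h1 h2 h3; have := h2 _ _ ac; have := h3 _ _ bd.
  by rewrite !inE !eqxx !orbT => /(_ isT isT) h4 /(_ isT isT) h5; lra.
- have [|||h1 f1 f2 f3] := @Exg3_last _ _ lam r b c d wr pr0.
  + by rewrite /= !inE !negb_or bc bd cd.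
  + by move=> y; rewrite !inE => /or3P[]/eqP->; apply: rr => //; memt.
  + right; move: lt; rewrite (RR c d) ?(RR b d) ?(LR a b) ?(LR a c) //; try memt; lra.
  have ee : e = expR (- (dep r c d - dep r b c)).
    by rewrite /e h1 (RR c d) ?(RR b d) ?(LR a b) ?(LR a c) //; try memt; congr expR; ring.
  have ek : [:: true; false; false; false] = [seq y \in cl l | y <- ys].
    by rewrite /= al (negbTE bl) (negbTE cc) (negbTE dl).
  split.
  + rewrite (eq0 _ _ [:: (cst1, first_pair [:: false; true; true])] (@eigen_quartet_h [:: true; true; false; false] isT) _ ek); last vmt.
    by rewrite big_seq1 /= Exg_cst1 mul1r f1 ee.
  + rewrite (eq0 _ _ [:: (cst1, first_pair [:: true; false; true])] (@eigen_quartet_h [:: true; false; true; false] isT) _ ek); last vmt.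
    by rewrite big_seq1 /= Exg_cst1 mul1r f2 ee.
  + rewrite (eq0 _ _ [:: (cst1, first_pair [:: true; true; false])] (@eigen_quartet_h [:: true; false; false; true] isT) _ ek); last vmt.
    by rewrite big_seq1 /= Exg_cst1 mul1r f3 ee.
Qed.

End FiveTaxa.

Section FiveTaxaMid.
Variables (R : realType) (X : finType) (lam : {set X} -> R).
Implicit Types (t l r : btree X) (ys : seq X) (g : gst -> int).

Local Notation dep := (dep lam).
Local Notation Exg := (Exg lam).
Local Notation pos := (pos lam).
Local Notation pos0 := (pos0 lam).

Lemma split4_cat t a b c d : wf t -> pos0 t -> uniq [:: a; b; c; d] ->
  {subset [:: a; b; c; d] <= cl t} -> dep t a c < dep t a b -> dep t a d < dep t a c ->
  exists l, [/\ [/\ wf l, pos0 l, uniq [:: a; b; c] & {subset [:: a; b; c] <= cl l}],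
    dep l a b = dep t a b - dep t a d, dep l a c = dep t a c - dep t a d &
    forall k2 g (hs : seq (gst -> int)), eigen k2 4 g ->
       decomp [:: true; true; true; false] g [seq (h, cst1) | h <- hs] ->
       Exg t [:: a; b; c; d] g = expR (- (k2%:~R / 2) * dep t a d) *
          \sum_(h <- hs) Exg l [:: a; b; c] h].
Proof.
move=> w p u sub h1 h2; have [l [r [de [sp al hs]]]] := split_mrca w p u isT sub.
have [[wl wr pl pr] hr hl [hrr hlr] E] := sp.
have ab : a != b by dist u. have ac : a != c by dist u. have ad : a != d by dist u.
have bc : b != c by dist u.
have bl : b \in cl l by apply: (split_left sp (z := d)); rewrite ?inE ?eqxx ?orbT //; lra.
have cc : c \in cl l by apply: (split_left sp (z := d)); rewrite ?inE ?eqxx ?orbT //; lra.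
have dl : d \notin cl l by move: hs; rewrite /= bl cc orbF.
have ead : dep t a d = de by apply: hlr => //; memt.
exists l; split.
- split=> //; [exact: pos_pos0 | by rewrite /= !inE !negb_or ab ac bc |].
  by move=> y; rewrite !inE => /or3P[]/eqP->.
- by rewrite (hl a b) ?inE ?eqxx ?orbT // ead; ring.
- by rewrite (hl a c) ?inE ?eqxx ?orbT // ead; ring.
move=> k2 g g' eg dec; rewrite (E k2 g [seq (h, cst1) | h <- g'] eg); last by rewrite /= al bl cc (negbTE dl); exact: dec.
rewrite ead big_map /= al bl cc (negbTE dl) /=; congr (_ * _); apply: eq_bigr => h _.
by rewrite Exg_cst1 mulr1.
Qed.

Lemma Exg4_nall_cat t a b c d : wf t -> pos0 t -> uniq [:: a; b; c; d] ->
  {subset [:: a; b; c; d] <= cl t} -> dep t a c < dep t a b -> dep t a d < dep t a c ->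
  Exg t [:: a; b; c; d] apart_all = expR (- (dep t a b + 2 * dep t a c + 3 * dep t a d)).
Proof.
move=> w p u sub h1 h2; have [l [[wl pl ul sl] e1 e2 E]] := split4_cat w p u sub h1 h2.
rewrite (E 12 apart_all [:: apart_all]); [|exact: (eigen_apart_all (k := 4))|vmt].
have [|_ _ _ N] := Exg3 wl pl ul sl; first by left; lra.
by rewrite big_seq1 N e1 e2 -expRD; congr expR; field.
Qed.

Lemma split4_bal t a b d e : wf t -> pos0 t -> uniq [:: a; b; d; e] ->
  {subset [:: a; b; d; e] <= cl t} -> dep t a d < dep t a b -> dep t a d < dep t d e ->
  forall k2 g (ds : seq ((gst -> int) * (gst -> int))), eigen k2 4 g ->
    decomp [:: true; true; false; false] g ds ->
    exists l r, [/\ Exg l [:: a; b] apart_all = expR (- (dep t a b - dep t a d)),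
      Exg r [:: d; e] apart_all = expR (- (dep t d e - dep t a d)) &
      Exg t [:: a; b; d; e] g = expR (- (k2%:~R / 2) * dep t a d) *
          \sum_(x <- ds) Exg l [:: a; b] x.1 * Exg r [:: d; e] x.2].
Proof.
move=> w p u sub h1 h2 k2 g ds eg dec; have [l [r [dl [sp al hs]]]] := split_mrca w p u isT sub.
have [[wl wr pl pr] hr hl [hrr hlr] E] := sp.
have ab : a != b by dist u. have ad : a != d by dist u. have ae : a != e by dist u.
have de : d != e by dist u.
have bl : b \in cl l.
  apply: (split_left sp (z := d)); rewrite ?inE ?eqxx ?orbT //; lra.
have gad : dl <= dep t a d by apply: (dep_ge sp) => //; memt.
have [dd ee] : d \notin cl l /\ e \notin cl l.
  move: hs; rewrite /= bl orbF /=.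
  case: (boolP (d \in cl l)) => dd; case: (boolP (e \in cl l)) => ee //= _; exfalso.
    have e1 : dep t d e = dl by apply: hlr => //; memt.
    lra.
  have e1 : dep t d e = dl by rewrite depC; apply: hlr; rewrite // 1?eq_sym //; memt.
  lra.
have ead : dep t a d = dl by apply: hlr => //; memt.
exists l, r; split.
- rewrite Exg_nall2 //; first by rewrite (hl a b) ?inE ?eqxx ?orbT // ead; congr expR; ring.
  + exact: pos_pos0. + by rewrite /= inE ab.
  + by move=> y; rewrite !inE => /orP[]/eqP->.
- rewrite Exg_nall2 //; first by rewrite (hrr d e) ?inE ?eqxx ?orbT // ead; congr expR; ring.
  + exact: pos_pos0. + by rewrite /= inE de.
  + by move=> y; rewrite !inE => /orP[]/eqP->; rewrite hr //; memt.
rewrite (E k2 g ds eg); last by rewrite /= al bl (negbTE dd) (negbTE ee); exact: dec.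
by rewrite ead /= al bl (negbTE dd) (negbTE ee).
Qed.

Lemma Exg5_cat t d e c b a : wf t -> pos0 t -> uniq [:: d; e; c; b; a] ->
  {subset [:: d; e; c; b; a] <= cl t} ->
  dep t d c < dep t d e -> dep t d b < dep t d c -> dep t d a < dep t d b ->
  let ys := [:: d; e; c; b; a] in
  Exg t ys (middle_h 4) - Exg t ys (middle_h 3) =
    5 * expR (- (dep t d e + 2 * dep t d c - 3 * dep t d b)) -
    5 * expR (- (dep t d e + 2 * dep t d c + 3 * dep t d b - 6 * dep t d a)) /\
  Exg t ys (middle_h 0) = Exg t ys (middle_h 1).
Proof.
move=> w p u sub h1 h2 h3 ys.
have [l [r [dl [sp dl' hs]]]] := split_mrca w p u isT sub.
have [[wl wr pl pr] hr hl [hrr hlr] E] := sp.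
have de : d != e by dist u. have dc : d != c by dist u. have db : d != b by dist u.
have da : d != a by dist u.
have el : e \in cl l by apply: (split_left sp (z := a)); rewrite ?inE ?eqxx ?orbT //; lra.
have cc : c \in cl l by apply: (split_left sp (z := a)); rewrite ?inE ?eqxx ?orbT //; lra.
have bl : b \in cl l by apply: (split_left sp (z := a)); rewrite ?inE ?eqxx ?orbT //; lra.
have al : a \notin cl l by move: hs; rewrite /= el cc bl orbF.
have eda : dep t d a = dl by apply: hlr => //; memt.
have e1 : dep t d e = dl + dep l d e by apply: hl => //; memt.
have e2 : dep t d c = dl + dep l d c by apply: hl => //; memt.
have e3 : dep t d b = dl + dep l d b by apply: hl => //; memt.
have ul : uniq [:: d; e; c; b].
  exact: subseq_uniq (prefix_subseq [:: d; e; c; b] [:: a]) u.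
have sl : {subset [:: d; e; c; b] <= cl l}.
  by move=> y; rewrite !inE => /or4P[]/eqP->.
have pl0 := pos_pos0 pl.
have l1 : dep l d c < dep l d e by lra.
have l2 : dep l d b < dep l d c by lra.
have [l' [[wl' pl' ul' sl'] e1' e2' E']] := split4_cat wl pl0 ul sl l1 l2.
have [|_ [_ f2 f3] [_ n2 n3] N] := Exg3 wl' pl' ul' sl'; first by left; lra.
have N4 := Exg4_nall_cat wl pl0 ul sl l1 l2.
have sel : [seq y \in cl l | y <- ys] = [:: true; true; true; true; false].
  by rewrite /= dl' el cc bl (negbTE al).
have sel' : [seq y \notin cl l | y <- ys] = [:: false; false; false; false; true].
  by rewrite /= dl' el cc bl (negbTE al).
move: E; rewrite sel sel' /= => E.
rewrite -!ExgB; split.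
  rewrite (E 0 _ [:: (cat_rest, cst1); (fun x => -5 * apart_all x, cst1)]); first last.
  - by have /and4P[] := decomp_cat.
  - by vm_cast_no_check (erefl true).
  rewrite !big_cons big_nil /= ExgZ !Exg_cst1 N4.
  rewrite (E' 0 cat_rest [:: (fun x => 5 * apart_all x)]); first last.
  - by have /and4P[] := decomp_cat.
  - by have /and3P[] := eigen_rest.
  rewrite big_seq1 ExgZ N e1' e2' mul0r oppr0 !mul0r expR0 e1 e2 e3 eda.
  rewrite (_ : dep l d e - dep l d b + 2 * (dep l d c - dep l d b) =
    dl + dep l d e + 2 * (dl + dep l d c) - 3 * (dl + dep l d b)); last by ring.
  rewrite (_ : dep l d e + 2 * dep l d c + 3 * dep l d b =
    dl + dep l d e + 2 * (dl + dep l d c) + 3 * (dl + dep l d b) - 6 * dl); last by ring.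
  ring.
apply/eqP; rewrite -subr_eq0 -ExgB; apply/eqP.
rewrite (E 0 _ [:: (cat_rest', cst1)]); first last.
- by have /and4P[] := decomp_cat.
- by vm_cast_no_check (erefl true).
rewrite big_seq1 /= Exg_cst1.
rewrite (E' 0 cat_rest' [:: (fun x => 10 * first_pair [:: false; true; true] x);
        (fun x => -10 * first_pair [:: true; false; true] x);
        (fun x => -20 * apart [:: true; false; true] x);
        (fun x => 20 * apart [:: false; true; true] x)]); first last.
- by have /and4P[] := decomp_cat.
- by have /and3P[] := eigen_rest.
by rewrite !big_cons big_nil !ExgZ f2 f3 n2 n3; ring.
Qed.

Lemma Exg5_bal t d e c a b : wf t -> pos0 t -> uniq [:: d; e; c; a; b] ->
  {subset [:: d; e; c; a; b] <= cl t} ->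
  dep t d c < dep t d e -> dep t d a < dep t d c -> dep t d a < dep t a b ->
  let ys := [:: d; e; c; a; b] in
  let x := expR (- (dep t a b + dep t d c - 2 * dep t d a)) in
  let y := expR (- (dep t d e - dep t d c)) in
  [/\ Exg t ys (middle_h 3) = Exg t ys (middle_h 4), Exg t ys (middle_h 0) = Exg t ys (middle_h 1) &
      Exg t ys (middle_h 3) - Exg t ys (middle_h 0) = 10 * (x - y) +
        15 * x * y * (1 - expR (- (2 * (dep t d c - dep t d a))))].
Proof.
move=> w p u sub h1 h2 h3 ys x y.
have [l [r [dl [sp dl' hs]]]] := split_mrca w p u isT sub.
have [[wl wr pl pr] hr hl [hrr hlr] E] := sp.
have de : d != e by dist u. have dc : d != c by dist u. have db : d != b by dist u.
have da : d != a by dist u. have ab : a != b by dist u. have ec : e != c by dist u.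
have el : e \in cl l by apply: (split_left sp (z := a)); rewrite ?inE ?eqxx ?orbT //; lra.
have cc : c \in cl l by apply: (split_left sp (z := a)); rewrite ?inE ?eqxx ?orbT //; lra.
have gda : dl <= dep t d a by apply: (dep_ge sp) => //; memt.
have [al bl] : a \notin cl l /\ b \notin cl l.
  move: hs; rewrite /= el cc orbF /=.
  case: (boolP (a \in cl l)) => dd; case: (boolP (b \in cl l)) => ee //= _; exfalso.
    have e1 : dep t a b = dl by apply: hlr => //; memt.
    lra.
  have e1 : dep t a b = dl by rewrite depC; apply: hlr; rewrite // 1?eq_sym //; memt.
  lra.
have eda : dep t d a = dl by apply: hlr => //; memt.
have e1 : dep t d e = dl + dep l d e by apply: hl => //; memt.
have e2 : dep t d c = dl + dep l d c by apply: hl => //; memt.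
have e3 : dep t a b = dl + dep r a b by apply: hrr => //; memt.
have [||||_ [_ f2 f3] [n1 n2 n3] N] := @Exg3 _ _ lam l d e c wl.
- exact: pos_pos0.
- by rewrite /= !inE !negb_or de dc ec.
- by move=> z; rewrite !inE => /or3P[]/eqP->.
- by left; lra.
have M : Exg r [:: a; b] apart_all = expR (- dep r a b).
  apply: Exg_nall2 => //; first exact: pos_pos0; first by rewrite /= inE ab.
  by move=> z; rewrite !inE => /orP[]/eqP->; rewrite hr //; memt.
have sel : [seq y \in cl l | y <- ys] = [:: true; true; true; false; false].
  by rewrite /= dl' el cc (negbTE al) (negbTE bl).
have sel' : [seq y \notin cl l | y <- ys] = [:: false; false; false; true; true].
  by rewrite /= dl' el cc (negbTE al) (negbTE bl).
move: E; rewrite sel sel' /= => E.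
have [d3 d4 d0 d1] := and4P decomp_bal.
have m3 := E 0 _ _ (@eigen_middle_h 3 isT) d3; have m4 := E 0 _ _ (@eigen_middle_h 4 isT) d4.
have m0 := E 0 _ _ (@eigen_middle_h 0 isT) d0; have m1 := E 0 _ _ (@eigen_middle_h 1 isT) d1.
clear d3 d4 d0 d1.
move: m3 m4 m0 m1; rewrite !big_cons !big_nil /= !ExgZ !Exg_cst1 f2 f3 n1 n2 n3 N M.
rewrite mul0r oppr0 !mul0r expR0 => m3 m4 m0 m1.
split; [by rewrite m3 m4 | by rewrite m0 m1; ring |].
rewrite m3 m0 /x /y e1 e2 e3 eda.
set U := dep l d e; set V := dep l d c; set W := dep r a b.
have -> : expR (- (dl + W + (dl + V) - 2 * dl)) = expR (- W) * expR (- V).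
  by rewrite -expRD; congr expR; ring.
have -> : expR (- (dl + U - (dl + V))) = expR (- U) * expR V by rewrite -expRD; congr expR; ring.
have -> : expR (- (2 * (dl + V - dl))) = expR (- V) * expR (- V) by rewrite -expRD; congr expR; ring.
have -> : expR (- (U + 2 * V)) = expR (- U) * expR (- V) * expR (- V) by rewrite -!expRD; congr expR; ring.
have -> : expR (- (U - V)) = expR (- U) * expR V by rewrite -expRD; congr expR; ring.
have v : expR (- V) = (expR V)^-1 by rewrite expRN.
have v0 : expR V != 0 by rewrite expR_eq0.
by rewrite v; field.
Qed.

Lemma Exg5_pse t a b d e c : wf t -> pos0 t -> uniq [:: a; b; d; e; c] ->
  {subset [:: a; b; d; e; c] <= cl t} ->
  dep t a d < dep t a b -> dep t a d < dep t d e -> dep t a c < dep t a d ->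
  let ys := [:: a; b; d; e; c] in
  let x := expR (- (dep t a b - dep t a d)) in
  let y := expR (- (dep t d e - dep t a d)) in
  let z := expR (- (6 * (dep t a d - dep t a c))) in
  [/\ Exg t ys (middle_h 0) = 10 * x - 5 * x * y + x * y * z,
      Exg t ys (middle_h 1) = 10 * x - 5 * x * y + x * y * z,
      Exg t ys (middle_h 2) = 10 * y - 5 * x * y + x * y * z &
      Exg t ys (middle_h 3) = 10 * y - 5 * x * y + x * y * z].
Proof.
move=> w p u sub h1 h2 h3 ys x y z.
have [l [r [dl [sp dl' hs]]]] := split_mrca w p u isT sub.
have [[wl wr pl pr] hr hl [hrr hlr] E] := sp.
have ab : a != b by dist u. have ad : a != d by dist u. have ae : a != e by dist u.
have ac : a != c by dist u. have de : d != e by dist u.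
have bl : b \in cl l by apply: (split_left sp (z := c)); rewrite ?inE ?eqxx ?orbT //; lra.
have dd : d \in cl l by apply: (split_left sp (z := c)); rewrite ?inE ?eqxx ?orbT //; lra.
have gac : dl <= dep t a c by apply: (dep_ge sp) => //; memt.
have el : e \in cl l.
  apply/negPn/negP => ee; have e1 : dep t d e = dl by apply: hlr => //; memt.
  lra.
have cc : c \notin cl l by move: hs; rewrite /= bl dd el orbF.
have eac : dep t a c = dl by apply: hlr => //; memt.
have e1 : dep t a b = dl + dep l a b by apply: hl => //; memt.
have e2 : dep t a d = dl + dep l a d by apply: hl => //; memt.
have e3 : dep t d e = dl + dep l d e by apply: hl => //; memt.
have ul : uniq [:: a; b; d; e].
  exact: subseq_uniq (prefix_subseq [:: a; b; d; e] [:: c]) u.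
have sl : {subset [:: a; b; d; e] <= cl l} by move=> v; rewrite !inE => /or4P[]/eqP->.
have pl0 := pos_pos0 pl.
have l1 : dep l a d < dep l a b by lra.
have l2 : dep l a d < dep l d e by lra.
have N4 : Exg l [:: a; b; d; e] apart_all = x * y * z.
  have [||l' [r' [N1 N2 ->]]] := split4_bal wl pl0 ul sl l1 l2 (k2 := 12) (g := apart_all) (ds := [:: (apart_all, apart_all)]).
    exact: (eigen_apart_all (k := 4)).
    by vm_cast_no_check (erefl true).
  rewrite big_seq1 /= N1 N2 /x /y /z -!expRD e1 e2 e3 eac; by congr expR; field.
have sel : [seq y \in cl l | y <- ys] = [:: true; true; true; true; false].
  by rewrite /= dl' bl dd el (negbTE cc).
have sel' : [seq y \notin cl l | y <- ys] = [:: false; false; false; false; true].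
  by rewrite /= dl' bl dd el (negbTE cc).
move: E; rewrite sel sel' /= => E.
have mE i : (i < 4)%N -> Exg t ys (middle_h i) = Exg l [:: a; b; d; e] (pse_rest i) + x * y * z.
  move=> i4; have i5 : (i < 5)%N by rewrite ltnS ltnW.
  rewrite (E 0 (middle_h i) [:: (pse_rest i, cst1); (apart_all, cst1)] (eigen_middle_h i5)); last first.
    by have /and3P[/allP h _ _] := decomp_pse; apply: h; rewrite mem_iota.
  by rewrite !big_cons big_nil /= !Exg_cst1 N4 mul0r oppr0 mul0r expR0; ring.
have eh i : (i < 4)%N -> eigen 0 4 (pse_rest i).
  by have /and3P[_ _ /allP h] := eigen_rest => i4; apply: h; rewrite mem_iota.
have hx i : i \in [:: 0; 1]%N -> Exg l [:: a; b; d; e] (pse_rest i) = 10 * x - 5 * x * y.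
  move=> i1; have i4 : (i < 4)%N by move: i1; rewrite !inE => /orP[]/eqP->.
  have [|l' [r' [N1 N2 ->]]] := split4_bal wl pl0 ul sl l1 l2 (eh i i4)
     (ds := [:: (fun x => 10 * apart_all x, cst1); (fun x => -5 * apart_all x, apart_all)]).
    by have /and3P[_ /allP h _] := decomp_pse; exact: h.
  rewrite !big_cons big_nil /= !ExgZ !Exg_cst1 N1 N2 mul0r oppr0 mul0r expR0 /x /y e1 e2 e3.
  have -> : dl + dep l a b - (dl + dep l a d) = dep l a b - dep l a d by ring.
  have -> : dl + dep l d e - (dl + dep l a d) = dep l d e - dep l a d by ring.
  ring.
have hy i : i \in [:: 2; 3]%N -> Exg l [:: a; b; d; e] (pse_rest i) = 10 * y - 5 * x * y.
  move=> i1; have i4 : (i < 4)%N by move: i1; rewrite !inE => /orP[]/eqP->.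
  have [|l' [r' [N1 N2 ->]]] := split4_bal wl pl0 ul sl l1 l2 (eh i i4)
     (ds := [:: (cst1, fun x => 10 * apart_all x); (fun x => -5 * apart_all x, apart_all)]).
    by have /and3P[_ _ /allP h] := decomp_pse; exact: h.
  rewrite !big_cons big_nil /= !ExgZ !Exg_cst1 N1 N2 mul0r oppr0 mul0r expR0 /x /y e1 e2 e3.
  have -> : dl + dep l a b - (dl + dep l a d) = dep l a b - dep l a d by ring.
  have -> : dl + dep l d e - (dl + dep l a d) = dep l d e - dep l a d by ring.
  ring.
by split; rewrite mE //; [rewrite hx|rewrite hx|rewrite hy|rewrite hy].
Qed.

End FiveTaxaMid.

(** * Observables of the unrooted gene tree *)

Section Observables.
Variables (R : realType) (X : finType).
Implicit Types (sg : rmst R X) (T : {set {set X}}) (ys ws : seq X) (o : {set {set X}} -> R).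

Definition EO sg o : R := \sum_T gtprob sg T * o T.

Lemma rmst_tree sg : is_rmst sg ->
  exists t, [/\ wf t, cl t = [set: X], cls t = sg.1 & pos0 sg.2 t].
Proof.
move=> [rb ps]; have [CT _ _ _ _] := rb; have [t [w e c]] := rbt_tree rb CT.
exists t; rewrite c; split => //; first by apply/setP => B; rewrite inE subsetT andbT.
move=> B; rewrite c inE e => /andP[BC _] B1 BT; apply: ps => //; rewrite /internal B1 /=.
rewrite -cardsT; apply: proper_card; by rewrite properEneq BT subsetT.
Qed.

Lemma EO_Exroot sg o t : wf t -> cl t = [set: X] -> cls t = sg.1 -> (1 < #|X|)%N ->
  EO sg o = Exroot sg.2 t (fun s => o (unroot (rooted_gene s))).
Proof.
move=> w e c X1.
rewrite -(weight_Exroot (sg := sg) (fun s => o (unroot (rooted_gene s))) w e c X1).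
rewrite (partition_big (fun f : {ffun {set X} -> state X} => unroot (rooted_gene (f [set: X]))) predT) //=.
apply: eq_bigr => T _; rewrite /gtprob mulr_suml.
by apply: eq_bigr => f /eqP ->.
Qed.

Lemma disp_rho (s : state X) ys p : uniq ys -> size p = size ys ->
  (1 < count id p)%N -> (1 < count id (map negb p))%N ->
  [exists S in unroot (rooted_gene s), mk ys S == p] =
  (p \in (rho ys s).2) || (map negb p \in (rho ys s).2).
Proof.
move=> u sp c1 c2.
have inr q : size q = size ys -> (1 < count id q)%N ->
    (q \in (rho ys s).2) = (q \in smasks ys (rooted_gene s)).
  move=> sq cq; rewrite mem_norm sq eqxx cq /=.
  apply/smasksP/smasksP => -[B]; first by move=> BS e; exists B; rewrite // inE BS.
  rewrite inE => /orP[BS e|/imsetP[a _ ->] e]; first by exists B.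
  by have := count_mk_card [set a] u; rewrite -e cards1 leqNgt cq.
have mkC S : mk ys (~: S) = map negb (mk ys S).
  by rewrite /mk -map_comp; apply: eq_map => y; rewrite /= inE.
rewrite !inr ?size_map //.
apply/existsP/orP => [[S /andP[]]|[/smasksP[B BS e]|/smasksP[B BS e]]].
- rewrite inE => /orP[SK /eqP e|/imsetP[B BK ->] /eqP e]; [left|right]; apply/smasksP.
    by exists S.
  by exists B; rewrite // -e mkC -map_comp (eq_map negbK) map_id.
- by exists B; rewrite inE BS e eqxx.
- exists (~: B); rewrite inE (imset_f _ BS) orbT mkC -e -map_comp (eq_map negbK) map_id.
  by rewrite eqxx.
Qed.

Lemma rho_absorbed (s : state X) ys : (#|s.1| <= 1)%N -> (size (rho ys s).1 <= 1)%N.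
Proof.
move=> s1; have : (size (smasks ys s.1) <= 1)%N by rewrite size_map -cardE.
apply: leq_trans; apply: uniq_leq_size; first exact: filter_uniq (uniq_masks _).
by move=> m; rewrite mem_norm => /and3P[].
Qed.

Definition odisp ys p T : R := ([exists S in T, mk ys S == p])%:R.

Lemma EO_quartet sg t (a b c d : X) p : wf t -> cl t = [set: X] -> cls t = sg.1 ->
  uniq [:: a; b; c; d] -> p \in pairs4 ->
  EO sg (fun T => 3 * odisp [:: a; b; c; d] p T) = Exg sg.2 t [:: a; b; c; d] (quartet_h p).
Proof.
move=> w e ec u pp; set ys := [:: a; b; c; d].
have X1 : (1 < #|X|)%N.
  by apply: (@leq_trans (size ys)) => //; rewrite -(card_uniqP u) max_card.
rewrite (EO_Exroot _ w e ec X1); apply: Exroot_harmonic => //.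
- by move=> y _; rewrite e inE.
- exact: eigen_quartet_h.
move=> s gs s1.
have [c1 c2 sp] : [/\ (1 < count id p)%N, (1 < count id (map negb p))%N & size p = size ys].
  by move: pp; rewrite !inE => /or3P[]/eqP->.
rewrite /odisp (disp_rho _ u) // /quartet_h; case: ifP => [_|_]; first by rewrite mulr1.
have [_ _ _ _ /(_ ys u isT)] := gs; rewrite e => /(_ (fun y _ => in_setT y)) rs.
have /allP h : all (fun x => (size x.1 <= 1)%N ==> (apart_all x == 0)) (reach 4) by vmt.
by have := h _ rs; rewrite rho_absorbed // => /eqP ->; rewrite mulr0.
Qed.

Definition omid (v : X) ws T : bool :=
  ~~ has (fun w => [exists S in T, (v \in S) && all (fun u => (u \in S) == (u == w)) ws]) ws.

Lemma omid_perm v ws ws' T : perm_eq ws ws' -> omid v ws T = omid v ws' T.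
Proof.
move=> h; rewrite /omid (perm_has _ h); congr negb; apply: eq_has => w.
by apply: eq_existsb => S; rewrite (perm_all _ h).
Qed.

Definition others (y0 : X) (i : nat) ys : seq X :=
  [seq nth y0 ys n | n <- iota 0 5 & n != i].

Lemma omid_index y0 ys i T : uniq ys -> size ys = 5 -> (i < 5)%N ->
  omid (nth y0 ys i) (others y0 i ys) T =
  ~~ has (fun j => (j != i) && [exists S in T, mk ys S == pairm 5 i j]) (iota 0 5).
Proof.
move=> u sy i5; rewrite /omid; congr negb.
have hf (P : pred nat) s : has P [seq n <- s | n != i] = has (fun n => (n != i) && P n) s.
  by elim: s => //= n s IH; case: (n != i) => /=; rewrite IH.
rewrite has_map hf; apply: eq_in_has => j; rewrite mem_iota /= => j5.
case: eqP => //= /eqP ji; apply: eq_existsb => S.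
case: (S \in T) => //=; rewrite all_map all_filter.
have -> : (mk ys S == pairm 5 i j) =
    all (fun n => (nth y0 ys n \in S) == ((n == i) || (n == j))) (iota 0 5).
  rewrite /mk -[in LHS](mkseq_nth y0 ys) sy /mkseq -map_comp /pairm /mkseq.
  apply/eqP/allP => [/eq_in_map h n /h /= ->//|h].
  by apply/eq_in_map => n /h /eqP.
apply/andP/allP => [[vS /allP h] n hn|h].
  have n5 : (n < 5)%N by move: hn; rewrite mem_iota.
  have := h n hn; rewrite /=; case: (eqVneq n i) => [->|ni] /=; first by rewrite vS.
  by rewrite nth_uniq ?sy.
split; first by have := h i; rewrite mem_iota eqxx => /(_ i5)/eqP ->.
apply/allP => n hn; have n5 : (n < 5)%N by move: hn; rewrite mem_iota.
rewrite /=; apply/implyP => ni; have := h n hn; rewrite (negbTE ni) /=.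
by rewrite nth_uniq ?sy.
Qed.

Lemma pairm_count i j : (i < 5)%N -> (j < 5)%N -> j != i ->
  (1 < count id (pairm 5 i j))%N /\ (1 < count id (map negb (pairm 5 i j)))%N.
Proof.
by move: i j => [|[|[|[|[|]]]]] // [|[|[|[|[|]]]]].
Qed.

Lemma EO_mid sg t y0 ys i ws : wf t -> cl t = [set: X] -> cls t = sg.1 ->
  uniq ys -> size ys = 5 -> (i < 5)%N -> perm_eq ws (others y0 i ys) ->
  EO sg (fun T => 30 * (omid (nth y0 ys i) ws T)%:R) = Exg sg.2 t ys (middle_h i).
Proof.
move=> w e ec u sy i5 pw.
have X1 : (1 < #|X|)%N.
  by apply: (@leq_trans (size ys)); [rewrite sy | rewrite -(card_uniqP u) max_card].
rewrite (EO_Exroot _ w e ec X1); apply: Exroot_harmonic => //.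
- by rewrite sy.
- by move=> y _; rewrite e inE.
- by rewrite sy; exact: eigen_middle_h.
move=> s gs s1; rewrite (omid_perm _ _ pw) omid_index //.
have -> : ~~ has (fun j => (j != i) && [exists S in unroot (rooted_gene s), mk ys S == pairm 5 i j])
    (iota 0 5) = is_middle i (rho ys s).
  congr negb; apply: eq_in_has => j; rewrite mem_iota /= => j5; case: eqP => //= /eqP ji.
  have sp : size (pairm 5 i j) = size ys by rewrite size_mkseq sy.
  by have [p1 p2] := pairm_count i5 j5 ji; rewrite (disp_rho _ u sp).
have : (size (rho ys s).1 <= 1)%N by exact: rho_absorbed.
by rewrite /middle_h; case: (size _) => [|[|]] // _; case: (is_middle _ _); rewrite ?mulr1 ?mulr0.
Qed.

End Observables.

(** * Root positions on five taxa *)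

Definition tri (R : realType) (p q r : R) : Prop :=
  [\/ q = r /\ q < p, p = r /\ p < q | p = q /\ p < r].

Definition profile (R : realType) (X : finType) (D : X -> X -> R) (a b c d e : X)
    (ab ac ad ae bc bd be cd ce de : R) : Prop :=
  [/\ [/\ D a b = ab, D a c = ac, D a d = ad & D a e = ae],
      [/\ D b c = bc, D b d = bd & D b e = be],
      [/\ D c d = cd & D c e = ce] & D d e = de].

(* The seven positions of the root on the unrooted tree ab|c|de with internal
   lengths [x] and [y]; [z] locates the root on its edge. *)
Definition root_position (R : realType) (X : finType) (D : X -> X -> R) (a b c d e : X)
    (x y : R) (i : nat) (m z : R) : Prop :=
  let n := m + z in
  match i with
  | 0 => profile D a b c d e m m m m n n n (n + x) (n + x) (n + x + y)
  | 1 => profile D a b c d e m n n n m m m (n + x) (n + x) (n + x + y)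
  | 2 => profile D a b c d e (n + y + x) (n + y) m n (n + y) m n m n m
  | 3 => profile D a b c d e (n + y + x) (n + y) n m (n + y) n m n m m
  | 4 => z < x /\ profile D a b c d e (m + x - z) m m m m m m n n (n + y)
  | 5 => z < y /\ profile D a b c d e (n + x) n m m n m m m m (m + y - z)
  | _ => profile D a b c d e (n + x) m n n m n n m m (n + y)
  end.

Lemma tri_eq (R : realType) (p q r : R) : tri p q r ->
  [/\ q < p -> q = r, p < q -> p = r, q < r -> p = q & p < r -> p = q].
Proof. by case=> -[e l]; split=> h; lra. Qed.

Lemma root_cases (R : realType) (X : finType) (D : X -> X -> R) (a b c d e : X) :
  tri (D a b) (D a c) (D b c) -> tri (D a c) (D a d) (D c d) -> tri (D b c) (D b d) (D c d) ->
  tri (D c d) (D c e) (D d e) ->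
  D a c + D b d < D a b + D c d -> D a c + D b d = D a d + D b c ->
  D a d + D c e < D a c + D d e -> D a d + D c e = D a e + D c d ->
  D b d + D c e = D b e + D c d ->
  let x := D a b + D c d - D a c - D b d in
  let y := D a c + D d e - D a d - D c e in
  exists i m z, [/\ (i < 7)%N, 0 < z & root_position D a b c d e x y i m z].
Proof.
rewrite /root_position /profile.
move: (D a b) (D a c) (D a d) (D a e) (D b c) (D b d) (D b e) (D c d) (D c e) (D d e).
move=> ab ac ad ae bc bd be cd ce de t1 t2 t3 t4 h1 h1' h3 h3' h4' /=.
have [t11 _ _ _] := tri_eq t1; have [t31 t32 _ _] := tri_eq t3; have [_ _ t43 _] := tri_eq t4.
case: t2 => -[e2 l2].
- have e3 : bd = cd by apply: t31; lra.
  have e1 : ac = bc by apply: t11; lra.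
  clear t1 t3 t11 t31 t32 t43; case: t4 => -[e4 l4].
  + by exists 3%N, ae, (ad - ae); split=> //; [lra | repeat split; lra].
  + by exists 2%N, ad, (ae - ad); split=> //; [lra | repeat split; lra].
  + by exists 5%N, ad, (ac - ad); split=> //; [lra | repeat split; lra].
- have e3 : bc = cd by apply: t32; lra.
  have e4 : cd = ce by apply: t43; lra.
  clear t1 t3 t4 t11 t31 t32 t43.
  by exists 6%N, ac, (ad - ac); split=> //; [lra | repeat split; lra].
- have e4 : cd = ce by apply: t43; lra.
  clear t3 t4 t11 t31 t32 t43; case: t1 => -[e1 l1].
  + by exists 4%N, ac, (cd - ac); split=> //; [lra | repeat split; lra].
  + by exists 1%N, ab, (ac - ab); split=> //; [lra | repeat split; lra].
  + by exists 0%N, ab, (bc - ab); split=> //; [lra | repeat split; lra].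
Qed.

Definition mid_values (R : realType) (i : nat) (x y z ma mb md me : R) : Prop :=
  let ex := expR (- x) in let ey := expR (- y) in
  let ez := expR (- (6 * z)) in let ew := expR (- (2 * z)) in
  let px := 5 * expR (- (3 * x + y)) * (1 - ez) in
  let py := 5 * expR (- (3 * y + x)) * (1 - ez) in
  match i with
  | 0 => ma - mb = px /\ md = me
  | 1 => mb - ma = px /\ md = me
  | 2 => md - me = py /\ ma = mb
  | 3 => me - md = py /\ ma = mb
  | 4 => [/\ ma = mb, md = me & ma - md = 10 * (ex - ey) + 15 * ex * ey * (1 - ew)]
  | 5 => [/\ ma = mb, md = me & md - ma = 10 * (ey - ex) + 15 * ey * ex * (1 - ew)]
  | _ => [/\ ma = 10 * ex - 5 * ex * ey + ex * ey * ez, mb = ma,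
             md = 10 * ey - 5 * ex * ey + ex * ey * ez & me = md]
  end.

Lemma mid_values_inj (R : realType) (i j : nat) (x y z z' ma mb md me : R) :
  0 < z -> 0 < z' -> (i < 7)%N -> (j < 7)%N ->
  mid_values i x y z ma mb md me -> mid_values j x y z' ma mb md me -> i = j /\ z = z'.
Proof.
move=> z0 z0' i7 j7.
have lt1 (k v : R) : 0 < k -> 0 < v -> expR (- (k * v)) < 1.
  by move=> k0 v0; rewrite expR_lt1 oppr_lt0 mulr_gt0.
have inj (k v v' : R) : 0 < k -> expR (- (k * v)) = expR (- (k * v')) -> v = v'.
  by move=> k0 /expR_inj /oppr_inj /mulfI; apply; rewrite gt_eqF.
have k6 : (0 : R) < 6 by []. have k2 : (0 : R) < 2 by [].
have e1 := lt1 6 z k6 z0; have e1' := lt1 6 z' k6 z0'.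
have e2 := lt1 2 z k2 z0; have e2' := lt1 2 z' k2 z0'.
have i6 := @inj 6 z z' k6; have i2 := @inj 2 z z' k2.
rewrite /mid_values.
move: (expR_gt0 (- x)) (expR_gt0 (- y)) (expR_gt0 (- (3 * x + y))) (expR_gt0 (- (3 * y + x))).
move: e1 e1' e2 e2' i6 i2 {lt1 inj k6 k2}.
move: (expR (- x)) (expR (- y)) (expR (- (3 * x + y))) (expR (- (3 * y + x))).
move: (expR (- (6 * z))) (expR (- (6 * z'))) (expR (- (2 * z))) (expR (- (2 * z'))).
move=> E E' F F' x1 y1 px py e1 e1' e2 e2' i6 i2 x0 y0 px0 py0.
have a1 : 0 < px * (1 - E) by rewrite mulr_gt0 // subr_gt0.
have a1' : 0 < px * (1 - E') by rewrite mulr_gt0 // subr_gt0.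
have a2 : 0 < py * (1 - E) by rewrite mulr_gt0 // subr_gt0.
have a2' : 0 < py * (1 - E') by rewrite mulr_gt0 // subr_gt0.
have a3 : 0 < x1 * y1 * (1 - F) by rewrite !mulr_gt0 // subr_gt0.
have a3' : 0 < x1 * y1 * (1 - F') by rewrite !mulr_gt0 // subr_gt0.
have cpx : px * E = px * E' -> z = z' by move=> /mulfI h; apply: i6; apply: h; rewrite gt_eqF.
have cpy : py * E = py * E' -> z = z' by move=> /mulfI h; apply: i6; apply: h; rewrite gt_eqF.
have cE : x1 * y1 * E = x1 * y1 * E' -> z = z'.
  by move=> /mulfI h; apply: i6; apply: h; rewrite gt_eqF // mulr_gt0.
have cF : x1 * y1 * F = x1 * y1 * F' -> z = z'.
  by move=> /mulfI h; apply: i2; apply: h; rewrite gt_eqF // mulr_gt0.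
clear i6 i2 e1 e1' e2 e2' z0 z0'.
have code k E0 : (k < 7)%N -> 0 < px * (1 - E0) -> 0 < py * (1 - E0) ->
  forall F0, 0 < x1 * y1 * (1 - F0) ->
  match k with
  | 0 => ma - mb = 5 * px * (1 - E0) /\ md = me
  | 1 => mb - ma = 5 * px * (1 - E0) /\ md = me
  | 2 => md - me = 5 * py * (1 - E0) /\ ma = mb
  | 3 => me - md = 5 * py * (1 - E0) /\ ma = mb
  | 4 => [/\ ma = mb, md = me & ma - md = 10 * (x1 - y1) + 15 * x1 * y1 * (1 - F0)]
  | 5 => [/\ ma = mb, md = me & md - ma = 10 * (y1 - x1) + 15 * y1 * x1 * (1 - F0)]
  | _ => [/\ ma = 10 * x1 - 5 * x1 * y1 + x1 * y1 * E0, mb = ma,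
             md = 10 * y1 - 5 * x1 * y1 + x1 * y1 * E0 & me = md]
  end ->
  k = let q := ma - md - 10 * (x1 - y1) in
    if mb < ma then 0%N else if ma < mb then 1%N else if me < md then 2%N else
    if md < me then 3%N else if 0 < q then 4%N else if q < 0 then 5%N else 6%N.
  clear; move=> k7 p1 p2 F0 p3 /=.
  case: k k7 => [|[|[|[|[|[|[|//]]]]]]] _.
  - by case=> h1 h2; have -> : mb < ma by lra.
  - by case=> h1 h2; have l : ma < mb by [lra]; rewrite (lt_gtF l) l.
  - by case=> h1 ->; rewrite ltxx; have -> : me < md by lra.
  - by case=> h1 ->; rewrite ltxx; have l : md < me by [lra]; rewrite (lt_gtF l) l.
  - by case=> -> -> h1; rewrite !ltxx; have -> : 0 < mb - me - 10 * (x1 - y1) by lra.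
  - case=> -> -> h1; rewrite !ltxx; have l : mb - me - 10 * (x1 - y1) < 0 by lra.
    by rewrite (lt_gtF l) l.
  - case=> h1 -> h2 ->; rewrite !ltxx; have -> : ma - md - 10 * (x1 - y1) = 0 by lra.
    by rewrite ltxx.
move=> hi hj.
have ei := code _ _ i7 a1 a2 _ a3 hi; have ej := code _ _ j7 a1' a2' _ a3' hj.
have ij : i = j by rewrite ei ej.
clear code ei ej; subst j; split=> //.
case: i i7 hi hj {j7} => [|[|[|[|[|[|[|//]]]]]]] _.
- by move=> [h1 _] [h3 _]; apply: (cpx); clear cpx cpy cE cF; lra.
- by move=> [h1 _] [h3 _]; apply: (cpx); clear cpx cpy cE cF; lra.
- by move=> [h1 _] [h3 _]; apply: (cpy); clear cpx cpy cE cF; lra.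
- by move=> [h1 _] [h3 _]; apply: (cpy); clear cpx cpy cE cF; lra.
- by move=> [_ _ h5] [_ _ h6]; apply: (cF); clear cpx cpy cE cF; lra.
- by move=> [_ _ h5] [_ _ h6]; apply: (cF); clear cpx cpy cE cF; lra.
- by move=> [h1 _ _ _] [h3 _ _ _]; apply: (cE); clear cpx cpy cE cF; lra.
Qed.

Section Identify.
Variables (R : realType) (X : finType).
Implicit Types (sg : rmst R X).

Definition species_tree sg t : Prop :=
  [/\ wf t, cl t = [set: X], cls t = sg.1 & pos0 sg.2 t].

Lemma sub_clT t (ys : seq X) : cl t = [set: X] -> {subset ys <= cl t}.
Proof. by move=> e y _; rewrite e inE. Qed.

Lemma dep_tri sg t a b c : species_tree sg t -> uniq [:: a; b; c] ->
  tri (dep sg.2 t a b) (dep sg.2 t a c) (dep sg.2 t b c).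
Proof.
move=> [w e ec p] u; exact: dep_triple w p u (sub_clT e).
Qed.

Definition quartet_prob sg (a b c d : X) : R :=
  EO sg (fun T => 3 * odisp R [:: a; b; c; d] [:: true; true; false; false] T).

Lemma quartet_Exg sg t a b c d : species_tree sg t -> uniq [:: a; b; c; d] ->
  [/\ quartet_prob sg a b c d = Exg sg.2 t [:: a; b; c; d] (quartet_h [:: true; true; false; false]),
      quartet_prob sg a c b d = Exg sg.2 t [:: a; b; c; d] (quartet_h [:: true; false; true; false]) &
      quartet_prob sg a d b c = Exg sg.2 t [:: a; b; c; d] (quartet_h [:: true; false; false; true])].
Proof.
move=> [w e ec p] u; split; rewrite -(EO_quartet w e ec u) //; congr EO;
  apply/funext => T; rewrite /odisp; congr (_ * _%:R); congr nat_of_bool;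
  apply: eq_existsb => S; rewrite /mk /= !eqseq_cons;
  by case: (a \in S); case: (b \in S); case: (c \in S); case: (d \in S).
Qed.

Lemma quartet_value sg t a b c d : species_tree sg t -> uniq [:: a; b; c; d] ->
  let D := dep sg.2 t in
  D a c + D b d < D a b + D c d ->
  let e := expR (- (D a b + D c d - D a c - D b d)) in
  [/\ quartet_prob sg a b c d = 3 - 2 * e, quartet_prob sg a c b d = e &
      quartet_prob sg a d b c = e].
Proof.
move=> st u D lt e; have [-> -> ->] := quartet_Exg st u; have [w ec _ p] := st.
exact: Exg4_quartet w p u (sub_clT ec) lt.
Qed.

Lemma four_point sg t a b c d : species_tree sg t -> uniq [:: a; b; c; d] ->
  let D := dep sg.2 t in
  [\/ D a c + D b d = D a d + D b c /\ D a c + D b d < D a b + D c d,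
      D a b + D c d = D a d + D b c /\ D a b + D c d < D a c + D b d |
      D a b + D c d = D a c + D b d /\ D a b + D c d < D a d + D b c].
Proof.
move=> st u D.
have u1 : uniq [:: a; b; c] by exact: subseq_uniq (prefix_subseq [:: a; b; c] [:: d]) u.
have u2 : uniq [:: b; c; d] by exact: subseq_uniq (suffix_subseq [:: a] [:: b; c; d]) u.
have u3 : uniq [:: a; b; d].
  by apply: (@subseq_uniq _ _ [:: a; b; d; c]); [exact: (prefix_subseq [:: a; b; d] [:: c])
    | rewrite (@perm_uniq _ _ [:: a; b; c; d]) //; permt].
have u4 : uniq [:: a; c; d].
  by apply: (@subseq_uniq _ _ [:: a; c; d; b]); [exact: (prefix_subseq [:: a; c; d] [:: b])
    | rewrite (@perm_uniq _ _ [:: a; b; c; d]) //; permt].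
have := (dep_tri st u1, dep_tri st u2, dep_tri st u3, dep_tri st u4).
rewrite -/D; move: (D a b) (D a c) (D a d) (D b c) (D b d) (D c d) => ab ac ad bc bd cd.
move=> [[[t1 t2] t3] t4].
have [_ t22 _ t24] := tri_eq t2; have [_ t32 _ t34] := tri_eq t3; have [_ t42 _ _] := tri_eq t4.
case: t1 => -[e1 l1].
- case: t3 {t32 t34} => -[e3 l3].
  + by clear t2 t22 t24 t42; apply: Or31; split; [|case: t4 => -[e4 l4]]; lra.
  + have e4 : ac = cd by apply: t42; lra.
    by clear t2 t22 t24 t42 t4; apply: Or33; split; lra.
  + have e4 : bc = cd by apply: t22; lra.
    by clear t2 t22 t24 t42 t4; apply: Or32; split; lra.
- case: t4 {t42} => -[e4 l4].
  + by clear t2 t22 t24 t32 t34; apply: Or32; split; [|case: t3 => -[e3 l3]]; lra.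
  + have e3 : ab = bd by apply: t32; lra.
    by clear t2 t22 t24 t32 t34 t3; apply: Or33; split; lra.
  + have e2 : bc = bd by apply: t24; lra.
    by clear t2 t22 t24 t32 t34 t3; apply: Or31; split; lra.
- case: t2 {t22 t24} => -[e2 l2].
  + by clear t4 t42 t32 t34; apply: Or33; split; [|case: t3 => -[e3 l3]]; lra.
  + have e3 : ab = ad by apply: t34; lra.
    by clear t4 t42 t32 t34 t3; apply: Or32; split; lra.
  + have e3 : ab = ad by apply: t34; lra.
    by clear t4 t42 t32 t34 t3; apply: Or31; split; lra.
Qed.

Lemma expR_neg_lt1 (v : R) : 0 < v -> expR (- v) < 1.
Proof. by move=> v0; rewrite expR_lt1 oppr_lt0. Qed.

Lemma quartet_cases sg t a b c d : species_tree sg t -> uniq [:: a; b; c; d] ->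
  let D := dep sg.2 t in
  let w1 := D a b + D c d in let w2 := D a c + D b d in let w3 := D a d + D b c in
  let q1 := quartet_prob sg a b c d in let q2 := quartet_prob sg a c b d in
  let q3 := quartet_prob sg a d b c in
  exists v, 0 < v /\
  [\/ [/\ w1 = w2 + v, w3 = w2 & q1 = 3 - 2 * expR (- v) /\ q2 = expR (- v)],
      [/\ w2 = w1 + v, w3 = w1 & q2 = 3 - 2 * expR (- v) /\ q1 = expR (- v)] |
      [/\ w3 = w1 + v, w2 = w1 & [/\ q3 = 3 - 2 * expR (- v), q1 = expR (- v) & q2 = expR (- v)]]].
Proof.
move=> st u D w1 w2 w3 q1 q2 q3.
have qs x y z v : quartet_prob sg x y z v = quartet_prob sg x y v z.
  rewrite /quartet_prob; congr EO.
  apply/funext => T; rewrite /odisp; congr (_ * _%:R); congr nat_of_bool.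
  apply: eq_existsb => S; rewrite /mk /= !eqseq_cons.
  by case: (x \in S); case: (y \in S); case: (z \in S); case: (v \in S).
have [[e1 l1]|[e1 l1]|[e1 l1]] := four_point st u; rewrite -/D -/w1 -/w2 -/w3 in e1 l1.
- exists (w1 - w2); split; first lra.
  apply: Or31; split; [lra|lra|].
  rewrite /q1 /q2; have [-> -> _] := quartet_value st u l1.
  by have -> : - (w1 - w2) = - (D a b + D c d - D a c - D b d) by rewrite /w1 /w2; ring.
- have u' : uniq [:: a; c; b; d] by rewrite (@perm_uniq _ _ [:: a; b; c; d]) //; permt.
  exists (w2 - w1); split; first lra.
  apply: Or32; split; [lra|lra|].
  rewrite /q1 /q2; have [-> -> _] := quartet_value st u' l1.
  by have -> : - (w2 - w1) = - (D a c + D b d - D a b - D c d) by rewrite /w1 /w2; ring.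
- have u' : uniq [:: a; d; b; c] by rewrite (@perm_uniq _ _ [:: a; b; c; d]) //; permt.
  exists (w3 - w1); split; first lra.
  apply: Or33; split; [lra|lra|].
  have Ddc : D d c = D c d by exact: depC.
  have l1' : D a b + D d c < D a d + D b c by rewrite Ddc.
  have [h1 h2 h3] := quartet_value st u' l1'; rewrite -/D in h1 h2 h3.
  have e3 : - (w3 - w1) = - (D a d + D b c - D a b - D d c).
    by rewrite /w1 /w3 Ddc; ring.
  by rewrite /q3 h1 e3 /q2 (qs a c b d) h3 /q1 (qs a b c d) h2.
Qed.

Lemma quartet_diff sg1 sg2 t1 t2 a b c d :
  species_tree sg1 t1 -> species_tree sg2 t2 -> gtprob sg1 =1 gtprob sg2 ->
  uniq [:: a; b; c; d] ->
  let D1 := dep sg1.2 t1 in let D2 := dep sg2.2 t2 in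
  D1 a b + D1 c d - D1 a c - D1 b d = D2 a b + D2 c d - D2 a c - D2 b d.
Proof.
move=> s1 s2 e u D1 D2.
have eq x y z v : quartet_prob sg1 x y z v = quartet_prob sg2 x y z v.
  by apply: eq_bigr => T _; rewrite e.
have [v [v0 c1]] := quartet_cases s1 u; have [v' [v0' c2]] := quartet_cases s2 u.
have l1 := expR_neg_lt1 v0; have l2 := expR_neg_lt1 v0'.
rewrite -/D1 !eq in c1; rewrite -/D2 in c2.
have inj : expR (- v) = expR (- v') -> v = v' by move=> /expR_inj; lra.
move: c1 c2 l1 l2 inj.
move: (quartet_prob _ _ _ _ _) (quartet_prob _ _ _ _ _) (quartet_prob _ _ _ _ _) => q1 q2 q3.
move: (expR (- v)) (expR (- v')) => E E'.
case=> [[h1 h2 [h3 h4]]|[h1 h2 [h3 h4]]|[h1 h2 [h3 h4 h5]]];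
case=> [[g1 g2 [g3 g4]]|[g1 g2 [g3 g4]]|[g1 g2 [g3 g4 g5]]] l1 l2 inj;
try (exfalso; clear inj; lra); have ev : v = v' by (apply: inj; lra).
all: clear inj; lra.
Qed.

End Identify.

Section IdentifyFive.
Variables (R : realType) (X : finType).
Implicit Types (sg : rmst R X).

Definition Mid sg v (ws : seq X) : R := EO sg (fun T => 30 * (omid v ws T)%:R).

Lemma Mid_Exg sg t y0 ys i v ws : species_tree sg t -> uniq ys -> size ys = 5 -> (i < 5)%N ->
  v = nth y0 ys i -> perm_eq ws (others y0 i ys) -> Exg sg.2 t ys (middle_h i) = Mid sg v ws.
Proof. by move=> [w e ec p] u s i5 -> pw; rewrite /Mid (EO_mid w e ec u s i5 pw). Qed.

Lemma mid_values_of_position sg t a b c d e (x y : R) i (m z : R) :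
  species_tree sg t -> uniq [:: a; b; c; d; e] -> 0 < x -> 0 < y -> 0 < z -> (i < 7)%N ->
  root_position (dep sg.2 t) a b c d e x y i m z ->
  mid_values i x y z (Mid sg a [:: b; c; d; e]) (Mid sg b [:: a; c; d; e])
    (Mid sg d [:: a; b; c; e]) (Mid sg e [:: a; b; c; d]).
Proof.
move=> st u x0 y0 z0 i7; have [w ec _ p] := st.
have U (ys : seq X) : perm_eq ys [:: a; b; c; d; e] -> uniq ys by move=> h; rewrite (perm_uniq h).
have u1 : uniq [:: d; e; c; b; a] by apply: U; permt.
have u2 : uniq [:: d; e; c; a; b] by apply: U; permt.
have u3 : uniq [:: a; b; c; e; d] by apply: U; permt.
have u4 : uniq [:: a; b; d; e; c] by apply: U; permt.
have sub (ys : seq X) : {subset ys <= cl t} by exact: sub_clT ec.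
have S x' y' := depC sg.2 t x' y'.
have ME ys j v ws := @Mid_Exg sg t a ys j v ws st.
case: i i7 => [|[|[|[|[|[|[|//]]]]]]] _; rewrite /root_position /mid_values.
- case=> -[ab ac ad ae] [bc bd be] [cd ce] de.
  have [|||h1 h2] := @Exg5_cat _ _ sg.2 t d e c b a w p u1 (sub _);
    rewrite ?(S d c) ?(S d b) ?(S d a); try lra.
  rewrite (ME _ 4 a [:: b; c; d; e] u1) ?(ME _ 3 b [:: a; c; d; e] u1) // in h1; try permt.
  rewrite (ME _ 0 d [:: a; b; c; e] u1) ?(ME _ 1 e [:: a; b; c; d] u1) // in h2; try permt.
  split=> //; rewrite h1 (S d c) (S d b) (S d a) de cd bd ad.
  set n := m + z.
  have -> : n + x + y + 2 * (n + x) - 3 * n = 3 * x + y by rewrite /n; ring.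
  have -> : n + x + y + 2 * (n + x) + 3 * n - 6 * m = 3 * x + y + 6 * z by rewrite /n; ring.
  by rewrite [- (_ + 6 * z)]opprD expRD; ring.
- case=> -[ab ac ad ae] [bc bd be] [cd ce] de.
  have [|||h1 h2] := @Exg5_cat _ _ sg.2 t d e c a b w p u2 (sub _);
    rewrite ?(S d c) ?(S d b) ?(S d a); try lra.
  rewrite (ME _ 4 b [:: a; c; d; e] u2) ?(ME _ 3 a [:: b; c; d; e] u2) // in h1; try permt.
  rewrite (ME _ 0 d [:: a; b; c; e] u2) ?(ME _ 1 e [:: a; b; c; d] u2) // in h2; try permt.
  split=> //; rewrite h1 (S d c) (S d b) (S d a) de cd bd ad.
  set n := m + z.
  have -> : n + x + y + 2 * (n + x) - 3 * n = 3 * x + y by rewrite /n; ring.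
  have -> : n + x + y + 2 * (n + x) + 3 * n - 6 * m = 3 * x + y + 6 * z by rewrite /n; ring.
  by rewrite [- (_ + 6 * z)]opprD expRD; ring.
- case=> -[ab ac ad ae] [bc bd be] [cd ce] de.
  have [|||h1 h2] := @Exg5_cat _ _ sg.2 t a b c e d w p u3 (sub _); try lra.
  rewrite (ME _ 4 d [:: a; b; c; e] u3) ?(ME _ 3 e [:: a; b; c; d] u3) // in h1; try permt.
  rewrite (ME _ 0 a [:: b; c; d; e] u3) ?(ME _ 1 b [:: a; c; d; e] u3) // in h2; try permt.
  split=> //; rewrite h1 ab ac ae ad.
  set n := m + z.
  have -> : n + y + x + 2 * (n + y) - 3 * n = 3 * y + x by rewrite /n; ring.
  have -> : n + y + x + 2 * (n + y) + 3 * n - 6 * m = 3 * y + x + 6 * z by rewrite /n; ring.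
  by rewrite [- (_ + 6 * z)]opprD expRD; ring.
- case=> -[ab ac ad ae] [bc bd be] [cd ce] de.
  have [|||h1 h2] := @Exg5_cat _ _ sg.2 t a b c d e w p u (sub _); try lra.
  rewrite (ME _ 4 e [:: a; b; c; d] u) ?(ME _ 3 d [:: a; b; c; e] u) // in h1; try permt.
  rewrite (ME _ 0 a [:: b; c; d; e] u) ?(ME _ 1 b [:: a; c; d; e] u) // in h2; try permt.
  split=> //; rewrite h1 ab ac ae ad.
  set n := m + z.
  have -> : n + y + x + 2 * (n + y) - 3 * n = 3 * y + x by rewrite /n; ring.
  have -> : n + y + x + 2 * (n + y) + 3 * n - 6 * m = 3 * y + x + 6 * z by rewrite /n; ring.
  by rewrite [- (_ + 6 * z)]opprD expRD; ring.
- case=> zx [] [ab ac ad ae] [bc bd be] [cd ce] de.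
  have [|||h1 h2 h3] := @Exg5_bal _ _ sg.2 t d e c a b w p u2 (sub _);
    rewrite ?(S d c) ?(S d a); try lra.
  rewrite (ME _ 3 a [:: b; c; d; e] u2) ?(ME _ 4 b [:: a; c; d; e] u2) // in h1; try permt.
  rewrite (ME _ 0 d [:: a; b; c; e] u2) ?(ME _ 1 e [:: a; b; c; d] u2) // in h2; try permt.
  rewrite (ME _ 3 a [:: b; c; d; e] u2) ?(ME _ 0 d [:: a; b; c; e] u2) // in h3; try permt.
  split=> //; rewrite h3 (S d c) (S d a) ab de cd ad.
  have -> : m + x - z + (m + z) - 2 * m = x by ring.
  have -> : m + z + y - (m + z) = y by ring.
  by have -> : m + z - m = z by ring.
- case=> zy [] [ab ac ad ae] [bc bd be] [cd ce] de.
  have [|||h1 h2 h3] := @Exg5_bal _ _ sg.2 t a b c d e w p u (sub _); try lra.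
  rewrite (ME _ 3 d [:: a; b; c; e] u) ?(ME _ 4 e [:: a; b; c; d] u) // in h1; try permt.
  rewrite (ME _ 0 a [:: b; c; d; e] u) ?(ME _ 1 b [:: a; c; d; e] u) // in h2; try permt.
  rewrite (ME _ 3 d [:: a; b; c; e] u) ?(ME _ 0 a [:: b; c; d; e] u) // in h3; try permt.
  split=> //; rewrite h3 ab de ac ad.
  have -> : m + y - z + (m + z) - 2 * m = y by ring.
  have -> : m + z + x - (m + z) = x by ring.
  by have -> : m + z - m = z by ring.
- case=> -[ab ac ad ae] [bc bd be] [cd ce] de.
  have [|||h1 h2 h3 h4] := @Exg5_pse _ _ sg.2 t a b d e c w p u4 (sub _); try lra.
  rewrite (ME _ 0 a [:: b; c; d; e] u4) // in h1; try permt.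
  rewrite (ME _ 1 b [:: a; c; d; e] u4) // in h2; try permt.
  rewrite (ME _ 2 d [:: a; b; c; e] u4) // in h3; try permt.
  rewrite (ME _ 3 e [:: a; b; c; d] u4) // in h4; try permt.
  rewrite h1 h2 h3 h4 ab ad ac de.
  have -> : m + z + x - (m + z) = x by ring.
  have -> : m + z + y - (m + z) = y by ring.
  by have -> : m + z - m = z by ring.
Qed.

Lemma four_point_eq sg t a b c d : species_tree sg t -> uniq [:: a; b; c; d] ->
  let D := dep sg.2 t in
  D a c + D b d < D a b + D c d -> D a c + D b d = D a d + D b c.
Proof. by move=> st u D; have [[]|[]|[]] := four_point st u; rewrite -/D; lra. Qed.

Definition unrooted5 (D : X -> X -> R) a b c d e : Prop :=
  [/\ D a c + D b d < D a b + D c d, D a d + D c e < D a c + D d e &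
      D b d + D c e < D b c + D d e].

Lemma root_exists sg t a b c d e : species_tree sg t -> uniq [:: a; b; c; d; e] ->
  let D := dep sg.2 t in unrooted5 D a b c d e ->
  let x := D a b + D c d - D a c - D b d in
  let y := D a c + D d e - D a d - D c e in
  exists i m z, [/\ (i < 7)%N, 0 < z & root_position D a b c d e x y i m z].
Proof.
move=> st u D [h1 h2 h3] x y.
have U (ys : seq X) : (forall P : pred X, (count P ys <= count P [:: a; b; c; d; e])%N) -> uniq ys.
  move=> h; apply: count_mem_uniq => v; case: (boolP (v \in ys)) => vy; last exact/count_memPn.
  apply/eqP; rewrite eqn_leq -has_count has_pred1 vy andbT.
  by apply: leq_trans (h _) _; rewrite (count_uniq_mem _ u); case: (_ \in _).
have T p q r : uniq [:: p; q; r] -> tri (D p q) (D p r) (D q r) by exact: dep_tri.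
have F p q r s : uniq [:: p; q; r; s] -> D p r + D q s < D p q + D r s ->
  D p r + D q s = D p s + D q r by exact: four_point_eq.
have ut : [/\ [/\ uniq [:: a; b; c], uniq [:: a; c; d], uniq [:: b; c; d] & uniq [:: c; d; e]],
    uniq [:: a; b; c; d], uniq [:: a; c; d; e] & uniq [:: b; c; d; e]].
  by split; [split|..]; apply: U; let P := fresh in intro P; cbn [count];
    repeat match goal with |- context [nat_of_bool (P ?x)] => generalize (nat_of_bool (P x)) end;
    clear; intros; lia.
case: ut => -[u1 u2 u3 u4] u5 u6 u7.
exact: (root_cases (T _ _ _ u1) (T _ _ _ u2) (T _ _ _ u3) (T _ _ _ u4) h1 (F _ _ _ _ u5 h1)
  h2 (F _ _ _ _ u6 h2) (F _ _ _ _ u7 h3)).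
Qed.

Lemma five_labelled sg1 sg2 t1 t2 a b c d e :
  species_tree sg1 t1 -> species_tree sg2 t2 -> gtprob sg1 =1 gtprob sg2 ->
  uniq [:: a; b; c; d; e] ->
  let D1 := dep sg1.2 t1 in let D2 := dep sg2.2 t2 in
  unrooted5 D1 a b c d e ->
  exists K, {in [:: a; b; c; d; e] &, forall p q, p != q -> D1 p q = D2 p q + K}.
Proof.
move=> s1 s2 eg u D1 D2 un1.
have sub4 p q r s v : perm_eq [:: p; q; r; s; v] [:: a; b; c; d; e] -> uniq [:: p; q; r; s].
  move=> h; rewrite -(perm_uniq h) in u.
  exact: subseq_uniq (prefix_subseq [:: p; q; r; s] [:: v]) u.
have Q p q r s v : perm_eq [:: p; q; r; s; v] [:: a; b; c; d; e] ->
    D1 p q + D1 r s - D1 p r - D1 q s = D2 p q + D2 r s - D2 p r - D2 q s.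
  by move=> h; apply: quartet_diff s1 s2 eg (sub4 _ _ _ _ _ h).
have q1 : D1 a b + D1 c d - D1 a c - D1 b d = D2 a b + D2 c d - D2 a c - D2 b d.
  by apply: (Q _ _ _ _ e); permt.
have q3 : D1 a c + D1 d e - D1 a d - D1 c e = D2 a c + D2 d e - D2 a d - D2 c e.
  by apply: (Q _ _ _ _ b); permt.
have q4 : D1 b c + D1 d e - D1 b d - D1 c e = D2 b c + D2 d e - D2 b d - D2 c e.
  by apply: (Q _ _ _ _ a); permt.
have un2 : unrooted5 D2 a b c d e by case: un1 => *; split; lra.
have x0 : 0 < D1 a b + D1 c d - D1 a c - D1 b d by case: un1 => *; lra.
have y0 : 0 < D1 a c + D1 d e - D1 a d - D1 c e by case: un1 => *; lra.
have [i [m [z [i7 z0 r1]]]] := root_exists s1 u un1.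
have [j [m' [z' [j7 z0' r2]]]] := root_exists s2 u un2.
rewrite -/D1 in r1; rewrite -/D2 -q1 -q3 in r2.
have v1 := mid_values_of_position s1 u x0 y0 z0 i7 r1.
have v2 := mid_values_of_position s2 u x0 y0 z0' j7 r2.
have eM v ws : Mid sg1 v ws = Mid sg2 v ws by apply: eq_bigr => T _; rewrite eg.
rewrite !eM in v1; have [ij zz] := mid_values_inj z0 z0' i7 j7 v1 v2.
subst j z'.
have S1 p q : D1 p q = D1 q p by exact: depC.
have S2 p q : D2 p q = D2 q p by exact: depC.
suff H : [/\ [/\ D1 a b = D2 a b + (m - m'), D1 a c = D2 a c + (m - m'),
                 D1 a d = D2 a d + (m - m') & D1 a e = D2 a e + (m - m')],
             [/\ D1 b c = D2 b c + (m - m'), D1 b d = D2 b d + (m - m') &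
                 D1 b e = D2 b e + (m - m')],
             [/\ D1 c d = D2 c d + (m - m') & D1 c e = D2 c e + (m - m')] &
             D1 d e = D2 d e + (m - m')].
  exists (m - m') => p q; rewrite !inE.
  case: H => -[ab ac ad ae] [bc bd be] [cd ce] de.
  by move=> /or4P[/eqP->|/eqP->|/eqP->|/orP[]/eqP->] /or4P[/eqP->|/eqP->|/eqP->|/orP[]/eqP->];
    rewrite ?eqxx // => _; rewrite // S1 S2.
move: r1 r2; rewrite /root_position /profile.
case: i i7 {v1 v2 j7} => [|[|[|[|[|[|[|//]]]]]]] _;
  try (move=> [] [-> -> -> ->] [-> -> ->] [-> ->] -> [] [-> -> -> ->] [-> -> ->] [-> ->] ->);
  try (move=> [_ [[-> -> -> ->] [-> -> ->] [-> ->] ->]] [_ [[-> -> -> ->] [-> -> ->] [-> ->] ->]]);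
  by repeat split; ring.
Qed.

End IdentifyFive.

(** * Reconstruction from depths *)

Section Reconstruct.
Variables (R : realType) (X : finType).
Implicit Types (sg : rmst R X).

Lemma unrooted_label sg t (ys : seq X) : species_tree sg t -> uniq ys -> size ys = 5 ->
  exists a b c d e, perm_eq ys [:: a; b; c; d; e] /\ unrooted5 (dep sg.2 t) a b c d e.
Proof.
move=> st u sy; set D := dep sg.2 t.
have S p q : D p q = D q p by exact: depC.
pose P (p : X * X) := [&& p.1 \in ys, p.2 \in ys & p.1 != p.2].
have [p0 Pp0] : exists p, P p.
  case: ys u sy @P => [|y [|z s]] // /andP[yz _] _.
  exists (y, z); rewrite !inE !eqxx orbT /=.
  by apply: contraNneq yz => ->; rewrite inE eqxx.
case: (@Order.TotalTheory.arg_maxP _ _ _ p0 P (fun p => D p.1 p.2) Pp0) => -[d e] /and3P[/= dy ey de] mx.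
have ey' : e \in rem d ys by rewrite mem_rem_uniq // !inE eq_sym de.
have p1 := perm_to_rem dy; have p2 := perm_to_rem ey'.
have sr : size (rem e (rem d ys)) = 3 by rewrite !size_rem // sy.
case: (rem e (rem d ys)) sr p2 => [|x1 [|x2 [|x3 [|]]]] // _ p2.
have pp : perm_eq ys [:: d, e & [:: x1; x2; x3]].
  by apply: (perm_trans p1); rewrite perm_cons.
have up : uniq [:: d; e; x1; x2; x3] by rewrite -(perm_uniq pp).
have mem w : w \in [:: x1; x2; x3] -> w \in ys.
  by move=> h; rewrite (perm_mem pp) !in_cons; move: h; rewrite !inE => /or3P[]->; rewrite ?orbT.
have cherry w : w \in [:: x1; x2; x3] -> D w d = D w e /\ D w d < D d e.
  move=> hw.
  have uw : uniq [:: d; e; w].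
    rewrite /= !inE !negb_or de andbT /=; move: up hw; rewrite /= !inE !negb_or.
    case/and3P => /and4P[_ n1 n2 n3] /and3P[m1 m2 m3] _.
    by move=> /or3P[]/eqP->; rewrite ?n1 ?n2 ?n3 ?m1 ?m2 ?m3.
  have m1 : D d w <= D d e.
    apply: (mx (d, w)); rewrite /P /= dy mem //=.
    by apply: contraTneq uw => ->; rewrite /= !inE eqxx orbT.
  have m2 : D e w <= D d e.
    apply: (mx (e, w)); rewrite /P /= ey mem //=.
    by apply: contraTneq uw => ->; rewrite /= !inE eqxx !andbF.
  have := dep_tri st uw; rewrite -/D (S w d) (S w e).
  by case=> -[h1 h2]; lra.
have [c1 l1] := cherry x1 (mem_head _ _).
have [c2 l2] : D x2 d = D x2 e /\ D x2 d < D d e by apply: cherry; rewrite !inE eqxx orbT.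
have [c3 l3] : D x3 d = D x3 e /\ D x3 d < D d e by apply: cherry; rewrite !inE eqxx !orbT.
have uq : uniq [:: x1; x2; x3; d].
  apply: (@subseq_uniq _ _ [:: x1; x2; x3; d; e]); first exact: (prefix_subseq [:: x1; x2; x3; d] [:: e]).
  by rewrite (perm_uniq (_ : perm_eq _ [:: d; e; x1; x2; x3])) //; permt.
have fin a b c : perm_eq [:: a; b; c; d; e] [:: d; e; x1; x2; x3] ->
    D a d = D a e -> D a d < D d e -> D b d = D b e -> D b d < D d e ->
    D c d = D c e -> D c d < D d e ->
    D a c + D b d < D a b + D c d ->
    exists a b c d e, perm_eq ys [:: a; b; c; d; e] /\ unrooted5 D a b c d e.
  move=> pe ea la eb lb ec lc lt; exists a, b, c, d, e; split.
    by apply: (perm_trans pp); rewrite perm_sym.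
  have ua : uniq [:: a; b; c; d; e] by rewrite (perm_uniq pe).
  have u1 : uniq [:: a; c; d].
    apply: (@subseq_uniq _ _ [:: a; c; d; b; e]); first exact: (prefix_subseq [:: a; c; d] [:: b; e]).
    by rewrite (perm_uniq (_ : perm_eq _ [:: a; b; c; d; e])) //; permt.
  have u2 : uniq [:: b; c; d].
    apply: (@subseq_uniq _ _ [:: b; c; d; a; e]); first exact: (prefix_subseq [:: b; c; d] [:: a; e]).
    by rewrite (perm_uniq (_ : perm_eq _ [:: a; b; c; d; e])) //; permt.
  have t1 := dep_tri st u1; have t2 := dep_tri st u2; rewrite -/D in t1 t2.
  move: lt; rewrite /unrooted5 -ec => lt.
  by split=> //; [case: t1 => -[]|case: t2 => -[]]; lra.
have q := four_point st uq; rewrite -/D in q.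
case: q => -[h1 h2].
- by apply: (fin x1 x2 x3) => //; permt.
- by apply: (fin x1 x3 x2) => //; permt.
- apply: (fin x2 x3 x1) => //; first permt.
  by rewrite (S x2 x1); lra.
Qed.

Lemma five_const sg1 sg2 t1 t2 (ys : seq X) :
  species_tree sg1 t1 -> species_tree sg2 t2 -> gtprob sg1 =1 gtprob sg2 ->
  uniq ys -> size ys = 5 ->
  exists K, {in ys &, forall p q, p != q -> dep sg1.2 t1 p q = dep sg2.2 t2 p q + K}.
Proof.
move=> s1 s2 eg u sy; have [a [b [c [d [e [pe un]]]]]] := unrooted_label s1 u sy.
have u' : uniq [:: a; b; c; d; e] by rewrite -(perm_uniq pe).
have [K h] := five_labelled s1 s2 eg u' un.
by exists K => p q; rewrite !(perm_mem pe); exact: h.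
Qed.

Lemma extend5 (s : seq X) : (size s <= 5)%N -> (5 <= #|X|)%N ->
  exists ys, [/\ uniq ys, size ys = 5 & {subset s <= ys}].
Proof.
move=> s5 X5; set s' := undup s.
have s5' : (size s' <= 5)%N by exact: leq_trans (size_undup s) s5.
set r := [seq x <- enum X | x \notin s'].
have sr : (5 - size s' <= size r)%N.
  rewrite /r size_filter leq_subLR; apply: (leq_trans X5).
  rewrite cardE -(count_predC [in s'] (enum X)); apply: leq_add => //.
  rewrite -size_filter; apply: uniq_leq_size; first exact: filter_uniq (enum_uniq _).
  by move=> x; rewrite mem_filter => /andP[].
exists (s' ++ take (5 - size s') r); split.
- rewrite cat_uniq undup_uniq /=; apply/andP; split; last first.
    by apply: take_uniq; exact: filter_uniq (enum_uniq _).
  by apply/hasPn => x /mem_take; rewrite mem_filter => /andP[].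
- by rewrite size_cat size_takel // subnKC.
- by move=> x xs; rewrite mem_cat mem_undup xs.
Qed.

Lemma all_const sg1 sg2 t1 t2 : (5 <= #|X|)%N ->
  species_tree sg1 t1 -> species_tree sg2 t2 -> gtprob sg1 =1 gtprob sg2 ->
  exists K, forall p q, p != q -> dep sg1.2 t1 p q = dep sg2.2 t2 p q + K.
Proof.
move=> X5 s1 s2 eg.
have [p0 [q0 pq0]] : exists p0 q0 : X, p0 != q0.
  by have /card_gt1P[p [q [_ _ pq]]] : (1 < #|X|)%N by [exact: leq_trans X5]; exists p, q.
exists (dep sg1.2 t1 p0 q0 - dep sg2.2 t2 p0 q0) => p q pq.
have [ys [u sy sub]] := @extend5 [:: p0; q0; p; q] isT X5.
have [K h] := five_const s1 s2 eg u sy.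
have m x : x \in [:: p0; q0; p; q] -> x \in ys by exact: sub.
rewrite (h p0 q0) ?(h p q) ?m ?inE ?eqxx ?orbT //; ring.
Qed.

Definition depth sg (a b : X) : R :=
  \sum_(B in sg.1 | [&& B != [set: X], a \in B & b \in B]) sg.2 B.

Lemma dep_depth sg t a b : species_tree sg t ->
  dep sg.2 t a b = sg.2 [set: X] + depth sg a b.
Proof.
move=> [w e ec p]; rewrite /dep ec (bigD1 [set: X]) /=; last by rewrite -ec -e cl_cls e !inE.
congr (_ + _); apply: eq_bigl => B; case: (B \in sg.1) => //=.
by case: (B != [set: X]); rewrite ?andbT ?andbF.
Qed.

Section OneTree.
Variables (sg : rmst R X).
Hypothesis hs : is_rmst sg.
Let C := sg.1.

Lemma rmst_pos B a b : B \in C -> B != [set: X] -> a \in B -> b \in B -> a != b -> 0 < sg.2 B.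
Proof.
move=> BC BT aB bB ab; apply: hs.2 => //; apply/andP; split; first by apply/card_gt1P; exists a, b.
by rewrite -cardsT; apply: proper_card; rewrite properEneq BT subsetT.
Qed.

Lemma depth_ge0 a b : a != b -> 0 <= depth sg a b.
Proof.
move=> ab; apply: sumr_ge0 => B /and4P[BC BT aB bB]; apply: ltW; exact: rmst_pos ab.
Qed.

Lemma cluster_children A : A \in C -> (1 < #|A|)%N ->
  exists B1 B2 a b, [/\ B1 \in C /\ B2 \in C, [disjoint B1 & B2], B1 :|: B2 = A, a \in B1 & b \in B2].
Proof.
have [[_ _ C0 _ Cb] _] := hs; move=> AC A1.
have [B1 [B2 [c1 c2 d e]]] := Cb A AC A1.
have ne B : B \in C -> exists x, x \in B by move=> BC; apply/set0Pn; apply: contraNneq C0 => <-.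
by have [a ha] := ne _ c1; have [b hb] := ne _ c2; exists B1, B2, a, b.
Qed.

Lemma cluster_sup B1 B2 B a b : B1 \in C -> B2 \in C -> [disjoint B1 & B2] -> B \in C ->
  a \in B1 -> b \in B2 -> a \in B -> b \in B -> B1 :|: B2 \subset B.
Proof.
have [[_ _ _ Cn _] _] := hs; move=> c1 c2 d cB a1 b2 aB bB; rewrite subUset; apply/andP; split.
  case/or3P: (Cn _ _ cB c1) => [/subsetP s|//|dd]; first by case: (disjointE d (s _ bB) b2).
  by case: (disjointE dd aB a1).
case/or3P: (Cn _ _ cB c2) => [/subsetP s|//|dd]; first by case: (disjointE d a1 (s _ aB)).
by case: (disjointE dd bB b2).
Qed.

Lemma depth_split B1 B2 a b : B1 \in C -> B2 \in C -> [disjoint B1 & B2] ->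
  a \in B1 -> b \in B2 ->
  depth sg a b = \sum_(B in C | (B != [set: X]) && (B1 :|: B2 \subset B)) sg.2 B.
Proof.
move=> c1 c2 d a1 b2; apply: eq_bigl => B; case: (boolP (B \in C)) => //= cB.
congr (_ && _); apply/andP/idP => [[aB bB]|/subsetP s]; first exact: (cluster_sup c1 c2 d cB a1 b2).
by split; apply: s; rewrite inE ?a1 ?b2 ?orbT.
Qed.

Lemma root_pair : (1 < #|X|)%N -> exists a b, a != b /\ depth sg a b = 0.
Proof.
move=> X1; have [[CT _ _ _ _] _] := hs.
have [|B1 [B2 [a [b [[c1 c2] d e a1 b2]]]]] := cluster_children CT; first by rewrite cardsT.
exists a, b; split; first by apply/eqP => ab; apply: (disjointE d a1); rewrite ab.
rewrite (depth_split c1 c2 d a1 b2) e big1 // => B /and3P[_ BT].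
by rewrite subTset => /eqP eB; rewrite eB eqxx in BT.
Qed.

Lemma depth_cluster A a b c : A \in C -> a \in A -> b \in A -> a != b -> c \notin A ->
  depth sg a c < depth sg a b.
Proof.
move=> AC aA bA ab cA; have [[_ _ _ Cn _] _] := hs.
have AT : A != [set: X] by apply: contraNneq cA => ->; rewrite inE.
have ac : a != c by apply: contraNneq cA => <-.
rewrite [ltRHS](bigD1 A) /=; last by rewrite AC AT aA bA.
apply: (@le_lt_trans _ _ (0 + depth sg a c)); first by rewrite add0r.
apply: ltr_leD; first exact: rmst_pos ab.
rewrite /depth big_mkcond [leRHS]big_mkcond /=; apply: ler_sum => B _.
case: ifP => [/and4P[BC BT aB cB]|_]; last first.
  case: ifP => // /andP[/and4P[BC BT aB bB] _]; apply: ltW; exact: rmst_pos ab.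
have -> : b \in B.
  case/or3P: (Cn _ _ BC AC) => [/subsetP s|/subsetP s|d]; last by case: (disjointE d aB aA).
    by case/negP: cA; apply: s.
  exact: s.
rewrite BC BT aB /=; case: eqP => [e|_] //=; by rewrite -e cB in cA.
Qed.

Lemma clusterP A : reflect (A != finset.set0 /\
    forall a b c, a \in A -> b \in A -> a != b -> c \notin A -> depth sg a c < depth sg a b)
  (A \in C).
Proof.
have [[CT Cs C0 Cn Cb] _] := hs.
apply: (iffP idP) => [AC|[A0 h]].
  by split; [apply: contraNneq C0 => <- | move=> a b c; exact: depth_cluster].
have [A1|A1] := leqP #|A| 1.
  have /cards1P[a ->] : #|A| == 1%N by rewrite eqn_leq A1 card_gt0.
  exact: Cs.
have P0 : ([set: X] \in C) && (A \subset [set: X]) by rewrite CT subsetT.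
case: (@arg_minnP _ [set: X] (fun B => (B \in C) && (A \subset B)) (fun B => #|B|) P0).
move=> B /andP[BC AB] mn.
have B1' : (1 < #|B|)%N by exact: leq_trans A1 (subset_leq_card AB).
have [B1 [B2 [x [y [[c1 c2] d e xB yB]]]]] := cluster_children BC B1'.
have lt1 : (#|B1| < #|B|)%N.
  apply: proper_card; rewrite -e; apply/properP; split; first exact: subsetUl.
  by exists y; [rewrite inE yB orbT | apply/negP => hy; exact: (disjointE d hy yB)].
have lt2 : (#|B2| < #|B|)%N.
  apply: proper_card; rewrite -e; apply/properP; split; first exact: subsetUr.
  by exists x; [rewrite inE xB | apply/negP => hx; exact: (disjointE d xB hx)].
have [b bA b2] : exists2 b, b \in A & b \in B2.
  have : ~~ (A \subset B1).
    by apply/negP => s; have := mn B1; rewrite c1 s leqNgt lt1 => /(_ isT).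
  case/subsetPn => b bA nb; exists b => //.
  by have := subsetP AB _ bA; rewrite -e inE (negbTE nb).
have [a aA a1] : exists2 a, a \in A & a \in B1.
  have : ~~ (A \subset B2).
    by apply/negP => s; have := mn B2; rewrite c2 s leqNgt lt2 => /(_ isT).
  case/subsetPn => a aA na; exists a => //.
  by have := subsetP AB _ aA; rewrite -e inE (negbTE na) orbF.
have ab : a != b by apply/eqP => eab; apply: (disjointE d a1); rewrite eab.
suff -> : A = B by [].
apply/eqP; rewrite eqEsubset AB; apply/subsetP => c cB; apply/negPn/negP => cA.
have d' : [disjoint B2 & B1] by rewrite disjoint_sym.
move: (cB); rewrite -e inE => /orP[c1'|c2'].
  have ba : b != a by rewrite eq_sym.
  have := h b a c bA aA ba cA.
  by rewrite (depth_split c2 c1 d' b2 c1') (depth_split c2 c1 d' b2 a1) ltxx.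
have := h a b c aA bA ab cA.
by rewrite (depth_split c1 c2 d a1 c2') (depth_split c1 c2 d a1 b2) ltxx.
Qed.

End OneTree.

Lemma depth_inj sg1 sg2 : is_rmst sg1 -> is_rmst sg2 ->
  (forall a b, a != b -> depth sg1 a b = depth sg2 a b) -> same_rooted sg1 sg2.
Proof.
move=> h1 h2 e.
have neq (A : {set X}) (a b : X) : a \in A -> b \notin A -> a != b.
  by move=> aA; apply: contraNneq => <-.
have eC : sg1.1 = sg2.1.
  apply/setP => A; apply/(clusterP h1)/(clusterP h2) => -[A0 h]; split => // a b c aA bA ab cA.
    by rewrite -!e ?h // (neq A).
  by rewrite !e ?h // (neq A).
split=> // A; have [m] := ubnP (#|X| - #|A|)%N; elim: m A => // m IH A mA AC iA.
have /andP[A1 A2] := iA.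
have [B1 [B2 [a [b [[c1 c2] d eA a1 b2]]]]] := cluster_children h1 AC A1.
have ab : a != b by apply/eqP => eab; apply: (disjointE d a1); rewrite eab.
have := e a b ab; rewrite (depth_split h1 c1 c2 d a1 b2).
rewrite eC in c1 c2; rewrite (depth_split h2 c1 c2 d a1 b2) eA.
have AT : A != [set: X] by apply: contraTneq A2 => ->; rewrite cardsT ltnn.
rewrite (bigD1 A) /=; last by rewrite AC AT subxx.
rewrite [RHS](bigD1 A) /=; last by rewrite -eC AC AT subxx.
rewrite -eC; set S1 := (X in _ + X = _ -> _); set S2 := (X in _ = _ + X -> _).
suff -> : S1 = S2 by move/addIr.
apply: eq_bigr => B /andP[/and3P[BC BT AB] BA].
have lt : (#|A| < #|B|)%N by apply: proper_card; rewrite properEneq eq_sym BA AB.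
have ltX : (#|B| < #|X|)%N by rewrite -cardsT; apply: proper_card; rewrite properEneq BT subsetT.
apply: IH => //; last by rewrite /internal ltX (leq_trans A1 (ltnW lt)).
by move: mA lt ltX; clear; lia.
Qed.

Lemma identify_rooted sg1 sg2 : (5 <= #|X|)%N -> is_rmst sg1 -> is_rmst sg2 ->
  gtprob sg1 =1 gtprob sg2 -> same_rooted sg1 sg2.
Proof.
move=> X5 h1 h2 eg; apply: depth_inj => //.
have [t1 s1] := rmst_tree h1; have [t2 s2] := rmst_tree h2.
have [K hK] := all_const X5 s1 s2 eg.
have X1 : (1 < #|X|)%N by exact: leq_trans X5.
have [a [b [ab d1]]] := root_pair h1 X1; have [a' [b' [ab' d2]]] := root_pair h2 X1.
have e p q : p != q -> sg1.2 [set: X] + depth sg1 p q = sg2.2 [set: X] + depth sg2 p q + K.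
  by move=> pq; rewrite -(dep_depth p q s1) -(dep_depth p q s2); exact: hK.
have e1 := e a b ab; have e2 := e a' b' ab'.
have g1 := depth_ge0 h1 ab'; have g2 := depth_ge0 h2 ab.
by move=> p q pq; have := e p q pq; lra.
Qed.

End Reconstruct.

(** * Four taxa *)

Lemma neq4 (X : eqType) (a b c d : X) : uniq [:: a; b; c; d] ->
  (((a == b) = false) * ((a == c) = false) * ((a == d) = false) *
   ((b == c) = false) * ((b == d) = false) * ((c == d) = false) *
   ((b == a) = false) * ((c == a) = false) * ((d == a) = false) *
   ((c == b) = false) * ((d == b) = false) * ((d == c) = false)).
Proof.
rewrite /= !inE !negb_or => /and4P[/and3P[/negbTE n1 /negbTE n2 /negbTE n3]
  /andP[/negbTE n4 /negbTE n5] /negbTE n6 _].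
by repeat apply: pair; rewrite // eq_sym.
Qed.

Section FourTaxa.
Variables (R : realType) (X : finType).
Implicit Types (sg : rmst R X).

Section Labelled.
Variables (a b c d : X).
Hypothesis u : uniq [:: a; b; c; d].
Hypothesis X4 : #|X| = 4%N.

Lemma all4 x : x \in [:: a; b; c; d].
Proof.
have e : [set y in [:: a; b; c; d]] = [set: X].
  apply/eqP; rewrite eqEcard subsetT cardsT X4 cardsE (card_uniqP u) //.
by have := in_setT x; rewrite -e inE.
Qed.

Lemma eq_set4 (A B : {set X}) :
  (A == B) = [&& (a \in A) == (a \in B), (b \in A) == (b \in B),
                 (c \in A) == (c \in B) & (d \in A) == (d \in B)].
Proof.
apply/eqP/and4P => [->//|[/eqP h1 /eqP h2 /eqP h3 /eqP h4]].
by apply/setP => x; have := all4 x; rewrite !inE => /or4P[]/eqP->.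
Qed.

Lemma eq_pair (B : {set X}) : (B == [set a; b]) = [&& a \in B, b \in B, c \notin B & d \notin B].
Proof.
rewrite eq_set4 !inE !eqxx !(neq4 u) /=.
by case: (a \in B); case: (b \in B); case: (c \in B); case: (d \in B).
Qed.

Lemma compl_pair : ~: [set a; b] = [set c; d].
Proof.
by apply/eqP; rewrite eq_set4 !inE !eqxx !(neq4 u).
Qed.

Lemma internal_pair : internal [set a; b].
Proof. by rewrite /internal cards2 X4 (neq4 u). Qed.

End Labelled.

Lemma perm4 (a b c d a' b' c' d' : X) : uniq [:: a; b; c; d] ->
  perm_eq [:: a'; b'; c'; d'] [:: a; b; c; d] -> uniq [:: a'; b'; c'; d'].
Proof. by move=> u h; rewrite (perm_uniq h). Qed.

Definition ind (b : bool) : R := b%:R.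

Lemma ulen_sum sg a b c d : uniq [:: a; b; c; d] -> #|X| = 4%N ->
  ulen sg [set a; b] = \sum_(B in sg.1 | B != [set: X])
    sg.2 B * (ind (B == [set a; b]) + ind (B == [set c; d])).
Proof.
move=> u X4.
have u' : uniq [:: c; d; a; b] by apply: perm4 u _; permt.
have one p q r s : uniq [:: p; q; r; s] ->
   \sum_(B in sg.1 | B != [set: X]) sg.2 B * ind (B == [set p; q]) =
   if [set p; q] \in sg.1 then sg.2 [set p; q] else 0.
  move=> v; rewrite big_mkcondr /=.
  have pT : [set p; q] != [set: X].
    have := internal_pair v X4; rewrite /internal => /andP[_ h].
    by apply: contraTneq h => ->; rewrite cardsT ltnn.
  case: ifP => pC.
    rewrite (bigD1 [set p; q]) //= pT /ind eqxx mulr1 big1 ?addr0 // => B /andP[_ /negbTE ->].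
    by rewrite mulr0; case: ifP.
  apply: big1 => B BC; rewrite /ind; case: (eqVneq B [set p; q]) => [e|_].
    by rewrite e pC in BC.
  by rewrite mulr0; case: ifP.
rewrite /ulen (compl_pair u X4) (internal_pair u X4) (internal_pair u' X4) !andbT.
rewrite -(one _ _ _ _ u) -(one _ _ _ _ u') -big_split /=.
by apply: eq_bigr => B _; rewrite mulrDr.
Qed.

Lemma ulen_diff sg a b c d : uniq [:: a; b; c; d] -> #|X| = 4%N ->
  ulen sg [set a; b] - ulen sg [set a; c] =
  depth sg a b + depth sg c d - depth sg a c - depth sg b d.
Proof.
move=> u X4.
have u1 : uniq [:: a; c; b; d] by apply: perm4 u _; permt.
have u2 : uniq [:: c; d; a; b] by apply: perm4 u _; permt.
have u3 : uniq [:: b; d; a; c] by apply: perm4 u _; permt.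
have dE p q : depth sg p q = \sum_(B in sg.1 | B != [set: X])
    sg.2 B * ind ((p \in B) && (q \in B)).
  rewrite /depth big_mkcondr [RHS]big_mkcondr /=; apply: eq_bigr => B _.
  rewrite /ind; case: (B != _) => //=; case: (_ && _); by rewrite ?mulr1 ?mulr0.
rewrite (ulen_sum sg u X4) (ulen_sum sg u1 X4) !dE -!sumrB -big_split /= -!sumrB.
apply: eq_bigr => B _; rewrite (eq_pair u X4) (eq_pair u1 X4) (eq_pair u2 X4) (eq_pair u3 X4) /ind.
by case: (a \in B); case: (b \in B); case: (c \in B); case: (d \in B) => /=; ring.
Qed.

Lemma ulen_ge0 sg A : is_rmst sg -> 0 <= ulen sg A.
Proof.
move=> [_ h]; rewrite /ulen addr_ge0 //; case: ifP => // /andP[h1 h2]; apply: ltW; exact: h.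
Qed.

Lemma ulen_pos sg a b c d : is_rmst sg -> uniq [:: a; b; c; d] -> #|X| = 4%N ->
  ([set a; b] \in unroot sg.1) = (0 < ulen sg [set a; b]).
Proof.
move=> h u X4; have u' : uniq [:: c; d; a; b] by apply: perm4 u _; permt.
have hp := h.2; have i1 := internal_pair u X4; have i2 := internal_pair u' X4.
have -> : ([set a; b] \in unroot sg.1) = ([set a; b] \in sg.1) || ([set c; d] \in sg.1).
  rewrite inE -(compl_pair u X4); congr (_ || _); apply/imsetP/idP => [[B BC ->]|hC].
    by rewrite setCK.
  by exists (~: [set a; b]); rewrite ?setCK.
rewrite /ulen (compl_pair u X4) i1 i2 !andbT.
case: ifP => h1; case: ifP => h2; rewrite /= ?addr0 ?add0r ?ltxx ?hp //.
by rewrite addr_gt0 ?hp.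
Qed.

Lemma ulen_excl sg a b c d : is_rmst sg -> uniq [:: a; b; c; d] -> #|X| = 4%N ->
  ulen sg [set a; b] = 0 \/ ulen sg [set a; c] = 0.
Proof.
move=> h u X4.
have u1 : uniq [:: a; c; b; d] by apply: perm4 u _; permt.
have u2 : uniq [:: c; d; a; b] by apply: perm4 u _; permt.
have u3 : uniq [:: b; d; a; c] by apply: perm4 u _; permt.
have [[_ _ _ Cn _] _] := h.
have bad p q r s : uniq [:: p; q; r; s] -> [set p; q] \in sg.1 -> [set p; r] \in sg.1 -> False.
  move=> v h1 h2.
  case/or3P: (Cn _ _ h1 h2) => [/subsetP/(_ q)|/subsetP/(_ r)|].
  - by rewrite !inE eqxx orbT !(neq4 v) => /(_ isT).
  - by rewrite !inE eqxx orbT !(neq4 v) => /(_ isT).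
  - by move=> /pred0P/(_ p); rewrite /= !inE eqxx.
rewrite /ulen (compl_pair u X4) (compl_pair u1 X4).
case h1: ([set a; b] \in sg.1); case h2: ([set c; d] \in sg.1);
case h3: ([set a; c] \in sg.1); case h4: ([set b; d] \in sg.1) => /=;
  rewrite ?addr0; try (by left); try (by right); exfalso.
all: try (by apply: (bad a b c d)).
all: try (by apply: (bad b a d c); [apply: perm4 u _; permt | rewrite setUC | ]).
all: try (by apply: (bad c d a b); [ | | rewrite setUC]).
all: try (by apply: (bad d c b a); [apply: perm4 u _; permt | rewrite setUC | rewrite setUC]).
Qed.

Lemma set2_label (A : {set X}) : #|X| = 4%N -> #|A| = 2%N ->
  exists a b c d, uniq [:: a; b; c; d] /\ A = [set a; b].
Proof.
move=> X4 A2; have /eqP/cards2P[a [b [ab eA]]] := A2.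
have : #|~: A| = 2%N by have := cardsC A; rewrite A2 X4; lia.
move/eqP/cards2P => [c [d [cd eC]]].
have cA : c \notin A by rewrite -in_setC eC !inE eqxx.
have dA : d \notin A by rewrite -in_setC eC !inE eqxx orbT.
exists a, b, c, d; split => //; move: cA dA; rewrite eA /= !inE !negb_or ab cd.
by rewrite ![a == _]eq_sym ![b == _]eq_sym => /andP[-> ->] /andP[-> ->].
Qed.

Lemma unroot_card sg (A : {set X}) : is_rmst sg -> #|X| = 4%N -> #|A| != 2%N -> A \in unroot sg.1.
Proof.
move=> [[CT Cs _ _ _] _] X4 A2; have le : (#|A| <= 4)%N by rewrite -X4 max_card.
have inC (B : {set X}) : B \in sg.1 -> B \in unroot sg.1 /\ ~: B \in unroot sg.1.
  by move=> h; rewrite !inE h imset_f ?orbT.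
have small (B : {set X}) : (#|B| == 1)%N -> B \in unroot sg.1 /\ ~: B \in unroot sg.1.
  by move=> /cards1P[x ->]; exact: inC.
have cC := cardsC A; rewrite X4 in cC.
have [A1|A1] := eqVneq #|A| 1%N; first by have [] := small A _; rewrite ?A1.
have [A3|A3] := eqVneq #|A| 3%N.
  have [|_] := small (~: A); last by rewrite setCK.
  by apply/eqP; lia.
have [A0|A0] := eqVneq #|A| 0%N.
  have -> : A = ~: [set: X] by rewrite setCT; apply/eqP; rewrite -cards_eq0 A0.
  exact: (inC _ CT).2.
have -> : A = [set: X] by apply/eqP; rewrite eqEcard subsetT cardsT X4; lia.
exact: (inC _ CT).1.
Qed.

Lemma identify_unrooted sg1 sg2 : #|X| = 4%N -> is_rmst sg1 -> is_rmst sg2 ->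
  gtprob sg1 =1 gtprob sg2 -> same_unrooted sg1 sg2.
Proof.
move=> X4 h1 h2 eg; have [t1 s1] := rmst_tree h1; have [t2 s2] := rmst_tree h2.
have dq a b c d : uniq [:: a; b; c; d] ->
    ulen sg1 [set a; b] - ulen sg1 [set a; c] = ulen sg2 [set a; b] - ulen sg2 [set a; c].
  move=> u; have := quartet_diff s1 s2 eg u.
  rewrite /= !(dep_depth _ _ s1) !(dep_depth _ _ s2).
  by rewrite (ulen_diff sg1 u X4) (ulen_diff sg2 u X4); lra.
have eu a b c d : uniq [:: a; b; c; d] -> ulen sg1 [set a; b] = ulen sg2 [set a; b].
  move=> u; have d1 := dq a b c d u.
  have p1 := ulen_ge0 [set a; b] h1; have p2 := ulen_ge0 [set a; b] h2.
  have p3 := ulen_ge0 [set a; c] h1; have p4 := ulen_ge0 [set a; c] h2.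
  by have [z|z] := ulen_excl h1 u X4; have [z'|z'] := ulen_excl h2 u X4; lra.
split.
  apply/setP => A; case: (eqVneq #|A| 2%N) => A2; last by rewrite !unroot_card.
  have [a [b [c [d [u ->]]]]] := set2_label X4 A2.
  by rewrite (ulen_pos h1 u X4) (ulen_pos h2 u X4) (eu _ _ _ _ u).
move=> A _ /andP[A1 A3]; have A2 : #|A| = 2%N by move: A1 A3; rewrite X4; lia.
by have [a [b [c [d [u ->]]]]] := set2_label X4 A2; exact: eu u.
Qed.

End FourTaxa.

(* The splits present in the unrooted gene tree of a fully coalesced state, and
   the split systems of the three quartet topologies. *)
Definition ugene (x : gst) (m : bitseq) : bool :=
  [|| count id m == 1%N, count id (map negb m) == 1%N, m \in x.2 | map negb m \in x.2].

Definition uquartet (p m : bitseq) : bool :=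
  [|| count id m != 2%N, m == p | m == map negb p].

Lemma absorbed4 x : x \in reach 4 -> (size x.1 <= 1)%N ->
  nseq 4 true \in x.2 /\ exists2 p, p \in pairs4 &
    {in masks 4, ugene x =1 uquartet p} /\
    {in pairs4, forall q, ((q \in x.2) || (map negb q \in x.2)) = (q == p)}.
Proof.
have /allP h : all (fun x => (size x.1 <= 1)%N ==> (nseq 4 true \in x.2) && has (fun p =>
   all (fun m => ugene x m == uquartet p m) (masks 4) &&
   all (fun q => ((q \in x.2) || (map negb q \in x.2)) == (q == p)) pairs4) pairs4) (reach 4).
  by vm_cast_no_check (erefl true).
move=> /h /implyP h1 /h1 /andP[h2 /hasP[p pp /andP[/allP h3 /allP h4]]].
by split=> //; exists p => //; split=> [m|q] hm; apply/eqP; [exact: h3|exact: h4].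
Qed.

Section Nonidentifiable.
Variables (R : realType) (X : finType).
Implicit Types (sg : rmst R X) (T : {set {set X}}).

Definition quartet_splits (ys : seq X) (p : bitseq) : {set {set X}} :=
  [set B | uquartet p (mk ys B)].

Lemma EO_topology sg t a b c d T : species_tree sg t -> uniq [:: a; b; c; d] -> #|X| = 4%N ->
  let ys := [:: a; b; c; d] in
  gtprob sg T = \sum_(p <- pairs4) (T == quartet_splits ys p)%:R * EO sg (odisp R ys p).
Proof.
move=> st u X4 ys; have [w e ec ps] := st.
have in4 := all4 u X4.
have -> : gtprob sg T = EO sg (fun T' => (T' == T)%:R).
  rewrite /EO (bigD1 T) //= eqxx mulr1 big1 ?addr0 // => T' /negbTE ->; by rewrite mulr0.
apply/eqP; rewrite -subr_eq0; apply/eqP.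
transitivity (EO sg (fun T' => (T' == T)%:R -
    \sum_(p <- pairs4) (T == quartet_splits ys p)%:R * odisp R ys p T')).
  rewrite /EO; under [RHS]eq_bigr do rewrite mulrBr.
  rewrite sumrB; congr (_ - _).
  under eq_bigr do rewrite mulr_sumr.
  rewrite exchange_big /=; apply: eq_bigr => T' _; rewrite mulr_sumr.
  by apply: eq_bigr => p _; rewrite mulrCA.
have X1 : (1 < #|X|)%N by rewrite X4.
rewrite (EO_Exroot _ w e ec X1).
transitivity (Exg sg.2 t ys (fun=> 0)); last by rewrite /Exg Ex_cst.
apply: Exroot_harmonic; [exact: w|exact: u|by []|exact: sub_clT|vmt|move=> s gs s1].
have [_ _ _ _ /(_ ys u isT)] := gs; rewrite e => /(_ (fun y _ => in_setT y)) rs.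
have [fT [p pp [h3 h4]]] := absorbed4 rs (rho_absorbed ys s1).
have uE : unroot (rooted_gene s) = quartet_splits ys p.
  apply/setP => B; rewrite [RHS]inE -h3 ?mem_masks ?size_mk //.
  have cm (D : {set X}) : count id (mk ys D) = #|D|.
    rewrite count_map -size_filter -(card_uniqP (filter_uniq _ u)).
    by apply: eq_card => y; rewrite mem_filter in4 andbT.
  have inj D D' : mk ys D = mk ys D' -> D = D'.
    by move=> eD; apply/setP => y; exact: (mk_inj eD).
  have mem2 (D : {set X}) : (1 < #|D|)%N -> (mk ys D \in (rho ys s).2) = (D \in s.2).
    move=> D1; rewrite mem_norm size_mk eqxx cm D1 /=.
    apply/smasksP/idP => [[D' D'S /inj->//]|DS]; by exists D.
  have mkC (D : {set X}) : map negb (mk ys D) = mk ys (~: D).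
    by rewrite /mk -map_comp; apply: eq_map => y; rewrite /= inE.
  have TS : [set: X] \in s.2.
    rewrite -mem2 ?cardsT // ; suff -> : mk ys [set: X] = nseq 4 true by [].
    by rewrite /mk /= !inE.
  have lt2 (D : {set X}) : (mk ys D \in (rho ys s).2) -> D \in s.2.
    by move=> h; rewrite -mem2 //; move: h; rewrite mem_norm cm => /and3P[].
  have rg (D : {set X}) : (D \in rooted_gene s) = (D \in s.2) || (#|D| == 1%N).
    rewrite inE; congr (_ || _); apply/imsetP/cards1P => [[y _ ->]|[y ->]]; by exists y.
  have uu : (B \in unroot (rooted_gene s)) = (B \in rooted_gene s) || (~: B \in rooted_gene s).
    rewrite inE; congr (_ || _); apply/imsetP/idP => [[D hD ->]|hB]; first by rewrite setCK.
    by exists (~: B); rewrite ?setCK.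
  rewrite uu /ugene mkC !cm !rg.
  have half (D : {set X}) : (D \in s.2) || (#|D| == 1%N) ->
      [|| #|D| == 1%N, #|~: D| == 1%N, mk ys D \in (rho ys s).2 | mk ys (~: D) \in (rho ys s).2].
    case/orP => [DS|->//]; case: (ltngtP #|D| 1) => D1 //=.
      have -> : D = finset.set0 by apply/eqP; rewrite -cards_eq0 -leqn0 -ltnS.
      by rewrite setC0 (mem2 [set: X]) ?cardsT // TS !orbT.
    by rewrite mem2 // DS orbT.
  apply/orP/idP => [[/half//|/half]|].
    by rewrite setCK => /or4P[]->; rewrite ?orbT.
  by case/or4P => [->|->|/lt2->|/lt2->]; rewrite ?orbT; [left|right|left|right].
have dj q : q \in pairs4 -> odisp R ys q (unroot (rooted_gene s)) = (q == p)%:R.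
  move=> hq; rewrite /odisp (disp_rho _ u) ?h4 //;
  by move: hq; rewrite !inE => /or3P[]/eqP->.
rewrite uE in dj *; apply/eqP; rewrite subr_eq0; apply/eqP.
rewrite (eq_big_seq (fun q => (T == quartet_splits ys q)%:R * (q == p)%:R)); last first.
  by move=> q hq; rewrite dj.
rewrite (bigD1_seq p) //= eqxx mulr1 big1 ?addr0 1?eq_sym // => q /negbTE ->; by rewrite mulr0.
Qed.

Lemma odisp_quartet sg t a b c d : species_tree sg t -> uniq [:: a; b; c; d] ->
  let D := depth sg in let e := expR (- (D a b + D c d - D a c - D b d)) in
  D a c + D b d < D a b + D c d ->
  [/\ 3 * EO sg (odisp R [:: a; b; c; d] [:: true; true; false; false]) = 3 - 2 * e,
      3 * EO sg (odisp R [:: a; b; c; d] [:: true; false; true; false]) = e &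
      3 * EO sg (odisp R [:: a; b; c; d] [:: true; false; false; true]) = e].
Proof.
move=> st u D e lt; have [w ec ec' ps] := st.
have sc p : 3 * EO sg (odisp R [:: a; b; c; d] p) = EO sg (fun T => 3 * odisp R [:: a; b; c; d] p T).
  by rewrite /EO mulr_sumr; apply: eq_bigr => T _; rewrite mulrCA.
have ee : e = expR (- (dep sg.2 t a b + dep sg.2 t c d - dep sg.2 t a c - dep sg.2 t b d)).
  by rewrite !(dep_depth _ _ st) /e /D; congr expR; ring.
rewrite !sc !(EO_quartet w ec ec' u) // ee.
by apply: Exg4_quartet => //; [exact: sub_clT | rewrite !(dep_depth _ _ st) -/D; lra].
Qed.

Section Example.
Variables (a b c d : X).
Hypothesis u : uniq [:: a; b; c; d].
Hypothesis X4 : #|X| = 4%N.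

Definition balanced_tree : {set {set X}} :=
  [set B : {set X} | [|| #|B| == 1%N, B == [set a; b], B == [set c; d] | B == [set: X]]].

Definition balanced (x y : R) : rmst R X :=
  (balanced_tree, fun B => if B == [set a; b] then x else y).

Lemma ucd : uniq [:: c; d; a; b]. Proof. by apply: perm4 u _; permt. Qed.

Lemma balanced_rmst x y : 0 < x -> 0 < y -> is_rmst (balanced x y).
Proof.
move=> x0 y0; split=> [|A _ _ /=]; last by case: ifP.
have cab := compl_pair u X4; have ccd := compl_pair ucd X4.
split.
- by rewrite inE eqxx !orbT.
- by move=> z; rewrite inE cards1 eqxx.
- rewrite inE cards0 /= !negb_or; apply/and3P; split; apply/eqP => /setP.
  + by move=> /(_ a); rewrite !inE eqxx.
  + by move=> /(_ c); rewrite !inE eqxx.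
  + by move=> /(_ a); rewrite !inE.
- have single z (B : {set X}) : [|| [set z] \subset B, B \subset [set z] | [disjoint [set z] & B]].
    by rewrite sub1set disjoints1; case: (z \in B); rewrite ?orbT.
  have dj : [disjoint [set a; b] & [set c; d]] by rewrite -cab disjoints_subset setCK.
  move=> A B; rewrite !inE.
  case/or4P => [/cards1P[z ->] _|/eqP->|/eqP->|/eqP-> _]; first exact: single.
  + case/or4P => [/cards1P[z ->]|/eqP->|/eqP->|/eqP->]; rewrite ?subxx ?subsetT ?dj ?orbT //.
    by have := single z [set a; b]; rewrite disjoint_sym orbCA orbA orbC orbA.
  + case/or4P => [/cards1P[z ->]|/eqP->|/eqP->|/eqP->]; rewrite ?subxx ?subsetT ?orbT //.
      by have := single z [set c; d]; rewrite disjoint_sym orbCA orbA orbC orbA.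
    by rewrite disjoint_sym dj !orbT.
  + by rewrite subsetT orbT.
- have two p q : p != q -> exists B1 B2, [/\ B1 \in balanced_tree, B2 \in balanced_tree,
      [disjoint B1 & B2] & B1 :|: B2 = [set p; q]].
    move=> pq; exists [set p], [set q]; rewrite !inE !cards1 !eqxx; split=> //.
    by rewrite disjoints1 inE.
  move=> A; rewrite inE => /or4P[/eqP->|/eqP->|/eqP->|/eqP-> _] //.
  + by move=> _; apply: two; rewrite (neq4 u).
  + by move=> _; apply: two; rewrite (neq4 u).
  + exists [set a; b], [set c; d]; rewrite !inE !eqxx !orbT -cab; split => //.
      by rewrite disjoints_subset setCK.
    by rewrite setUCr.
Qed.

Lemma balanced_depth x y :
  [/\ depth (balanced x y) a b = x, depth (balanced x y) c d = y,
      depth (balanced x y) a c = 0 & depth (balanced x y) b d = 0].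
Proof.
have dE p q (F : {set X} -> bool) : (forall B, [&& B \in balanced_tree, B != [set: X], p \in B & q \in B] = F B) ->
    depth (balanced x y) p q = \sum_(B | F B) (if B == [set a; b] then x else y).
  by move=> h; apply: eq_bigl.
have key p q (B : {set X}) : p != q -> [&& B \in balanced_tree, B != [set: X], p \in B & q \in B] =
    ((B == [set a; b]) || (B == [set c; d])) && ((p \in B) && (q \in B)).
  move=> pq; rewrite inE; case: (boolP ((p \in B) && (q \in B))) => /= [|]; last by rewrite !andbF.
  case/andP => pB qB; rewrite !andbT.
  have -> : #|B| == 1%N = false.
    apply/negP => /cards1P[z ez]; move: pB qB; rewrite ez !inE => /eqP pz /eqP qz.
    by rewrite pz qz eqxx in pq.
  have nT p' q' r' s' : uniq [:: p'; q'; r'; s'] -> [set p'; q'] != [set: X].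
    move=> v; have := internal_pair v X4; rewrite /internal => /andP[_ h].
    by apply: contraTneq h => ->; rewrite cardsT ltnn.
  case: (eqVneq B [set: X]) => [->|_]; last by rewrite /= orbF andbT.
  by rewrite ![[set: X] == _]eq_sym (negbTE (nT _ _ _ _ u)) (negbTE (nT _ _ _ _ ucd)).
have cd0 : ([set c; d] == [set a; b]) = false.
  by apply/eqP => /setP/(_ a); rewrite !inE eqxx !(neq4 u).
split.
- rewrite (dE _ _ (pred1 [set a; b])) ?big_pred1_eq ?eqxx // => B.
  rewrite key ?(neq4 u) //=; case: (eqVneq B [set a; b]) => [->|_] /=; first by rewrite !inE !eqxx orbT.
  by case: eqP => [->|//]; rewrite !inE !(neq4 u).
- rewrite (dE _ _ (pred1 [set c; d])) ?big_pred1_eq ?cd0 // => B.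
  rewrite key ?(neq4 u) //=; case: (eqVneq B [set c; d]) => [->|_] /=; first by rewrite !inE !eqxx !orbT.
  by rewrite orbF; case: eqP => [->|//]; rewrite !inE !(neq4 u).
- rewrite (dE _ _ pred0) ?big_pred0_eq // => B; rewrite key ?(neq4 u) //=.
  by apply/negP => /andP[/orP[]/eqP->]; rewrite !inE !(neq4 u) ?andbF.
- rewrite (dE _ _ pred0) ?big_pred0_eq // => B; rewrite key ?(neq4 u) //=.
  by apply/negP => /andP[/orP[]/eqP->]; rewrite !inE !(neq4 u) ?andbF.
Qed.

Lemma balanced_gtprob x y : 0 < x -> 0 < y -> gtprob (balanced x y) =1 gtprob (balanced y x).
Proof.
move=> x0 y0 T.
have h1 := balanced_rmst x0 y0; have h2 := balanced_rmst y0 x0.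
have [t1 s1] := rmst_tree h1; have [t2 s2] := rmst_tree h2.
rewrite (EO_topology T s1 u X4) (EO_topology T s2 u X4).
have [e1 e2 e3 e4] := balanced_depth x y; have [f1 f2 f3 f4] := balanced_depth y x.
have [|q1 q2 q3] := odisp_quartet s1 u; first by rewrite e1 e2 e3 e4; lra.
have [|r1 r2 r3] := odisp_quartet s2 u; first by rewrite f1 f2 f3 f4; lra.
rewrite e1 e2 e3 e4 in q1 q2 q3; rewrite f1 f2 f3 f4 in r1 r2 r3.
have exy : expR (- (y + x - 0 - 0)) = expR (- (x + y - 0 - 0)) by congr expR; ring.
rewrite exy in r1 r2 r3; move: q1 q2 q3 r1 r2 r3.
rewrite !big_cons !big_nil.
set E := expR _; move: E => E q1 q2 q3 r1 r2 r3.
by congr (_ * _ + (_ * _ + (_ * _ + _))); lra.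
Qed.

End Example.

Lemma not_identify_rooted : #|X| = 4%N -> exists s1 s2 : rmst R X,
  [/\ is_rmst s1, is_rmst s2, gtprob s1 =1 gtprob s2 & ~ same_rooted s1 s2].
Proof.
move=> X4; have [A A2] : exists A : {set X}, #|A| = 2%N.
  have /card_gt1P[a [b [_ _ ab]]] : (1 < #|X|)%N by rewrite X4.
  by exists [set a; b]; rewrite cards2 ab.
have [a [b [c [d [u _]]]]] := set2_label X4 A2.
exists (balanced a b c d 1 2), (balanced a b c d 2 1); split.
- exact: balanced_rmst.
- exact: balanced_rmst.
- exact: balanced_gtprob.
move=> [_ /(_ [set a; b])] /=; rewrite inE eqxx !orbT (internal_pair u X4) => /(_ isT isT).
by lra.
Qed.

End Nonidentifiable.

Theorem theorem1 (R : realType) (X : finType) :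
  ((5 <= #|X|)%N ->
     forall s1 s2 : rmst R X, is_rmst s1 -> is_rmst s2 ->
       gtprob s1 =1 gtprob s2 -> same_rooted s1 s2)
  /\
  (#|X| = 4%N ->
     (forall s1 s2 : rmst R X, is_rmst s1 -> is_rmst s2 ->
        gtprob s1 =1 gtprob s2 -> same_unrooted s1 s2)
     /\
     (exists s1 s2 : rmst R X, [/\ is_rmst s1, is_rmst s2,
        gtprob s1 =1 gtprob s2 & ~ same_rooted s1 s2])).
Proof.
split=> [X5 s1 s2|X4]; first exact: identify_rooted.
by split=> [s1 s2|]; [exact: identify_unrooted | exact: not_identify_rooted].
Qed.
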